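(* Let $L>2\pi\sqrt{\frac{\sqrt5}{\sqrt5-1}}$ be fixed. For each $c_0\in\left(0,\frac12\sqrt{5-\frac{L^4}{(L^2-4\pi^2)^2}}\right)$ consider the unique $\alpha_{4,0}\in\left(\frac{-1+\sqrt{1+4r}}2,\frac{-3+\sqrt{9+48r}}4\right)$, with $r=1-c_0^2$, such that $T(\alpha_{4,0},c_0)=L$. Then: (1) there exist an interval $I_1$ around $c_0$, an interval $I_2$ around $\alpha_{4,0}$ and a unique smooth function $\Lambda:I_1\to I_2$ such that $\Lambda(c_0)=\alpha_{4,0}$ and $$T(\Lambda(c),c)=\frac{2\sqrt{2\sqrt3(5-4c^2)}\,K(k(\Lambda(c),c))}{\sqrt{\Lambda(c)\sqrt{\beta(\Lambda(c),c)}}}=L\quad\text{for all }c\in I_1,$$ where $\alpha_4(c)=\Lambda(c)\in I_2$ and $k^2=k^2(c)\in(0,1)$; (2) the dnoidal wave $\phi_c:=\phi(\cdot,\Lambda(c))$ determined by $\alpha_4=\Lambda(c)$ has fundamental period $L$ and satisfies $-\phi''+\frac rs\phi-\frac1s(\phi^3+\phi^5)=0$ with $r=1-c^2$, $s=5-4c^2$; moreover the mapping $c\in I_1\mapsto\phi_c\in H^n_{per}([0,L])$ is smooth for all $n\in\mathbb N$; (3) the interval $I_1$ can be chosen as $\left[0,\frac12\sqrt{5-\frac{L^4}{(L^2-4\pi^2)^2}}\right)$.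
   Context: For $c\in[0,1)$ let $r=1-c^2$, $s=5-4c^2$. For $\alpha_4\in\left(\frac{-1+\sqrt{1+4r}}2,\frac{-3+\sqrt{9+48r}}4\right)$ put $\beta=\beta(\alpha_4,c)=-4\alpha_4^2-4\alpha_4+3+16r$, $\alpha_1=\frac{-2\alpha_4-3-\sqrt3\sqrt\beta}4$, $\alpha_3=\frac{-2\alpha_4-3+\sqrt3\sqrt\beta}4$ (so $\alpha_1<0<\alpha_3<\alpha_4$), and let $k=k(\alpha_4,c)\in(0,1)$ be given by $$k^2=\frac{-\alpha_1(\alpha_4-\alpha_3)}{\alpha_4(\alpha_3-\alpha_1)}=\frac{6\alpha_4^2+9\alpha_4-12r+\alpha_4\sqrt3\sqrt\beta}{2\sqrt3\,\alpha_4\sqrt\beta}.$$ With $K(k)=\int_0^1\frac{dt}{\sqrt{(1-k^2t^2)(1-t^2)}}$ and Jacobi elliptic functions $\mathrm{sn},\mathrm{dn}$ of modulus $k$, set $$T(\alpha_4,c)=\frac{2\sqrt{2\sqrt3\,s}\,K(k)}{\sqrt{\alpha_4\sqrt\beta}},\qquad \phi(x)=\phi(x,\alpha_4)=\frac{\sqrt{\alpha_4}\,\mathrm{dn}(\gamma x,k)}{\sqrt{1+\frac{\alpha_4k^2}{-\alpha_1}\mathrm{sn}^2(\gamma x,k)}},\qquad \gamma=\sqrt{\frac{\alpha_4(\alpha_3-\alpha_1)}{3s}}.$$ $H^n_{per}([0,L])$ is the $L$-periodic Sobolev space of order $n$. *)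

(* Defs.v *)
From HB Require Import structures.
From mathcomp Require Import all_boot all_order all_algebra.
From mathcomp Require Import all_classical all_reals all_analysis.
Set Implicit Arguments.
Unset Strict Implicit.
Unset Printing Implicit Defensive.
Import Order.TTheory GRing.Theory Num.Theory.
Import numFieldNormedType.Exports.
Local Open Scope classical_set_scope.
Local Open Scope ring_scope.

Section EllipticFunctions.
Context {R : realType}.
Implicit Types k u x : R.
Local Notation mu := (@lebesgue_measure R).

(* The integrand is singular at t = 1; the junk value 0^-1 = 0 there is
   irrelevant to the Lebesgue integral. *)
Definition ellipticK k : R :=
  \int[mu]_(t in `[0, 1])
    (Num.sqrt ((1 - k ^+ 2 * t ^+ 2) * (1 - t ^+ 2)))^-1.

(* Oriented integral from 0 to x, for x of either sign. *)
Definition ellipticF k x : R :=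
  let f t := (Num.sqrt (1 - k ^+ 2 * sin t ^+ 2))^-1 in
  if 0 <= x then \int[mu]_(t in `[0, x]) f t
  else - \int[mu]_(t in `[x, 0]) f t.

(* For 0 <= k < 1, ellipticF k is an increasing bijection of R, so that the
   set below is a singleton. *)
Definition jacobi_am u k : R := xget 0 [set x | ellipticF k x = u].
Definition jacobi_sn u k : R := sin (jacobi_am u k).
Definition jacobi_dn u k : R :=
  Num.sqrt (1 - k ^+ 2 * jacobi_sn u k ^+ 2).

End EllipticFunctions.

Section DnoidalWaves.
Context {R : realType}.
Implicit Types a c x L : R.

Definition rc c : R := 1 - c ^+ 2.
Definition sc c : R := 5 - 4 * c ^+ 2.

(* The range allowed for the parameter alpha_4 at the speed c. *)
Definition alpha4_range c : set R :=
  `](- 1 + Num.sqrt (1 + 4 * rc c)) / 2,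
    (- 3 + Num.sqrt (9 + 48 * rc c)) / 4[.

(* In what follows, a stands for alpha_4. *)
Definition beta a c : R := - 4 * a ^+ 2 - 4 * a + 3 + 16 * rc c.
Definition alpha1 a c : R :=
  (- 2 * a - 3 - Num.sqrt 3 * Num.sqrt (beta a c)) / 4.
Definition alpha3 a c : R :=
  (- 2 * a - 3 + Num.sqrt 3 * Num.sqrt (beta a c)) / 4.

Definition modulus_sq a c : R :=
  - alpha1 a c * (a - alpha3 a c) / (a * (alpha3 a c - alpha1 a c)).
Definition modulus a c : R := Num.sqrt (modulus_sq a c).

Definition period a c : R :=
  2 * Num.sqrt (2 * Num.sqrt 3 * sc c) * ellipticK (modulus a c)
  / Num.sqrt (a * Num.sqrt (beta a c)).

Definition gamma_ a c : R :=
  Num.sqrt (a * (alpha3 a c - alpha1 a c) / (3 * sc c)).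

Definition dnoidal a c : R -> R := fun x =>
  Num.sqrt a * jacobi_dn (gamma_ a c * x) (modulus a c)
  / Num.sqrt (1 + a * modulus_sq a c / (- alpha1 a c)
                  * jacobi_sn (gamma_ a c * x) (modulus a c) ^+ 2).

Definition cmax L : R :=
  2^-1 * Num.sqrt (5 - L ^+ 4 / (L ^+ 2 - 4 * pi ^+ 2) ^+ 2).

Definition fundamental_period (f : R -> R) L : Prop :=
  [/\ 0 < L, periodic f L & forall p, 0 < p -> periodic f p -> L <= p].

Definition solves_profile_equation c (f : R -> R) : Prop :=
  forall x, [/\ derivable f x 1, derivable (derive1 f) x 1 &
    - derive1n 2 f x + rc c / sc c * f x - (sc c)^-1 * (f x ^+ 3 + f x ^+ 5) = 0].

End DnoidalWaves.

Section SmoothnessOnIntervals.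
Context {R : realType}.
Implicit Types (I : set R) (f : R -> R).

Definition interval_around (x : R) I : Prop := is_interval I /\ nbhs x I.

(* C^oo on a nondegenerate interval I, with one-sided derivatives at the
   endpoints that belong to I; D n is the n-th derivative. *)
Definition smooth_on I f : Prop :=
  exists D : nat -> R -> R,
    (forall c, I c -> D 0%N c = f c) /\
    (forall n c, I c ->
       (D n y - D n c) / (y - c) @[y --> within I c^'] --> D n.+1 c).

End SmoothnessOnIntervals.

Section PeriodicSobolev.
Context {R : realType}.
Variable L : R.
Local Notation mu := (@lebesgue_measure R).

Definition L2per (f : R -> R) : Prop :=
  [/\ measurable_fun setT f, periodic f L &
      (\int[mu]_(x in `[0%R, L]) ((f x) ^+ 2)%:E < +oo)%E].

Definition test_per (psi : R -> R) : Prop :=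
  periodic psi L /\ forall j x, derivable (derive1n j psi) x 1.

Definition weak_derivative_per (j : nat) (f g : R -> R) : Prop :=
  forall psi, test_per psi ->
    \int[mu]_(x in `[0, L]) (f x * derive1n j psi x) =
    (- 1) ^+ j * \int[mu]_(x in `[0, L]) (g x * psi x).

(* Weak derivatives are unique up to equality almost everywhere, so that the
   infimum is taken over at most one value; it is +oo when f has no weak
   derivatives up to order n in L2per. *)
Definition Hper_norm (n : nat) (f : R -> R) : \bar R :=
  sqrte (ereal_inf
    [set (\sum_(0 <= j < n.+1) \int[mu]_(x in `[0%R, L]) ((g j x) ^+ 2)%:E)%E
    | g in [set g : nat -> R -> R | forall j, (j <= n)%N ->
              L2per (g j) /\ weak_derivative_per j f (g j)]]).

Definition Hper (n : nat) : set (R -> R) :=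
  [set f | L2per f /\ (Hper_norm n f < +oo)%E].

(* C^oo curves in the space Hper n: D m is the m-th derivative of F, for the
   norm of Hper n. *)
Definition smooth_into_Hper (n : nat) (I : set R) (F : R -> R -> R) : Prop :=
  exists D : nat -> R -> R -> R,
    [/\ forall c, I c -> D 0%N c = F c,
        forall m c, I c -> Hper n (D m c) &
        forall m c, I c ->
          Hper_norm n (fun x => (D m y x - D m c x) / (y - c) - D m.+1 c x)
            @[y --> within I c^'] --> 0%E].

End PeriodicSobolev.

Section Branches.
Context {R : realType}.
Implicit Types (L a c : R) (I : set R) (Lam : R -> R).

(* The value [period a c] is only meaningful for a in alpha4_range c; hence
   the membership condition that comes with the equation. *)
Definition period_branch L c0 a0 I1 I2 Lam : Prop :=
  [/\ smooth_on I1 Lam, forall c, I1 c -> I2 (Lam c), Lam c0 = a0 &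
      forall c, I1 c -> alpha4_range c (Lam c) /\ period (Lam c) c = L].

Definition dnoidal_branch_on L c0 a0 I1 : Prop :=
  [/\ interval_around c0 I1, I1 `<=` `[0, 1[ &
  exists I2 Lam,
    [/\ interval_around a0 I2,
        period_branch L c0 a0 I1 I2 Lam,
        forall Lam', period_branch L c0 a0 I1 I2 Lam' ->
          forall c, I1 c -> Lam' c = Lam c,
        forall c, I1 c ->
          [/\ 0 < modulus_sq (Lam c) c < 1,
              fundamental_period (dnoidal (Lam c) c) L &
              solves_profile_equation c (dnoidal (Lam c) c)] &
        forall n, smooth_into_Hper L n I1 (fun c => dnoidal (Lam c) c)]].

End Branches.

(* Main.v *)
Require Import Defs.
From mathcomp Require Import all_boot all_order all_algebra.
From mathcomp Require Import all_classical all_reals all_analysis.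
From mathcomp Require Import measurable_realfun.
From mathcomp Require Import ring lra.
Import Order.TTheory GRing.Theory Num.Theory.
Import numFieldNormedType.Exports.
Local Open Scope classical_set_scope.
Local Open Scope ring_scope.
Set Implicit Arguments.
Unset Strict Implicit.
Unset Printing Implicit Defensive.

(* Parametrize by S = alpha_4 + alpha_3 instead of alpha_4. With
   X^2 = alpha_4 (alpha_3 - alpha_1) and Y^2 = alpha_3 (alpha_4 - alpha_1) one has
   1 - k^2 = (Y/X)^2 and
     T = 2 sqrt(3 s) K / X = 2 sqrt(3 s) K (1 + sqrt(1 - k^2)) / (X + Y).
   As S grows, X + Y increases and k decreases, while K (1 + sqrt(1 - k^2)) is
   nondecreasing in k; hence T decreases in S, from +oo down to its limit at k = 0,
   and T = L has a unique solution S(c) as soon as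
   sqrt s (L^2 - 4 pi^2) > L^2, an open condition on c that holds on [0, cmax L[.

   For smoothness, the quantities at hand are closed expressions in c, S and the
   Jacobi amplitude t(c, x). Expressions built from the field operations, sqrt,
   sin, cos and the integrals of sin^2n / Delta^(2n+1) are closed under
   differentiation, and the implicit function theorem expresses S'(c), dt/dc and
   dt/dx as such expressions; so all derivatives of the wave in c and x exist and
   are jointly continuous. The mixed ones commute by Schwarz, and uniform
   convergence of the difference quotients on a period bounds the norm of H^n. *)

(** * Calculus *)

(** The numbers alpha_1, alpha_3, alpha_4 are the roots of a cubic: they sum to -3/2 and their
    pairwise products sum to -3r. So alpha_1 and alpha_3 alpha_4 are polynomials in S, and alpha_4 -
    alpha_3 is the only square root left.

    The formula T = 2 sqrt(3 s) K / X hides the sign of dT/dS: K decreases in S, but so does X where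
    alpha_3 and alpha_4 come together. Passing to X + Y removes the conflict; behind it is the fact
    that K / X depends on X and Y through their arithmetic-geometric mean.

    With w = sqrt s, the limit of T at k = 0 is 2 pi sqrt(w / (w - 1)). It is below L exactly when w
    (L^2 - 4 pi^2) > L^2, and solving this for c gives [cmax L].

    The branch is constructed globally, by intermediate values and strict monotonicity; implicit
    differentiation is then applied to a solution already known to be continuous. The condition on c
    defines an open set, symmetric under c -> -c, so 0, an endpoint of the final interval, is
    interior to it and every derivative is two-sided. *)

Section Calculus.
Context {R : realType}.
Implicit Types (f g : R -> R) (x t : R).

Lemma is_derive_mul f g x df dg :
  is_derive x 1 f df -> is_derive x 1 g dg ->
  is_derive x 1 (fun t => f t * g t) (df * g x + f x * dg).
Proof.
move=> hf hg; apply: is_derive_eq (is_deriveM hf hg) _.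
by rewrite /GRing.scale /=; ring.
Qed.

Lemma is_derive_add f g x df dg :
  is_derive x 1 f df -> is_derive x 1 g dg ->
  is_derive x 1 (fun t => f t + g t) (df + dg).
Proof. by move=> hf hg; apply: is_derive_eq (is_deriveD hf hg) _. Qed.

Lemma is_derive_opp f x df :
  is_derive x 1 f df -> is_derive x 1 (fun t => - f t) (- df).
Proof. by move=> hf; apply: is_derive_eq (is_deriveN hf) _. Qed.

Lemma is_derive_sub f g x df dg :
  is_derive x 1 f df -> is_derive x 1 g dg ->
  is_derive x 1 (fun t => f t - g t) (df - dg).
Proof. by move=> hf hg; apply: is_derive_eq (is_deriveB hf hg) _. Qed.

Lemma is_derive_const (a x : R) : is_derive x 1 (fun=> a) 0.
Proof. exact: is_derive_cst. Qed.

Lemma is_derive_inv f x df : f x != 0 ->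
  is_derive x 1 f df -> is_derive x 1 (fun t => (f t)^-1) (- df / f x ^+ 2).
Proof.
move=> f0 hf; apply: is_derive_eq (is_deriveV f0 hf) _.
by rewrite /GRing.scale /= mulNr mulrC mulNr.
Qed.

Lemma is_derive_comp f g x df dg :
  is_derive (g x) 1 f df -> is_derive x 1 g dg ->
  is_derive x 1 (fun t => f (g t)) (df * dg).
Proof. exact: is_derive1_comp. Qed.

Lemma is_derive_sqrt f x df : 0 < f x ->
  is_derive x 1 f df ->
  is_derive x 1 (fun t => Num.sqrt (f t)) (df / (2 * Num.sqrt (f x))).
Proof.
move=> f0 hf; apply: is_derive_eq.
  by apply: (@is_derive_comp Num.sqrt f) hf; exact: is_derive1_sqrt.
by rewrite mulrC.
Qed.

Lemma is_derive_pow f x df n :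
  is_derive x 1 f df ->
  is_derive x 1 (fun t => f t ^+ n) (n%:R * f x ^+ n.-1 * df).
Proof.
move=> hf; have -> : (fun t => f t ^+ n) = f ^+ n.
  by apply/funext => t; rewrite exprfctE.
apply: is_derive_eq (is_deriveX n hf) _.
by rewrite /GRing.scale /= mulr_natl.
Qed.

Lemma is_derive_continuous f x df :
  is_derive x 1 f df -> {for x, continuous f}.
Proof.
by move=> [hf _]; apply/differentiable_continuous/derivable1_diffP.
Qed.

Lemma is_derive_uniq f x a b :
  is_derive x 1 f a -> is_derive x 1 f b -> a = b.
Proof. by move=> [_ <-] [_ <-]. Qed.

(** Derivatives are defined with increments [h], whereas [smooth_on] uses quotients in [y - x];
    Caratheodory's slope function translates between the two. *)
Lemma is_derive_quotient f x df :
  is_derive x 1 f df <-> (f y - f x) / (y - x) @[y --> x^'] --> df.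
Proof.
split=> [/is_derive1_caratheodory[g [fg cg <-]]|h].
  move: cg => /continuous_withinNx; apply: cvg_trans.
  apply: near_eq_cvg; near=> y.
  rewrite fg mulfK// subr_eq0; near: y; exact: nbhs_dnbhs_neq.
apply/is_derive1_caratheodory.
exists (fun z => if z == x then df else (f z - f x) / (z - x)); split.
- move=> z; case: eqP => [->|/eqP]; first by rewrite !subrr mulr0.
  by rewrite -subr_eq0 => /divfK ->.
- apply/continuous_withinNx; rewrite eqxx; move: h; apply: cvg_trans.
  apply: near_eq_cvg; near=> y; rewrite ifN//.
  near: y; exact: nbhs_dnbhs_neq.
- by rewrite eqxx.
Unshelve. all: by end_near. Qed.

(** The endpoints come in either order because a nearby point may lie on either side of the base
    point. *)
Lemma MVT_gen f df a b :
  (forall x, Num.min a b <= x <= Num.max a b -> is_derive x 1 f (df x)) ->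
  exists2 c, Num.min a b <= c <= Num.max a b & f b - f a = df c * (b - a).
Proof.
wlog ab : a b / a <= b => [hw|].
  have /orP[ab|ba] := le_total a b; first by move=> h; exact: hw.
  rewrite minC maxC => h; have [c hc e] := hw _ _ ba h.
  by exists c => //; rewrite -[LHS]opprB e; ring.
rewrite (min_idPl ab) (max_idPr ab) => h.
have [||c ci e] := @MVT_segment R f df a b ab.
- by move=> x; rewrite in_itv /= => /andP[ax xb]; apply: h; rewrite !ltW.
- apply: derivable_within_continuous => x; rewrite in_itv /= => xab.
  by have [] := h _ xab.
- by exists c => //; move: ci; rewrite in_itv.
Qed.

(* Hadamard's quotient in the second variable, along a filter. *)
Lemma partial_slope (T : Type) (F : set_system T) (FF : Filter F)
  (g g2 : R -> R -> R) (u v : T -> R) (u0 v0 : R) :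
  u @ F --> u0 -> v @ F --> v0 ->
  (\forall x \near u0 & y \near v0, is_derive (y : R) 1 (g x) (g2 x y)) ->
  {for (u0, v0), continuous (fun p : R * R => g2 p.1 p.2)} ->
  exists2 q : T -> R, q @ F --> g2 u0 v0 &
    \forall s \near F, g (u s) (v s) - g (u s) v0 = q s * (v s - v0).
Proof.
move=> hu hv hg cg.
exists (fun s => if v s == v0 then g2 u0 v0
                 else (g (u s) (v s) - g (u s) v0) / (v s - v0)); last first.
  near=> s; case: eqP => [->|/eqP]; first by rewrite !subrr mulr0.
  by rewrite -subr_eq0 => /divfK ->.
apply/cvgrPdist_lt => e e0.
have /cvgrPdist_lt/(_ e e0) cge := cg.
have : \forall x \near u0 & y \near v0, is_derive (y : R) 1 (g x) (g2 x y) /\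
   `|g2 u0 v0 - g2 x y| < e.
  by apply: filterS2 hg cge => p.
move=> -[[A B] /= [/nbhs_ballP[d1 /= d10 h1] /nbhs_ballP[d2 /= d20 h2]] AB].
near=> s; case: eqP => [_|/eqP vs]; first by rewrite subrr normr0.
have Bu : A (u s) by apply: h1; near: s; exact/hu/nbhsx_ballx.
have vd : ball v0 d2 (v s) by near: s; exact/hv/nbhsx_ballx.
have dv x : Num.min v0 (v s) <= x <= Num.max v0 (v s) -> B x.
  move=> hx; apply: h2; move: vd; rewrite /ball /= !ltr_norml.
  by move: hx; rewrite minElt maxElt; case: ltP => ? /andP[? ?] /andP[? ?];
    apply/andP; split; lra.
have [x hx ->] := @MVT_gen (g (u s)) (g2 (u s)) v0 (v s)
  (fun x hx => (AB (u s, x) (conj Bu (dv x hx))).1).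
rewrite mulfK ?subr_eq0//.
exact: (AB (u s, x) (conj Bu (dv x hx))).2.
Unshelve. all: by end_near. Qed.

(** The increment splits into one at fixed [u s], handled by [partial_slope], and one at fixed
    [v t], handled by the one-variable chain rule. So only the second partial derivative has to
    exist nearby and be continuous, and the first one is taken at a single point. *)
Lemma is_derive_comp2 (g g2 : R -> R -> R) (u v : R -> R) (t g1 du dv : R) :
  is_derive (u t) 1 (g ^~ (v t)) g1 ->
  (\forall x \near u t & y \near v t, is_derive (y : R) 1 (g x) (g2 x y)) ->
  {for (u t, v t), continuous (fun p : R * R => g2 p.1 p.2)} ->
  is_derive t 1 u du -> is_derive t 1 v dv ->
  is_derive t 1 (fun s => g (u s) (v s)) (g1 * du + g2 (u t) (v t) * dv).
Proof.
move=> h1 h2 c2 hu hv.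
have cu := is_derive_continuous hu; have cv := is_derive_continuous hv.
have [q hq qE] := partial_slope (nbhs_filter t) cu cv h2 c2.
have hg1 := is_derive_comp h1 hu.
move/is_derive_quotient : hg1 => hg1; move/is_derive_quotient : hv => hv.
apply/is_derive_quotient.
have hq' : q y @[y --> t^'] --> g2 (u t) (v t).
  by apply: cvg_trans hq; apply: cvg_app; exact: nbhs_dnbhs.
apply: cvg_trans (cvgD hg1 (cvgM hq' hv)); apply: near_eq_cvg.
near=> s.
have qs : g (u s) (v s) - g (u s) (v t) = q s * (v s - v t).
  by near: s; exact: nbhs_dnbhs qE.
rewrite -[LHS]/(_ / _ + q s * (_ / _)) mulrA -qs -mulrDl.
by congr (_ / _); ring.
Unshelve. all: by end_near. Qed.

(** Since g is constant along y, its increment from y t to y s at fixed s is minus its increment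
    from t to s at fixed y t; dividing by the Hadamard quotient gives the slope of y. Continuity of
    y is a hypothesis: it is obtained beforehand from monotonicity, both for the branch and for the
    amplitude. *)
Lemma is_derive_implicit (g g2 : R -> R -> R) (y : R -> R) (t g1 l : R) :
  is_derive t 1 (g ^~ (y t)) g1 ->
  (\forall x \near t & z \near y t, is_derive (z : R) 1 (g x) (g2 x z)) ->
  {for (t, y t), continuous (fun p : R * R => g2 p.1 p.2)} ->
  g2 t (y t) != 0 -> {for t, continuous y} ->
  (\forall s \near t, g s (y s) = l) ->
  is_derive t 1 y (- g1 / g2 t (y t)).
Proof.
move=> h1 h2 c2 n0 cy hl.
have [q hq qE] := partial_slope (nbhs_filter t) (@cvg_id _ _) cy h2 c2.
move/is_derive_quotient : h1 => h1.
apply/is_derive_quotient.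
have hq' : q y @[y --> t^'] --> g2 t (y t).
  by apply: cvg_trans hq; apply: cvg_app; exact: nbhs_dnbhs.
have hqn : \forall s \near t^', q s != 0.
  exact: cvgr_neq0 hq' n0.
have lt : g t (y t) = l by exact: nbhs_singleton hl.
apply: cvg_trans (cvgM (cvgN h1) (cvgV n0 hq')); apply: near_eq_cvg.
near=> s.
have qs : g s (y s) - g s (y t) = q s * (y s - y t).
  by near: s; exact: nbhs_dnbhs qE.
have gs : g s (y s) = l by near: s; exact: nbhs_dnbhs hl.
have q0 : q s != 0 by near: s.
rewrite -[LHS]/(- ((_ - _) / _) / _) lt -gs -mulNr opprB qs.
by rewrite mulrAC [q s * _]mulrC mulfK.
Unshelve. all: by end_near. Qed.

(** * Oriented integrals and differentiation under the integral sign *)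

Definition oriented_integral f x : R :=
  if 0 <= x then \int[@lebesgue_measure R]_(t in `[0, x]) f t
  else - \int[@lebesgue_measure R]_(t in `[x, 0]) f t.

Lemma integrable_segment f (a b : R) : continuous f ->
  (@lebesgue_measure R).-integrable `[a, b] (EFin \o f).
Proof.
move=> cf; apply: continuous_compact_integrable; first exact: segment_compact.
exact: continuous_subspaceT.
Qed.

(** A base point to the left of both 0 and x gives one formula across x = 0, where the definition
    changes case; the fundamental theorem of calculus can then be applied there too. *)
Lemma oriented_integralE f (a x : R) : continuous f -> a < 0 -> a <= x ->
  oriented_integral f x = \int[@lebesgue_measure R]_(t in `[a, x]) f t
                        - \int[@lebesgue_measure R]_(t in `[a, 0]) f t.
Proof.
move=> cf a0 ax; have i1 := @integrable_segment f _ _ cf.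
rewrite /oriented_integral; case: ifPn => [x0|].
  rewrite Rintegral_itvB ?bnd_simp ?(ltW a0)//.
  by rewrite Rintegral_itv_obnd_cbnd//; apply: integrableS (i1 0 x) => //;
    exact: subset_itv_oc_cc.
rewrite -ltNge => x0; rewrite -[RHS]opprB Rintegral_itvB ?bnd_simp ?(ltW x0)//.
rewrite Rintegral_itv_obnd_cbnd//; apply: integrableS (i1 x 0) => //.
exact: subset_itv_oc_cc.
Qed.

Lemma is_derive_oriented_integral f x : continuous f ->
  is_derive x 1 (oriented_integral f) (f x).
Proof.
move=> cf; pose a := Num.min 0 x - 1.
have a0 : a < 0 by rewrite /a; case: (lerP 0 x) => ?; lra.
have ax : a < x by rewrite /a; case: (lerP 0 x) => ?; lra.
have [|h1 h2] := @continuous_FTC1_closed R f a x (x + 1) _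
   (@integrable_segment f _ _ cf) ax (cf x); first lra.
have h : is_derive x 1 (fun y => \int[@lebesgue_measure R]_(t in `[a, y]) f t) (f x).
  by rewrite -h2 derive1E; exact/derivableP.
have := is_derive_sub h (is_derive_const
  (\int[@lebesgue_measure R]_(t in `[a, 0]) f t) x).
rewrite subr0; apply: near_eq_is_derive.
near=> y; rewrite -oriented_integralE//.
by apply/ltW; near: y; exact: lt_nbhsr.
Unshelve. all: by end_near. Qed.

Lemma oriented_integral0 f : oriented_integral f 0 = 0.
Proof. by rewrite /oriented_integral lexx set_itv1 Rintegral_set1. Qed.

(** On a bounded interval a constant is an integrable dominating function, so a uniform bound on the
    parameter derivative is enough for dominated convergence. *)
Lemma is_derive_oriented_integral_param (f f1 : R -> R -> R) (m x e B : R) :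
  0 < e ->
  (forall p, `|p - m| < e -> continuous (f p)) ->
  (forall p t, `|p - m| < e -> is_derive p 1 (f ^~ t) (f1 p t)) ->
  (forall p t, `|p - m| < e -> `|f1 p t| <= B) ->
  is_derive m 1 (fun p => oriented_integral (f p) x) (oriented_integral (f1 m) x).
Proof.
move=> e0 cf df hB.
have key (a b : R) : is_derive m 1
    (fun p => \int[@lebesgue_measure R]_(t in `[a, b]) f p t)
    (\int[@lebesgue_measure R]_(t in `[a, b]) f1 m t).
  have Im : [set` `]m - e, m + e[] m by rewrite /= in_itv /=; apply/andP; split; lra.
  have II p : [set` `]m - e, m + e[] p -> `|p - m| < e.
    by rewrite /= in_itv /= => /andP[h1 h2]; rewrite ltr_norml; apply/andP; split; lra.
  pose H := @cvg_differentiation_under_integral R _ _ lebesgue_measure f `[a, b] _ m (m - e) (m + e) Im.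
  have E : \int[@lebesgue_measure R]_(t in `[a, b]) f1 m t =
    \int[@lebesgue_measure R]_(t in `[a, b]) (partial1of2 f m t).
    apply: eq_Rintegral => t _; rewrite partial1of2E.
    by have [] := df m t (II _ Im).
  have B0 : 0 <= B by apply: le_trans (hB m m (II _ Im)).
  have {}H : h^-1 *: (\int[@lebesgue_measure R]_(y in `[a, b]) f (h + m) y - \int[@lebesgue_measure R]_(y in `[a, b]) f m y) @[h --> 0^'] -->
   \int[@lebesgue_measure R]_(t in `[a, b]) f1 m t.
    rewrite E; apply: (H _ _ _ (cst B)) => //.
    - by move=> p /II hp; apply: integrable_segment; exact: cf.
    - by move=> p t /II hp _; have [] := df p t hp.
    - by apply: integrable_segment => t; exact: cvg_cst.
    - move=> p t /II hp _; rewrite partial1of2E.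
      by have [_ ->] := df p t hp; exact: hB.
  (* The same limit, with the increment written as a multiple of the direction [1], as in the
     definition of [derive]. *)
  have {}H : h^-1 *: (\int[@lebesgue_measure R]_(y in `[a, b]) f (h *: (1:R) + m) y - \int[@lebesgue_measure R]_(y in `[a, b]) f m y) @[h --> 0^'] -->
   \int[@lebesgue_measure R]_(t in `[a, b]) f1 m t.
    by under eq_fun do rewrite /GRing.scale /= mulr1.
  by apply: DeriveDef; [apply/cvg_ex; eexists; exact: H|exact: (cvg_lim _ H)].
rewrite /oriented_integral; case: ifP => _; first exact: key.
exact: is_derive_opp (key _ _).
Qed.

End Calculus.

(** * Elliptic integrals *)

Section EllipticIntegrals.
Context {R : realType}.
Implicit Types (m t x : R) (n : nat).

Definition ell_delta m t : R := Num.sqrt (1 - m * sin t ^+ 2).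

(** This family takes the place of the pair K, E: its derivative in m passes from n to n + 1 with a
    constant coefficient, while the classical formulas divide by m (1 - m). Negative m is allowed,
    so m = 0 is no boundary. *)
Definition ell_integrand n m t : R :=
  sin t ^+ n.*2 * (ell_delta m t)^-1 ^+ n.*2.+1.

Definition ell n m x : R := oriented_integral (ell_integrand n m) x.

Lemma sin2_le1 t : sin t ^+ 2 <= 1.
Proof. by rewrite -(cos2Dsin2 t) lerDr sqr_ge0. Qed.

(** For m >= 0 the worst case is sin^2 = 1; for m < 0 the radicand is at least 1, whence the
    hypothesis e <= 1. *)
Lemma ell_radicand_lb m e t : 0 <= e -> e <= 1 -> m <= 1 - e -> e <= 1 - m * sin t ^+ 2.
Proof.
move=> e0 e1 hm; have := sin2_le1 t; have := sqr_ge0 (sin t); set y := _ ^+ 2.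
by move=> y0 y1; have [m0|m0] := leP 0 m; nra.
Qed.

Lemma ell_radicand_gt0 m t : m < 1 -> 0 < 1 - m * sin t ^+ 2.
Proof.
have := sin2_le1 t; have := sqr_ge0 (sin t); set y := _ ^+ 2.
by move=> y0 y1 m1; have [m0|m0] := leP 0 m; nra.
Qed.

Lemma ell_delta_gt0 m t : m < 1 -> 0 < ell_delta m t.
Proof. by move=> m1; rewrite sqrtr_gt0 ell_radicand_gt0. Qed.

Lemma ell_delta_sqr m t : m < 1 -> ell_delta m t ^+ 2 = 1 - m * sin t ^+ 2.
Proof. by move=> m1; rewrite sqr_sqrtr// ltW// ell_radicand_gt0. Qed.

Lemma is_derive_ell_delta (u v : R -> R) t du dv : u t < 1 ->
  is_derive t 1 u du -> is_derive t 1 v dv ->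
  is_derive t 1 (fun s => ell_delta (u s) (v s))
    (- (du * sin (v t) ^+ 2 + 2 * u t * sin (v t) * cos (v t) * dv)
       / (2 * ell_delta (u t) (v t))).
Proof.
move=> u1 hu hv.
have h := is_derive_sub (is_derive_const 1 t)
  (is_derive_mul hu (is_derive_pow 2 (is_derive_comp (is_derive_sin (v t)) hv))).
rewrite /ell_delta; apply: is_derive_eq.
  by apply: is_derive_sqrt h; exact: ell_radicand_gt0.
by congr (_ / _); rewrite /= expr1; ring.
Qed.

Lemma is_derive_ell_integrand_param n m t : m < 1 ->
  is_derive m 1 (ell_integrand n ^~ t) ((n%:R + 2^-1) * ell_integrand n.+1 m t).
Proof.
move=> m1; have d0 := lt0r_neq0 (ell_delta_gt0 t m1).
have h := is_derive_pow n.*2.+1 (@is_derive_inv _ (ell_delta^~ t) m _ d0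
  (is_derive_ell_delta (u := id) m1 (is_derive_id m 1) (is_derive_const t m))).
apply: is_derive_eq (is_derive_mul (is_derive_const (sin t ^+ n.*2) m) h) _.
rewrite mul0r add0r /ell_integrand /= doubleS !exprS mulr0 addr0 mul1r.
rewrite -muln2 -natr1 natrM.
field.
by rewrite d0.
Qed.

Lemma continuous_sqrt_comp (T : topologicalType) (f : T -> R) (p : T) :
  {for p, continuous f} -> {for p, continuous (fun q => Num.sqrt (f q))}.
Proof. by move=> cf; apply: continuous_comp => //; exact: sqrt_continuous. Qed.

Lemma continuous_pow (T : topologicalType) (f : T -> R) (p : T) k :
  {for p, continuous f} -> {for p, continuous (fun q => f q ^+ k)}.
Proof. move=> cf; apply: (@continuous_comp _ _ _ f (@GRing.exp R ^~ k)) => //.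
exact: exprn_continuous. Qed.

Lemma continuous_ell_integrand (T : topologicalType) (u v : T -> R) (p : T) n :
  u p < 1 -> {for p, continuous u} -> {for p, continuous v} ->
  {for p, continuous (fun q => ell_integrand n (u q) (v q))}.
Proof.
move=> u1 cu cv.
have cs : {for p, continuous (fun q => sin (v q))}.
  by apply: continuous_comp => //; exact: continuous_sin.
apply: continuousM; first exact: continuous_pow.
apply: continuous_pow; apply: continuousV.
  exact/lt0r_neq0/ell_delta_gt0.
apply: continuous_sqrt_comp; apply: continuousB; first exact: cvg_cst.
by apply: continuousM => //; exact: continuous_pow.
Qed.

Lemma continuous_ell_integrand1 n m : m < 1 -> continuous (ell_integrand n m).
Proof.
by move=> m1 t; apply: continuous_ell_integrand => //; exact: cvg_cst.
Qed.

Lemma ell_integrand_bound n m e t : 0 < e -> e <= 1 -> m <= 1 - e ->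
  `|ell_integrand n m t| <= (Num.sqrt e)^-1 ^+ n.*2.+1.
Proof.
move=> e0 e1 me; have se : 0 < Num.sqrt e by rewrite sqrtr_gt0.
have sd : Num.sqrt e <= ell_delta m t.
  by apply: ler_wsqrtr; apply: ell_radicand_lb => //; exact: ltW.
rewrite normrM -[leRHS]mul1r; apply: ler_pM => //.
  by rewrite normrX; apply: exprn_ile1 => //; exact: sin_max.
rewrite normrX; apply: lerXn2r; rewrite ?nnegrE ?invr_ge0 ?(ltW se)//.
rewrite ger0_norm ?invr_ge0 ?(le_trans (ltW se))// lef_pV2// posrE//.
exact: lt_le_trans sd.
Qed.

Lemma is_derive_ell_param n m x : m < 1 ->
  is_derive m 1 (ell n ^~ x) ((n%:R + 2^-1) * ell n.+1 m x).
Proof.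
(* One number is used both as the radius around m and as the lower bound of the radicand: 2 e <= 1 -
   m makes p <= 1 - e for every p within e of m. *)
move=> m1; pose e := Num.min (1:R) ((1 - m) / 2).
have e0 : 0 < e by rewrite lt_min ltr01 divr_gt0 ?subr_gt0.
have e1 : e <= 1 by rewrite ge_min lexx.
have em : e <= (1 - m) / 2 by rewrite ge_min lexx orbT.
have ep p : `|p - m| < e -> p <= 1 - e.
  by rewrite ltr_norml => /andP[_ h]; lra.
have p1 p : `|p - m| < e -> p < 1.
  by move=> /ep; move: e0 => /[swap] h; lra.
have h := @is_derive_oriented_integral_param R (fun m => ell_integrand n m)
   (fun m t => (n%:R + 2^-1) * ell_integrand n.+1 m t) m x e
   ((n%:R + 2^-1) * (Num.sqrt e)^-1 ^+ n.+1.*2.+1) e0.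
apply: is_derive_eq; first (apply: h => //).
- by move=> p /p1; exact: continuous_ell_integrand1.
- by move=> p t /p1; exact: is_derive_ell_integrand_param.
- move=> p t /ep hp; have n0 : (0:R) <= n%:R + 2^-1 by rewrite addr_ge0.
  by rewrite normrM ger0_norm// ler_wpM2l// ell_integrand_bound.
rewrite /ell /oriented_integral.
have i1 := @integrable_segment R _ _ _ (@continuous_ell_integrand1 n.+1 m m1).
by case: ifP => _; rewrite RintegralZl// mulrN.
Qed.

Lemma is_derive_ell n m x : m < 1 -> is_derive x 1 (ell n m) (ell_integrand n m x).
Proof. by move=> m1; apply/is_derive_oriented_integral/continuous_ell_integrand1. Qed.

Lemma near_lt1_prod (m x : R) (P : R -> R -> Prop) : m < 1 ->
  (forall p y, p < 1 -> P p y) -> \forall p \near m & y \near x, P p y.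
Proof.
move=> m1 h; exists ([set p | p < 1], setT) => /=.
  by split; [exact: lt_nbhsl|exact: filterT].
by move=> [p y] /= [p1 _]; exact: h.
Qed.

Lemma continuous_ell_integrand_pair n (m x : R) : m < 1 ->
  {for (m, x), continuous (fun q : R * R => ell_integrand n q.1 q.2)}.
Proof.
move=> m1.
have c1 : {for (m, x), continuous (fun q : R * R => q.1)} by exact: cvg_fst.
have c2 : {for (m, x), continuous (fun q : R * R => q.2)} by exact: cvg_snd.
apply: continuous_ell_integrand.
exact: m1.
exact: c1.
exact: c2.
Qed.

Lemma is_derive_ell_comp n (u v : R -> R) t du dv : u t < 1 ->
  is_derive t 1 u du -> is_derive t 1 v dv ->
  is_derive t 1 (fun s => ell n (u s) (v s))
    ((n%:R + 2^-1) * ell n.+1 (u t) (v t) * du + ell_integrand n (u t) (v t) * dv).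
Proof.
move=> u1 hu hv.
apply: (@is_derive_comp2 _ (ell n) (ell_integrand n)) => //.
- exact: is_derive_ell_param.
- by apply: near_lt1_prod => // p y p1; exact: is_derive_ell.
- exact: continuous_ell_integrand_pair.
Qed.

(** Joint continuity comes from the derivative in m at a fixed endpoint, plus a Hadamard quotient in
    the endpoint that converges along the filter. *)
Lemma continuous_ell (T : topologicalType) (u v : T -> R) (p : T) n :
  u p < 1 -> {for p, continuous u} -> {for p, continuous v} ->
  {for p, continuous (fun q => ell n (u q) (v q))}.
Proof.
move=> u1 cu cv.
have [q hq qE] := @partial_slope R T (nbhs p) _ (ell n) (ell_integrand n)
  u v (u p) (v p) cu cv
  (near_lt1_prod (v p) u1 (fun m y => @is_derive_ell n m y))
  (@continuous_ell_integrand_pair n _ (v p) u1).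
have h1 : ell n (u s) (v p) @[s --> p] --> ell n (u p) (v p).
  apply: (@continuous_comp _ _ _ u (ell n ^~ (v p))) => //.
  exact: is_derive_continuous (is_derive_ell_param n (v p) u1).
have h2 : v s - v p @[s --> p] --> 0.
  by rewrite -(subrr (v p)); apply: cvgB => //; exact: cvg_cst.
have e0 : ell n (u p) (v p) =
   ell n (u p) (v p) + ell_integrand n (u p) (v p) * 0 by rewrite mulr0 addr0.
rewrite /prop_for /continuous_at e0.
apply: cvg_trans (cvgD h1 (cvgM hq h2)); apply: near_eq_cvg; near=> s.
rewrite -[LHS]/(_ + q s * (_ - _)).
have <- : ell n (u s) (v s) - ell n (u s) (v p) = q s * (v s - v p) by near: s.
by rewrite addrC subrK.
Unshelve. all: by end_near. Qed.

End EllipticIntegrals.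

(** * Expressions closed under differentiation *)

Section Expressions.
Context {R : realType}.

(** A syntax rather than a class of functions: derivatives are again terms, so they can be iterated,
    and their domain conditions are checked by induction on terms. *)
Inductive expr :=
| Const of R
| Var of nat
| Add of expr & expr
| Mul of expr & expr
| Inv of expr
| Sqrt of expr
| Sin of expr
| Cos of expr
| Ell of nat & expr & expr.

Fixpoint eval (v : nat -> R) (e : expr) : R :=
  match e with
  | Const a => a
  | Var i => v i
  | Add e1 e2 => eval v e1 + eval v e2
  | Mul e1 e2 => eval v e1 * eval v e2
  | Inv e1 => (eval v e1)^-1
  | Sqrt e1 => Num.sqrt (eval v e1)
  | Sin e1 => sin (eval v e1)
  | Cos e1 => cos (eval v e1)
  | Ell n e1 e2 => ell n (eval v e1) (eval v e2)
  end.

(* All subexpressions are differentiable at every valuation in D. *)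
Fixpoint ok (D : set (nat -> R)) (e : expr) : Prop :=
  match e with
  | Const _ | Var _ => True
  | Add e1 e2 | Mul e1 e2 => ok D e1 /\ ok D e2
  | Inv e1 => ok D e1 /\ forall v, D v -> eval v e1 != 0
  | Sqrt e1 => ok D e1 /\ forall v, D v -> 0 < eval v e1
  | Sin e1 | Cos e1 => ok D e1
  | Ell _ e1 e2 => [/\ ok D e1, ok D e2 & forall v, D v -> eval v e1 < 1]
  end.

Definition Opp e := Mul (Const (-1)) e.
Definition Pow e k := iter k (Mul e) (Const 1).

Lemma eval_Pow v e k : eval v (Pow e k) = eval v e ^+ k.
Proof. by elim: k => //= k ->; rewrite exprS. Qed.

Lemma ok_Pow D e k : ok D e -> ok D (Pow e k).
Proof. by move=> h; elim: k. Qed.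

Definition EllRadicand e1 e2 :=
  Add (Const 1) (Opp (Mul e1 (Mul (Sin e2) (Sin e2)))).

(** The derivative of [Ell n] in its endpoint, spelled with the other constructors so that the
    syntax is closed under [der]. *)
Definition EllIntegrand n e1 e2 :=
  Mul (Pow (Sin e2) n.*2) (Pow (Inv (Sqrt (EllRadicand e1 e2))) n.*2.+1).

Lemma eval_EllRadicand v e1 e2 :
  eval v (EllRadicand e1 e2) = 1 - eval v e1 * sin (eval v e2) ^+ 2.
Proof. by rewrite /= expr2 mulN1r. Qed.

Lemma eval_EllIntegrand v n e1 e2 :
  eval v (EllIntegrand n e1 e2) = ell_integrand n (eval v e1) (eval v e2).
Proof.
rewrite -[LHS]/(eval v (Pow (Sin e2) n.*2) *
  eval v (Pow (Inv (Sqrt (EllRadicand e1 e2))) n.*2.+1)) !eval_Pow.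
by rewrite -[eval v (Inv _)]/(Num.sqrt (eval v (EllRadicand e1 e2)))^-1
  eval_EllRadicand.
Qed.

Lemma ok_EllIntegrand D n e1 e2 : ok D (Ell n e1 e2) -> ok D (EllIntegrand n e1 e2).
Proof.
move=> [h1 h2 h3]; split; first exact: ok_Pow.
have pos v : D v -> 0 < eval v (EllRadicand e1 e2).
  by move=> /h3 h; rewrite eval_EllRadicand ell_radicand_gt0.
apply: ok_Pow; split=> [|v /pos h]; last by rewrite lt0r_neq0// sqrtr_gt0.
by split=> //=.
Qed.

(** [dv] is a vector field: it gives the velocity of each variable as an expression in all the
    variables, and [der dv] differentiates along it. *)
Fixpoint der (dv : nat -> expr) (e : expr) : expr :=
  match e with
  | Const _ => Const 0
  | Var i => dv i
  | Add e1 e2 => Add (der dv e1) (der dv e2)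
  | Mul e1 e2 => Add (Mul (der dv e1) e2) (Mul e1 (der dv e2))
  | Inv e1 => Opp (Mul (der dv e1) (Mul (Inv e1) (Inv e1)))
  | Sqrt e1 => Mul (der dv e1) (Mul (Const 2^-1) (Inv (Sqrt e1)))
  | Sin e1 => Mul (Cos e1) (der dv e1)
  | Cos e1 => Opp (Mul (Sin e1) (der dv e1))
  (* d/dm (sin^2n / Delta^(2n+1)) = (n + 1/2) sin^(2n+2) / Delta^(2n+3) *)
  | Ell n e1 e2 =>
      Add (Mul (Mul (Const (n%:R + 2^-1)) (Ell n.+1 e1 e2)) (der dv e1))
          (Mul (EllIntegrand n e1 e2) (der dv e2))
  end.

Lemma ok_der D dv e : (forall i, ok D (dv i)) -> ok D e -> ok D (der dv e).
Proof.
move=> hd; elim: e => //=.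
- by move=> e1 h1 e2 h2 [/h1 ? /h2 ?].
- by move=> e1 h1 e2 h2 [/[dup] ? /h1 ? /[dup] ? /h2 ?].
- by move=> e h [/[dup] ? /h ? ?].
- move=> e h [/[dup] ? /h ? h0]; split=> //; split=> //; split=> // v Dv.
  by rewrite lt0r_neq0// sqrtr_gt0 h0.
- by move=> e h /[dup] ? /h ?.
- by move=> e h /[dup] ? /h ?.
- move=> n e1 h1 e2 h2 [/[dup] ? /h1 ? /[dup] ? /h2 ? h3]; split=> //.
  by split=> //; apply: (@ok_EllIntegrand D n e1 e2).
Qed.

Lemma is_derive_eval D dv e (v : R -> nat -> R) t :
  ok D e -> D (v t) ->
  (forall i, is_derive t 1 (v ^~ i) (eval (v t) (dv i))) ->
  is_derive t 1 (fun s => eval (v s) e) (eval (v t) (der dv e)).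
Proof.
move=> + Dv hv; elim: e.
- by move=> a _; exact: is_derive_const.
- by move=> i _; exact: hv.
- by move=> e1 h1 e2 h2 /= [/h1 ? /h2 ?]; exact: is_derive_add.
- by move=> e1 h1 e2 h2 /= [/h1 ? /h2 ?]; exact: is_derive_mul.
- move=> e h /= [/h he /(_ _ Dv) n0]; apply: is_derive_eq (is_derive_inv n0 he) _.
  by rewrite mulN1r mulNr -expr2 exprVn.
- move=> e h /= [/h he /(_ _ Dv) n0]; apply: is_derive_eq.
    by apply: is_derive_sqrt he; exact: n0.
  by rewrite invfM.
- by move=> e h /= /h he; exact: is_derive_comp he.
- move=> e h /= /h he; apply: is_derive_eq (is_derive_comp (is_derive_cos _) he) _.
  by rewrite mulN1r mulNr.
- move=> n e1 h1 e2 h2 [/h1 k1 /h2 k2 /(_ _ Dv) h3].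
  apply: is_derive_eq; first exact: (is_derive_ell_comp n h3 k1 k2).
  by rewrite -eval_EllIntegrand.
Qed.

Lemma continuous_eval (T : topologicalType) D e (v : T -> nat -> R) p :
  ok D e -> D (v p) -> (forall i, {for p, continuous (v ^~ i)}) ->
  {for p, continuous (fun q => eval (v q) e)}.
Proof.
move=> + Dv hv; elim: e.
- by move=> a _; exact: cvg_cst.
- by move=> i _; exact: hv.
- by move=> e1 h1 e2 h2 /= [/h1 ? /h2 ?]; exact: continuousD.
- by move=> e1 h1 e2 h2 /= [/h1 ? /h2 ?]; exact: continuousM.
- by move=> e h /= [/h he /(_ _ Dv) n0]; exact: continuousV.
- by move=> e h /= [/h he _]; exact: continuous_sqrt_comp.
- by move=> e h /= /h he; apply: continuous_comp he _; exact: continuous_sin.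
- by move=> e h /= /h he; apply: continuous_comp he _; exact: continuous_cos.
- by move=> n e1 h1 e2 h2 [/h1 k1 /h2 k2 /(_ _ Dv) h3]; exact: continuous_ell.
Qed.

End Expressions.

(** * Parameters of the wave *)

Section WaveParameters.
Context {R : realType}.
Implicit Types (a c S : R).

(* [S] stands for alpha_4 + alpha_3, and alpha_4 - alpha_3 is [root_gap]. *)
Definition root_prod c S : R := S ^+ 2 + 3 / 2 * S - 3 * rc c.
(** By the relations between roots and coefficients, [root_prod] is alpha_3 alpha_4, and [gap_sq] is
    S^2 - 4 [root_prod], the square of alpha_4 - alpha_3. *)
Definition gap_sq c S : R := 12 * rc c - 6 * S - 3 * S ^+ 2.
Definition root_gap c S : R := Num.sqrt (gap_sq c S).
Definition alpha4_of c S : R := (S + root_gap c S) / 2.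
(* alpha_4 (alpha_3 - alpha_1) and alpha_3 (alpha_4 - alpha_1) *)
Definition major_sq c S : R :=
  (3 * S ^+ 2 + 9 / 2 * S - 6 * rc c + (S + 3 / 2) * root_gap c S) / 2.
Definition minor_sq c S : R :=
  (3 * S ^+ 2 + 9 / 2 * S - 6 * rc c - (S + 3 / 2) * root_gap c S) / 2.
Definition msq c S : R := (S + 3 / 2) * root_gap c S / major_sq c S.

(** This says 0 < alpha_3 < alpha_4 through sum, product and discriminant: three strict polynomial
    inequalities, hence an open condition on (c, S). *)
Definition admissible c S : Prop :=
  [/\ 0 < S, 0 < root_prod c S & 0 < gap_sq c S].

Section Admissible.
Variables (c S : R).
Hypothesis adm : admissible c S.

Lemma adm_gt0 : 0 < S. Proof. by case: adm. Qed.

Lemma root_gap_gt0 : 0 < root_gap c S.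
Proof. by case: adm => _ _ h; rewrite sqrtr_gt0. Qed.

Lemma root_gap_sqr : root_gap c S ^+ 2 = gap_sq c S.
Proof. by case: adm => _ _ h; rewrite sqr_sqrtr// ltW. Qed.

Lemma root_gap_lt : root_gap c S < S.
Proof.
have [S0 P0 _] := adm; rewrite -(@ltr_pXn2r _ 2)// ?nnegrE ?ltW// ?root_gap_gt0//.
by rewrite root_gap_sqr; move: P0; rewrite /root_prod /gap_sq => h; lra.
Qed.

Lemma adm_rc_gt0 : 0 < rc c.
Proof. by have [S0 _ h] := adm; move: h; rewrite /gap_sq; nra. Qed.

Lemma adm_sc_gt1 : 1 < sc c.
Proof. by have := adm_rc_gt0; rewrite /rc /sc => h; lra. Qed.

Lemma major_minor : minor_sq c S = ((S - root_gap c S) / 2) * (alpha4_of c S + 3 / 2 + S).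
Proof.
have := root_gap_sqr; rewrite /minor_sq /alpha4_of /gap_sq.
(* Eliminating [rc c] through the square of the gap leaves a polynomial identity in S and d. *)
by set d := root_gap _ _; move=> e; rewrite (_ : rc c = (d ^+ 2 + 6 * S + 3 * S ^+ 2) / 12); [field|rewrite e; field].
Qed.

Lemma majorE : major_sq c S = alpha4_of c S * ((S - root_gap c S) / 2 + 3 / 2 + S).
Proof.
have := root_gap_sqr; rewrite /major_sq /alpha4_of /gap_sq.
by set d := root_gap _ _; move=> e; rewrite (_ : rc c = (d ^+ 2 + 6 * S + 3 * S ^+ 2) / 12); [field|rewrite e; field].
Qed.

Lemma minor_gt0 : 0 < minor_sq c S.
Proof.
rewrite major_minor /alpha4_of; have := root_gap_lt; have := root_gap_gt0.
have := adm_gt0; set d := root_gap _ _ => S0 d0 dS.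
by apply: mulr_gt0; lra.
Qed.

Lemma major_gt0 : 0 < major_sq c S.
Proof.
rewrite majorE /alpha4_of; have := root_gap_lt; have := root_gap_gt0.
have := adm_gt0; set d := root_gap _ _ => S0 d0 dS.
by apply: mulr_gt0; lra.
Qed.

Lemma onem_msq : 1 - msq c S = minor_sq c S / major_sq c S.
Proof.
have h := lt0r_neq0 major_gt0; rewrite -(divff h) -mulrBl; congr (_ / _).
by rewrite /major_sq /minor_sq; field.
Qed.

Lemma msq_gt0 : 0 < msq c S.
Proof.
rewrite divr_gt0 ?major_gt0// mulr_gt0 ?root_gap_gt0//.
by have := adm_gt0 => h; lra.
Qed.

Lemma msq_lt1 : msq c S < 1.
Proof. by rewrite -subr_gt0 onem_msq divr_gt0 ?minor_gt0 ?major_gt0. Qed.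

(** Half the square root of 3 beta is alpha_3 - alpha_1, which is affine in S and the gap; the
    nested radicals of [alpha1] and [alpha3] thus disappear. *)
Lemma adm_betaE : 3 * beta (alpha4_of c S) c = (3 * S + 3 - root_gap c S) ^+ 2.
Proof.
have := root_gap_sqr; rewrite /beta /alpha4_of /gap_sq.
set d := root_gap _ _; move=> e; rewrite (_ : rc c = (d ^+ 2 + 6 * S + 3 * S ^+ 2) / 12); last by rewrite e; field.
by field.
Qed.

Lemma adm_beta_gt0 : 0 < beta (alpha4_of c S) c.
Proof.
have : 0 < 3 * beta (alpha4_of c S) c.
  rewrite adm_betaE exprn_gt0//; have := root_gap_lt; have := adm_gt0; lra.
by rewrite pmulr_rgt0.
Qed.

Lemma adm_sqrt_beta : Num.sqrt 3 * Num.sqrt (beta (alpha4_of c S) c) =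
  3 * S + 3 - root_gap c S.
Proof.
rewrite -sqrtrM// adm_betaE sqrtr_sqr ger0_norm//.
have := root_gap_lt; have := adm_gt0; lra.
Qed.

Lemma adm_alpha1 : alpha1 (alpha4_of c S) c = - (3 / 2) - S.
Proof. by rewrite /alpha1 adm_sqrt_beta /alpha4_of; field. Qed.

Lemma adm_alpha3 : alpha3 (alpha4_of c S) c = (S - root_gap c S) / 2.
Proof. by rewrite /alpha3 adm_sqrt_beta /alpha4_of; field. Qed.

Lemma adm_modulus_sq : modulus_sq (alpha4_of c S) c = msq c S.
Proof.
rewrite /modulus_sq adm_alpha1 adm_alpha3 /msq majorE; congr (_ / (_ * _)).
  by rewrite /alpha4_of; field.
by ring.
Qed.

Lemma adm_modulus_sqr : modulus (alpha4_of c S) c ^+ 2 = msq c S.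
Proof. by rewrite /modulus adm_modulus_sq sqr_sqrtr// ltW// msq_gt0. Qed.

Lemma adm_gamma : gamma_ (alpha4_of c S) c = Num.sqrt (major_sq c S / (3 * sc c)).
Proof.
rewrite /gamma_ adm_alpha1 adm_alpha3 majorE; congr (Num.sqrt (_ * _ / _)); ring.
Qed.

Lemma alpha4_of_gt0 : 0 < alpha4_of c S.
Proof. by rewrite divr_gt0// addr_gt0 ?adm_gt0 ?root_gap_gt0. Qed.

(** In this form the period can be compared with the wave, whose amplitude advances by pi when gamma
    x advances by 2 K. *)
Lemma adm_period : period (alpha4_of c S) c =
  2 * ellipticK (modulus (alpha4_of c S) c) / gamma_ (alpha4_of c S) c.
Proof.
have s0 : 0 < sc c := lt_trans ltr01 adm_sc_gt1.
have a0 := alpha4_of_gt0; have b0 := adm_beta_gt0.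
have E : Num.sqrt (2 * Num.sqrt 3 * sc c) /
    Num.sqrt (alpha4_of c S * Num.sqrt (beta (alpha4_of c S) c)) =
    (gamma_ (alpha4_of c S) c)^-1.
  have w0 : 0 < Num.sqrt 3 :> R by rewrite sqrtr_gt0.
  have q0 : 0 < Num.sqrt (beta (alpha4_of c S) c) by rewrite sqrtr_gt0.
  have -> : gamma_ (alpha4_of c S) c = Num.sqrt
     (alpha4_of c S * (Num.sqrt 3 * Num.sqrt (beta (alpha4_of c S) c) / 2) / (3 * sc c)).
    by rewrite adm_gamma majorE adm_sqrt_beta; congr (Num.sqrt (_ * _ / _)); field.
  rewrite -!sqrtrV ?mulr_ge0 ?invr_ge0 ?mulr_ge0 ?(ltW q0) ?(ltW a0) ?(ltW w0) ?(ltW s0) ?addr_ge0 ?(ltW root_gap_gt0) ?(ltW adm_gt0)//.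
  rewrite -sqrtrM ?mulr_ge0 ?(ltW w0) ?(ltW s0)//; congr Num.sqrt.
  have : (3:R) = Num.sqrt 3 * Num.sqrt 3 by rewrite -expr2 sqr_sqrtr.
  move: w0 q0; set w := Num.sqrt 3; set q := Num.sqrt _ => w0 q0 ->.
  by field; rewrite !lt0r_neq0.
by rewrite -E /period; ring.
Qed.

(** The lower end of the range is a^2 + a = r, where alpha_3 = alpha_4; the upper end is 2 a^2 + 3 a
    = 6 r, where alpha_3 = 0. *)
Lemma adm_alpha4_range : alpha4_range c (alpha4_of c S).
Proof.
have [S0 P0 G0] := adm; have d0 := root_gap_gt0; have dS := root_gap_lt.
have r0 := adm_rc_gt0; have e := root_gap_sqr.
rewrite /alpha4_range /= in_itv /=; apply/andP; split.
  suff : Num.sqrt (1 + 4 * rc c) < 2 * alpha4_of c S + 1 by lra.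
  rewrite -(@ltr_pXn2r _ 2)// ?nnegrE ?sqrtr_ge0//; last first.
    by have := alpha4_of_gt0; lra.
  rewrite sqr_sqrtr; last lra.
  by move: e; rewrite /gap_sq /alpha4_of; set d := root_gap _ _ in d0 dS *; nra.
suff : 4 * alpha4_of c S + 3 < Num.sqrt (9 + 48 * rc c) by lra.
rewrite -(@ltr_pXn2r _ 2)// ?nnegrE ?sqrtr_ge0//; last first.
  by have := alpha4_of_gt0; lra.
rewrite sqr_sqrtr; last lra.
by move: e; rewrite /gap_sq /alpha4_of; set d := root_gap _ _ in d0 dS *; nra.
Qed.

End Admissible.

Lemma alpha4_range_admissible a c : alpha4_range c a ->
  exists2 S, admissible c S & a = alpha4_of c S.
Proof.
rewrite /alpha4_range /= in_itv /= => /andP[h1 h2].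
have {}h1 : Num.sqrt (1 + 4 * rc c) < 2 * a + 1 by lra.
have {}h2 : 4 * a + 3 < Num.sqrt (9 + 48 * rc c) by lra.
have a1 : 0 < 2 * a + 1 by apply: le_lt_trans h1; exact: sqrtr_ge0.
have {}h1 : rc c < a ^+ 2 + a.
  (* The sign of [rc c] is unknown here, and the square root of a negative number is 0 by default;
     in that case r < -1/4 <= a^2 + a. The upper bound is treated likewise below. *)
  have [k|k] := leP 0 (1 + 4 * rc c); last by nra.
  move: h1; rewrite -(@ltr_pXn2r _ 2)// ?nnegrE ?sqrtr_ge0// ?ltW// sqr_sqrtr//.
  by lra.
have {}h2 : 2 * a ^+ 2 + 3 * a < 6 * rc c.
  have [k|/ltW k] := leP 0 (9 + 48 * rc c); last first.
    by move: h2; rewrite (ler0_sqrtr k); lra.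
  move: h2; rewrite -(@ltr_pXn2r _ 2)// ?nnegrE ?sqrtr_ge0//; last lra.
  by rewrite sqr_sqrtr//; lra.
have a0 : 0 < a by nra.
have b0 : (2 * a + 3) ^+ 2 < 3 * beta a c by rewrite /beta; lra.
have b1 : 3 * beta a c < (6 * a + 3) ^+ 2 by rewrite /beta; lra.
pose q := Num.sqrt 3 * Num.sqrt (beta a c).
have qq : q ^+ 2 = 3 * beta a c.
  by rewrite exprMn !sqr_sqrtr//; nra.
have q0 : 0 <= q by rewrite mulr_ge0 ?sqrtr_ge0.
have q1 : 2 * a + 3 < q.
  by rewrite -(@ltr_pXn2r _ 2)// ?nnegrE ?qq//; lra.
have q2 : q < 6 * a + 3.
  by rewrite -(@ltr_pXn2r _ 2)// ?nnegrE ?qq//; lra.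
have rE : rc c = (q ^+ 2 / 3 + 4 * a ^+ 2 + 4 * a - 3) / 16.
  by rewrite qq /beta; field.
(* This is a + [alpha3 a c]; the gap a - [alpha3 a c] is then (6 a + 3 - q) / 4. *)
pose S := (2 * a - 3 + q) / 4.
have gS : gap_sq c S = ((6 * a + 3 - q) / 4) ^+ 2.
  by rewrite /gap_sq rE /S; field.
exists S; last first.
  rewrite /alpha4_of /root_gap gS sqrtr_sqr ger0_norm; last lra.
  by rewrite /S; field.
split; first by rewrite /S; lra.
  rewrite (_ : root_prod c S = a * ((- 2 * a - 3 + q) / 4)).
    by apply: mulr_gt0 => //; lra.
  by rewrite /root_prod rE /S; field.
by rewrite gS exprn_gt0//; lra.
Qed.

End WaveParameters.

(** * The complete integral *)

Section CompleteIntegral.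
Context {R : realType}.
Implicit Types (m t x k : R).
Local Notation mu := (@lebesgue_measure R).

Lemma ellipticFE k x : ellipticF k x = ell 0 (k ^+ 2) x.
Proof.
rewrite /ellipticF /ell.
have -> // : ell_integrand 0 (k ^+ 2) =
  fun t => (Num.sqrt (1 - k ^+ 2 * sin t ^+ 2))^-1.
by apply/funext => t; rewrite /ell_integrand /= mul1r expr1.
Qed.

Lemma asin0 : asin 0 = 0 :> R.
Proof.
rewrite -[X in asin X]sin0 sinK// in_itv /=.
by have := @pihalf_ge1 R; move=> *; apply/andP; split; lra.
Qed.

Lemma FTC2_segment (f F : R -> R) (a b : R) : a < b ->
  (forall x, a <= x <= b -> is_derive x 1 F (f x)) ->
  (forall x, a <= x <= b -> {for x, continuous f}) ->
  (\int[mu]_(x in `[a, b]) (f x)%:E = (F b - F a)%:E)%E.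
Proof.
move=> ab dF cf; rewrite EFinB; apply: continuous_FTC2 => //.
- apply/continuous_in_subspaceT => x; rewrite inE /= in_itv /= => h.
  exact: cf.
- split.
  + move=> x; rewrite in_itv /= => /andP[h1 h2].
    by have [] : is_derive x 1 F (f x) by apply: dF; rewrite !ltW.
  + apply: cvg_at_right_filter; apply: is_derive_continuous (dF a _).
    by rewrite lexx ltW.
  + apply: cvg_at_left_filter; apply: is_derive_continuous (dF b _).
    by rewrite lexx ltW.
- move=> x; rewrite in_itv /= => /andP[h1 h2].
  by rewrite derive1E; have [_ ->] : is_derive x 1 F (f x) by apply: dF; rewrite !ltW.
Qed.

Lemma ellipticK_radicand_gt0 k t : k ^+ 2 < 1 -> 0 <= t < 1 ->
  0 < 1 - k ^+ 2 * t ^+ 2 /\ 0 < 1 - t ^+ 2.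
Proof.
move=> k1 /andP[t0 t1]; have := sqr_ge0 k; set m := k ^+ 2 in k1 *.
have t2 : t ^+ 2 < 1 by rewrite expr_lt1.
by have := sqr_ge0 t; set y := t ^+ 2 in t2 *; move=> *; nra.
Qed.

Lemma continuous_ellipticK_integrand k t : k ^+ 2 < 1 -> 0 <= t < 1 ->
  {for t, continuous
    (fun t => (Num.sqrt ((1 - k ^+ 2 * t ^+ 2) * (1 - t ^+ 2)))^-1)}.
Proof.
move=> k1 ht; have [p1 p2] := ellipticK_radicand_gt0 k1 ht.
apply: continuousV; first by rewrite lt0r_neq0// sqrtr_gt0 mulr_gt0.
apply: continuous_sqrt_comp; apply: continuousM.
  apply: continuousB; first exact: cvg_cst.
  by apply: continuousM; [exact: cvg_cst|exact: exprn_continuous].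
by apply: continuousB; [exact: cvg_cst|exact: exprn_continuous].
Qed.

Lemma integral_ellipticK k x : k ^+ 2 < 1 -> 0 < x < 1 ->
  (\int[mu]_(t in `[0%R, x])
    ((Num.sqrt ((1 - k ^+ 2 * t ^+ 2) * (1 - t ^+ 2)))^-1)%:E =
   (ell 0 (k ^+ 2) (asin x))%:E)%E.
Proof.
move=> k1 /andP[x0 x1].
have t01 t : 0 <= t <= x -> 0 <= t < 1.
  by move=> /andP[-> /le_lt_trans]; apply.
have -> : ell 0 (k ^+ 2) (asin x) = ell 0 (k ^+ 2) (asin x) - ell 0 (k ^+ 2) (asin 0).
  by rewrite asin0 /ell oriented_integral0 subr0.
apply: (@FTC2_segment _ (fun x => ell 0 (k ^+ 2) (asin x))) => // t ht.
- have [p1 p2] := ellipticK_radicand_gt0 k1 (t01 t ht); move: ht => /andP[t0 tx].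
  have t1 : -1 < t < 1 by apply/andP; split; lra.
  have ha := is_derive1_asin t1.
  apply: is_derive_eq (is_derive_comp (is_derive_ell 0 _ k1) ha) _.
  rewrite /ell_integrand /= mul1r expr1 /ell_delta asinK ?in_itv /= ?(ltW (andP t1).1) ?(ltW (andP t1).2)//.
  by rewrite sqrtrM ?ltW// invfM.
- exact: continuous_ellipticK_integrand k1 (t01 t ht).
Qed.

(** Substitution t = sin theta. The integrand is singular at t = 1, so the substitution is made on
    [0, sin (b n)] with b n increasing to pi / 2, and monotone convergence gives the limit. *)
Lemma ellipticKE k : k ^+ 2 < 1 -> ellipticK k = ell 0 (k ^+ 2) (pi / 2).
Proof.
move=> k1; pose G t := (Num.sqrt ((1 - k ^+ 2 * t ^+ 2) * (1 - t ^+ 2)))^-1.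
pose b n : R := pi / 2 - harmonic n.
have h01 n : 0 < (harmonic n : R) <= 1.
  by rewrite invr_gt0 ltr0Sn /= invf_le1 ?ltr0Sn// ler1n.
have b0 n : 0 <= b n by have /andP[] := h01 n; have := @pihalf_ge1 R; rewrite /b; lra.
have b1 n : b n < pi / 2 by have /andP[] := h01 n; rewrite /b; lra.
have bb n : b n \in `[- (pi / 2), pi / 2].
  by rewrite in_itv /=; have := b0 n; have := b1 n; have := @pihalf_ge1 R; move=> *; apply/andP; split; lra.
have sb n : 0 <= sin (b n) < 1.
  have h0 : (0:R) \in `[- (pi / 2), pi / 2].
    by rewrite in_itv /=; have := @pihalf_ge1 R; move=> *; apply/andP; split; lra.
  have h1 : (pi / 2 : R) \in `[- (pi / 2), pi / 2].
    by rewrite in_itv /=; have := @pihalf_ge1 R; move=> *; apply/andP; split; lra.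
  rewrite -{1}(@sin0 R) -(@sin_pihalf R) ltr_sin// b1 andbT.
  by rewrite leNgt ltr_sin// -leNgt b0.
pose F n := [set` `[0, sin (b n)]] : set R.
have intF n : (\int[mu]_(t in F n) (G t)%:E = (ell 0 (k ^+ 2) (b n))%:E)%E.
  (* Only b n >= 0 is known, from harmonic n <= 1 <= pi / 2, so the degenerate segment is treated
     apart. *)
  have /andP[] := sb n; rewrite /F le_eqVlt => /predU1P[e|s0] s1.
    have -> : b n = 0 by rewrite -(sinK (bb n)) -e asin0.
    by rewrite sin0 set_itv1 integral_set1 /ell oriented_integral0.
  by rewrite integral_ellipticK ?s0// sinK.
have UF : \bigcup_n F n = `[0, 1[%classic.
  apply/seteqP; split => [t [n _]|t] /=; rewrite !in_itv /=.
    rewrite /F /= in_itv /= => /andP[-> /le_lt_trans]; apply.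
    by have /andP[] := sb n.
  move=> /andP[t0 t1].
  have [n _ hn] : \forall n \near \oo, harmonic n < pi / 2 - asin t.
    have := @cvg_harmonic R => /cvgr_lt; apply.
    by rewrite subr_gt0 asin_ltpi2// t1 andbT; lra.
  exists n => //; rewrite /F /= in_itv /= t0 /=.
  rewrite -[t]asinK ?in_itv /=; last by apply/andP; split; lra.
  rewrite leNgt ltr_sin ?bb//; last first.
    by rewrite in_itv /= asin_geNpi2 ?asin_lepi2//; apply/andP; split; lra.
  have hh : harmonic n < pi / 2 - asin t := hn n (leqnn n).
  by rewrite -leNgt /b; move: hh; set h := harmonic n => hh; lra.
have mG n : measurable_fun (F n) G.
  apply: subspace_continuous_measurable_fun; first exact: measurable_itv.
  apply/continuous_in_subspaceT => t; rewrite inE /F /= in_itv /= => /andP[t0 t1].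
  by apply: continuous_ellipticK_integrand => //; rewrite t0 /= (le_lt_trans t1)//; have /andP[] := sb n.
have mG1 : measurable_fun (`[(0:R), (1:R)[%classic : set R) G.
  apply: subspace_continuous_measurable_fun; first exact: measurable_itv.
  apply/continuous_in_subspaceT => t; rewrite inE /= in_itv /= => ht.
  exact: continuous_ellipticK_integrand.
have c1 : (\int[mu]_(t in F n) (G t)%:E @[n --> \oo] --> \int[mu]_(t in `[0%R, 1%R[) (G t)%:E)%E.
  rewrite -UF; apply: ge0_nondecreasing_set_cvg_integral.
  - apply/nondecreasing_seqP => n; rewrite subsetEset /F; apply: subset_itvl.
    rewrite bnd_simp leNgt ltr_sin// -leNgt /b lerB// /harmonic.
    by rewrite lef_pV2 ?posrE ?ltr0Sn// ler_nat.
  - by move=> n; exact: measurable_itv.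
  - move=> n; apply/measurable_EFinP; exact: mG.
  - by move=> n t _; rewrite lee_fin invr_ge0 sqrtr_ge0.
have c2 : (\int[mu]_(t in F n) (G t)%:E @[n --> \oo] --> (ell 0 (k ^+ 2) (pi / 2))%:E)%E.
  under eq_fun do rewrite intF.
  apply: cvg_EFin; first exact: nearW.
  have cb : b n @[n --> \oo] --> pi / 2.
    rewrite -[X in _ --> X]subr0; apply: cvgB; first exact: cvg_cst.
    exact: cvg_harmonic.
  apply: continuous_cvg cb.
  exact: is_derive_continuous (is_derive_ell 0 (pi / 2) k1).
have := cvg_unique _ c1 c2; rewrite /ellipticK /Rintegral.
(* The endpoint 1, where the integrand takes its junk value, has measure zero. *)
rewrite -integral_itv_bndo_bndc; last exact/measurable_EFinP.
by move=> ->.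
Qed.

(** Inequalities between elliptic integrals are proved below by letting the endpoint vary and
    comparing integrands. *)
Lemma ge0_of_derive_ge0 (f df : R -> R) x : 0 <= x -> f 0 = 0 ->
  (forall t, 0 <= t <= x -> is_derive t 1 f (df t)) ->
  (forall t, 0 <= t <= x -> 0 <= df t) -> 0 <= f x.
Proof.
move=> x0 f0 hd hp; have [|y] := @MVT_gen R f df 0 x.
  by rewrite (min_idPl x0) (max_idPr x0).
rewrite (min_idPl x0) (max_idPr x0) f0 !subr0 => /hp hy ->.
exact: mulr_ge0.
Qed.

Lemma ell0 n m : ell n m 0 = 0.
Proof. exact: oriented_integral0. Qed.

Definition completeK m : R := ell 0 m (pi / 2).

Lemma ell_integrand0 m t : ell_integrand 0 m t = (ell_delta m t)^-1.
Proof. by rewrite /ell_integrand /= mul1r expr1. Qed.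

(** Delta is at least sqrt(1 - m). Equality holds at m = 0, which makes the resulting bound on the
    period sharp where the gap closes. *)
Lemma completeK_le m : 0 <= m -> m < 1 ->
  completeK m <= pi / 2 / Num.sqrt (1 - m).
Proof.
move=> m0 m1; rewrite -subr_ge0.
have q0 : 0 < Num.sqrt (1 - m) by rewrite sqrtr_gt0 subr_gt0.
apply: (@ge0_of_derive_ge0 (fun x => x / Num.sqrt (1 - m) - ell 0 m x)
  (fun x => (Num.sqrt (1 - m))^-1 - ell_integrand 0 m x)).
- by rewrite divr_ge0 ?pi_ge0.
- by rewrite ell0 mul0r subr0.
- move=> t _; apply: is_derive_sub; last exact: is_derive_ell.
  apply: is_derive_eq (is_derive_mul (is_derive_id t 1) (is_derive_const _ t)) _.
  by rewrite mul1r mulr0 addr0.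
- move=> t _; rewrite ell_integrand0 subr_ge0 lef_pV2 ?posrE ?ell_delta_gt0//.
  by apply: ler_wsqrtr; have := sin2_le1 t; set y := _ ^+ 2; nra.
Qed.

Lemma cos_le_pihalfB t : 0 <= t <= pi / 2 -> cos t <= pi / 2 - t.
Proof.
move=> /andP[t0 t1]; rewrite -subr_ge0.
have -> : cos t = sin (pi / 2 - t).
  by rewrite sinB sin_pihalf cos_pihalf mul0r subr0 mul1r.
apply: (@ge0_of_derive_ge0 (fun x => x - sin x) (fun x => 1 - cos x)).
- by rewrite subr_ge0.
- by rewrite sin0 subrr.
- by move=> x _; rewrite subr_ge0 cos_le1.
Qed.

(** With q^2 = 1 - m, Delta^2 = cos^2 + q^2 sin^2 <= (cos x + q)^2 <= (pi / 2 - x + q)^2, and the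
    reciprocal of the last root integrates to a logarithm. This is the divergence of K as m tends to
    1. *)
Lemma completeK_ge m : 0 <= m -> m < 1 ->
  ln (1 + pi / (2 * Num.sqrt (1 - m))) <= completeK m.
Proof.
move=> m0 m1; set q := Num.sqrt (1 - m).
have q0 : 0 < q by rewrite sqrtr_gt0 subr_gt0.
have qq : q ^+ 2 = 1 - m by rewrite sqr_sqrtr// subr_ge0 ltW.
have p1 := @pihalf_ge1 R.
rewrite -subr_ge0.
have -> : ln (1 + pi / (2 * q)) = ln (pi / 2 + q) - ln (pi / 2 + q - pi / 2).
  have -> : pi / 2 + q - pi / 2 = q by ring.
  rewrite -ln_div ?posrE; last by []; last lra.
  by congr ln; field; rewrite lt0r_neq0.
apply: (@ge0_of_derive_ge0
   (fun x => ell 0 m x - (ln (pi / 2 + q) - ln (pi / 2 + q - x)))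
   (fun x => (ell_delta m x)^-1 - (pi / 2 + q - x)^-1)).
- lra.
- by rewrite ell0 subr0 subrr subrr.
- move=> x /andP[x0 x1]; rewrite -ell_integrand0.
  apply: is_derive_sub; first exact: is_derive_ell.
  have h : 0 < pi / 2 + q - x by lra.
  have h2 := is_derive_comp (g := fun x => pi / 2 + q - x) (is_derive1_ln h)
     (is_derive_sub (is_derive_const (pi / 2 + q) x) (is_derive_id x 1)).
  apply: is_derive_eq (is_derive_sub (is_derive_const (ln (pi / 2 + q)) x) h2) _.
  by rewrite !sub0r mulrN1 opprK.
- move=> x /andP[x0 x1]; rewrite subr_ge0 lef_pV2 ?posrE ?ell_delta_gt0//; last lra.
  rewrite -(@ler_pXn2r _ 2)// ?nnegrE ?sqrtr_ge0//; last lra.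
  rewrite ell_delta_sqr//.
  have c1 : cos x <= pi / 2 - x by apply: cos_le_pihalfB; rewrite x0.
  have c0 : 0 <= cos x by apply: cos_ge0_pihalf; apply/andP; split; lra.
  have -> : 1 - m * sin x ^+ 2 = cos x ^+ 2 + q ^+ 2 * sin x ^+ 2.
    by rewrite qq sin2cos2; ring.
  apply: (@le_trans _ _ ((cos x + q) ^+ 2)).
    have := sin2_le1 x; have := sqr_ge0 (sin x); set y := sin x ^+ 2 => y0 y1.
    nra.
  by apply: lerXn2r; rewrite ?nnegrE; lra.
Qed.

(* The derivative of [sin x cos x / ell_delta m x] integrates to 0 over a quarter period;
   adding a suitable multiple of it turns the integrand into a square. *)
Lemma ell1_ge m : 0 <= m -> m < 1 ->
  completeK m <=
  Num.sqrt (1 - m) * (1 + Num.sqrt (1 - m)) * ell 1 m (pi / 2).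
Proof.
move=> m0 m1; set q := Num.sqrt (1 - m).
have q0 : 0 < q by rewrite sqrtr_gt0 subr_gt0.
have qq : m = 1 - q ^+ 2 by rewrite sqr_sqrtr ?subr_ge0 ?ltW//; ring.
have q1 : q <= 1 by rewrite -(sqrtr1 R) ler_wsqrtr//; lra.
rewrite -subr_ge0.
have := @ge0_of_derive_ge0
   (fun x => q * (1 + q) * ell 1 m x + (1 + q) / (2 * q) * (sin x * cos x / ell_delta m x) - ell 0 m x)
   (fun x => q * (1 + q) * ell_integrand 1 m x + (1 + q) / (2 * q) *
      ((1 - 2 * sin x ^+ 2 + m * sin x ^+ 4) * (ell_delta m x)^-1 ^+ 3) - ell_integrand 0 m x) (pi / 2).
rewrite cos_pihalf mulr0 mul0r mulr0 addr0; apply.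
- by rewrite divr_ge0 ?pi_ge0.
- by rewrite !ell0 sin0 !(mul0r, mulr0, addr0, subr0).
- move=> x _; apply: is_derive_sub; last exact: is_derive_ell.
  apply: is_derive_add.
    apply: is_derive_eq (is_derive_mul (is_derive_const _ x) (is_derive_ell 1 x m1)) _.
    by rewrite mul0r add0r.
  have d0 : ell_delta m x != 0 by rewrite lt0r_neq0// ell_delta_gt0.
  have dd := is_derive_ell_delta (u := fun=> m) (v := id) m1 (is_derive_const m x) (is_derive_id x 1).
  have h := is_derive_mul (is_derive_mul (is_derive_sin x) (is_derive_cos x)) (@is_derive_inv _ (ell_delta m) x _ d0 dd).
  apply: is_derive_eq (is_derive_mul (is_derive_const _ x) h) _.
  rewrite mul0r add0r; congr (_ * _).
  have e1 : ell_delta m x ^+ 2 = 1 - m * sin x ^+ 2 by exact: ell_delta_sqr.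
  have e2 := cos2sin2 x.
  rewrite /=; move: d0 e1 e2; set d := ell_delta m x; set s := sin x; set c := cos x => d0 e1 e2.
  transitivity (((c ^+ 2 - s ^+ 2) * d ^+ 2 + m * s ^+ 2 * c ^+ 2) * d^-1 ^+ 3); first by field.
  by rewrite e1 e2; congr (_ * _); ring.
- move=> x _; rewrite ell_integrand0 /ell_integrand /=.
  have d0 := ell_delta_gt0 x m1.
  have e1 : ell_delta m x ^+ 2 = 1 - m * sin x ^+ 2 by exact: ell_delta_sqr.
  move: d0 e1; set d := ell_delta m x; set s := sin x => d0 e1.
  (* The numerator is quadratic in y = s^2; the multiple (1 + q) / (2 q) is the one that gives it a
     double root, at y = 1 / (1 + q). *)
  rewrite (_ : _ - _ = (1 - q) * (1 - (1 + q) * s ^+ 2) ^+ 2 / (2 * q) * d^-1 ^+ 3).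
    apply: mulr_ge0; last by rewrite exprn_ge0// invr_ge0 ltW.
    apply: divr_ge0; last by rewrite mulr_ge0// ltW.
    by apply: mulr_ge0; rewrite ?subr_ge0 ?sqr_ge0.
  have e2 : d^-1 = (1 - m * s ^+ 2) * d^-1 ^+ 3.
    by rewrite -e1; field; rewrite lt0r_neq0.
  rewrite [X in _ - X = _]e2 (_ : 1.*2 = 2%N)// qq; field.
  by rewrite !lt0r_neq0.
Qed.

Lemma completeK_gt0 m : 0 <= m -> m < 1 -> 0 < completeK m.
Proof.
move=> m0 m1; apply: lt_le_trans (completeK_ge m0 m1).
by rewrite ln_gt0// ltrDl divr_gt0 ?pi_gt0// mulr_gt0// sqrtr_gt0 subr_gt0.
Qed.

Lemma is_derive_completeK m : m < 1 ->
  is_derive m 1 completeK (2^-1 * ell 1 m (pi / 2)).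
Proof.
move=> m1; apply: is_derive_eq (is_derive_ell_param 0 (pi / 2) m1) _.
by rewrite add0r.
Qed.

(** By Landen's transformation K(k) (1 + k') is twice K at the modulus (1 - k') / (1 + k'), which
    grows with k. Here the sign of the derivative is read off directly: it is the content of
    [ell1_ge]. *)
Lemma is_derive_completeK_scaled m : 0 <= m -> m < 1 ->
  exists2 d, 0 <= d &
  is_derive m 1 (fun p => completeK p * (1 + Num.sqrt (1 - p))) d.
Proof.
move=> m0 m1; set q := Num.sqrt (1 - m).
have q0 : 0 < q by rewrite sqrtr_gt0 subr_gt0.
have h1 : 0 < 1 - m by rewrite subr_gt0.
have hs := is_derive_sqrt (f := fun p => 1 - p) h1
   (is_derive_sub (is_derive_const 1 m) (is_derive_id m 1)).
eexists; last first.
  exact: is_derive_mul (is_derive_completeK m1)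
    (is_derive_add (is_derive_const 1 m) hs).
have := ell1_ge m0 m1; rewrite -/q => h.
rewrite (_ : _ + _ = (q * (1 + q) * ell 1 m (pi / 2) - completeK m) / (2 * q)).
  by apply: divr_ge0; [rewrite subr_ge0|rewrite mulr_ge0// ltW].
by field; rewrite lt0r_neq0.
Qed.

End CompleteIntegral.

(** * Monotonicity of the period *)

Section PeriodMap.
Context {R : realType}.
Implicit Types (c S L : R).

Definition period_map c S : R :=
  2 * completeK (msq c S) / Num.sqrt (major_sq c S / (3 * sc c)).

Lemma period_mapE c S : admissible c S ->
  period (alpha4_of c S) c = period_map c S.
Proof.
move=> adm; rewrite adm_period// ellipticKE adm_modulus_sqr ?msq_lt1//.
by rewrite adm_gamma.
Qed.

Lemma near_admissible c S : admissible c S ->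
  \forall c' \near c & S' \near S, admissible c' S'.
Proof.
move=> [h1 h2 h3].
have c1 : {for (c, S), continuous (fun q : R * R => q.1)} by exact: cvg_fst.
have c2 : {for (c, S), continuous (fun q : R * R => q.2)} by exact: cvg_snd.
have cr : {for (c, S), continuous (fun q : R * R => rc q.1)}.
  by apply: continuousB; [exact: cvg_cst|exact: continuous_pow].
have cP : {for (c, S), continuous (fun q : R * R => root_prod q.1 q.2)}.
  apply: continuousB; last by apply: continuousM => //; exact: cvg_cst.
  apply: continuousD; first exact: continuous_pow.
  by apply: continuousM => //; exact: cvg_cst.
have cG : {for (c, S), continuous (fun q : R * R => gap_sq q.1 q.2)}.
  apply: continuousB; last first.
    by apply: continuousM; [exact: cvg_cst|exact: continuous_pow].
  by apply: continuousB; apply: continuousM => //; exact: cvg_cst.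
have n1 := cvgr_gt _ c2 _ h1.
have n2 := cvgr_gt _ cP _ h2.
have n3 := cvgr_gt _ cG _ h3.
have F := nbhs_filter ((c, S) : R * R).
by apply: filterS3 (n1 F) (n2 F) (n3 F) => q.
Qed.

Lemma near_admissible_r c S : admissible c S -> \forall S' \near S, admissible c S'.
Proof.
move=> /near_admissible[[A B] /= [hA hB] hAB].
by apply: filterS hB => S' BS'; apply: (hAB (c, S')); split => //; exact: nbhs_singleton hA.
Qed.

Lemma near_admissible_l c S : admissible c S -> \forall c' \near c, admissible c' S.
Proof.
move=> /near_admissible[[A B] /= [hA hB] hAB].
by apply: filterS hA => c' Ac'; apply: (hAB (c', S)); split => //; exact: nbhs_singleton hB.
Qed.

(** For S > 0 [root_prod] increases and [gap_sq] decreases, so the admissible S form an interval. *)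
Lemma admissible_convex c S1 S2 S : admissible c S1 -> admissible c S2 ->
  S1 <= S <= S2 -> admissible c S.
Proof.
move=> [h1 h2 _] [_ _ k3] /andP[e1 e2]; split; first exact: lt_le_trans e1.
  apply: lt_le_trans h2 _; rewrite /root_prod; nra.
by apply: lt_le_trans k3 _; rewrite /gap_sq; nra.
Qed.

(** These are X^2 + Y^2, X^2 Y^2 and X + Y, written without the gap: the gap decreases in S, whereas
    every factor kept here increases. *)
Definition sum_sq c S : R := 3 * S ^+ 2 + 9 / 2 * S - 6 * rc c.
Definition prod_sq c S : R :=
  root_prod c S * (root_prod c S + 2 * S ^+ 2 + 9 / 2 * S + 9 / 4).
Definition axes_sum c S : R := Num.sqrt (sum_sq c S + 2 * Num.sqrt (prod_sq c S)).

Lemma prod_sq_gt0 c S : admissible c S -> 0 < prod_sq c S.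
Proof.
move=> [S0 P0 _]; apply: mulr_gt0 => //; have := sqr_ge0 S; lra.
Qed.

Lemma prod_sqE c S : admissible c S -> major_sq c S * minor_sq c S = prod_sq c S.
Proof.
move=> adm; have e := root_gap_sqr adm.
transitivity (((3 * S ^+ 2 + 9 / 2 * S - 6 * rc c) ^+ 2
              - (S + 3 / 2) ^+ 2 * root_gap c S ^+ 2) / 4).
  by rewrite /major_sq /minor_sq; field.
by rewrite e /gap_sq /prod_sq /root_prod; field.
Qed.

Lemma sum_sqE c S : sum_sq c S = major_sq c S + minor_sq c S.
Proof. by rewrite /sum_sq /major_sq /minor_sq; field. Qed.

Lemma sum_sq_gt0 c S : admissible c S -> 0 < sum_sq c S.
Proof. by move=> adm; rewrite sum_sqE addr_gt0 ?major_gt0 ?minor_gt0. Qed.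

Lemma axes_sumE c S : admissible c S ->
  axes_sum c S = Num.sqrt (major_sq c S) + Num.sqrt (minor_sq c S).
Proof.
move=> adm; have M0 := major_gt0 adm; have m0 := minor_gt0 adm.
rewrite /axes_sum -prod_sqE// sum_sqE sqrtrM ?ltW//.
rewrite -{1}(sqr_sqrtr (ltW M0)) -{1}(sqr_sqrtr (ltW m0)).
set X := Num.sqrt (major_sq c S); set Y := Num.sqrt (minor_sq c S).
rewrite (_ : _ + _ + _ = (X + Y) ^+ 2); last by ring.
by rewrite sqrtr_sqr ger0_norm// addr_ge0 ?sqrtr_ge0.
Qed.

Lemma period_map_axes c S : admissible c S ->
  period_map c S = 2 * Num.sqrt (3 * sc c) *
    (completeK (msq c S) * (1 + Num.sqrt (1 - msq c S))) / axes_sum c S.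
Proof.
move=> adm; have M0 := major_gt0 adm; have m0 := minor_gt0 adm.
have s0 : 0 < 3 * sc c by rewrite mulr_gt0// (lt_trans ltr01 (adm_sc_gt1 adm)).
have si : 0 <= (3 * sc c)^-1 by rewrite invr_ge0 ltW.
have Mi : 0 <= (major_sq c S)^-1 by rewrite invr_ge0 ltW.
have E1 : Num.sqrt (major_sq c S / (3 * sc c)) =
    Num.sqrt (major_sq c S) / Num.sqrt (3 * sc c).
  by rewrite sqrtrM ?(ltW M0)// sqrtrV ?(ltW s0).
have E2 : Num.sqrt (minor_sq c S / major_sq c S) =
    Num.sqrt (minor_sq c S) / Num.sqrt (major_sq c S).
  by rewrite sqrtrM ?(ltW m0)// sqrtrV ?(ltW M0).
rewrite axes_sumE// /period_map onem_msq// E1 E2.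
have h1 : 0 < Num.sqrt (major_sq c S) by rewrite sqrtr_gt0.
have h2 : 0 < Num.sqrt (minor_sq c S) by rewrite sqrtr_gt0.
have h3 : 0 < Num.sqrt (3 * sc c) by rewrite sqrtr_gt0.
field.
by rewrite !lt0r_neq0// addr_gt0.
Qed.

(** With A = [sum_sq] and d = [root_gap], [msq] is 2 / (1 + A / ((S + 3/2) d)); here d decreases and
    A / (S + 3/2) increases, the latter being the positivity of [B0]. *)
Lemma is_derive_msq c S : admissible c S ->
  exists2 d, d <= 0 & is_derive S 1 (msq c) d.
Proof.
move=> adm; have M0 := major_gt0 adm; have A0 := sum_sq_gt0 adm.
have r0 := adm_rc_gt0 adm; have d0 := root_gap_gt0 adm; have S0 := adm_gt0 adm.
have g0 : 0 < gap_sq c S by case: adm.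
have hg : is_derive S 1 (gap_sq c) (- 6 - 6 * S).
  apply: is_derive_eq (is_derive_sub (is_derive_sub (is_derive_const (12 * rc c) S)
    (is_derive_mul (is_derive_const 6 S) (is_derive_id S 1)))
    (is_derive_mul (is_derive_const 3 S) (is_derive_pow 2 (is_derive_id S 1)))) _.
  by rewrite /=; ring.
have hd := is_derive_sqrt g0 hg.
have hu : is_derive S 1 (fun x => (x + 3 / 2) * root_gap c x)
   (root_gap c S + (S + 3 / 2) * ((- 6 - 6 * S) / (2 * root_gap c S))).
  apply: is_derive_eq (is_derive_mul (is_derive_add (is_derive_id S 1) (is_derive_const (3 / 2) S)) hd) _.
  by rewrite addr0 mul1r.
have hA : is_derive S 1 (sum_sq c) (6 * S + 9 / 2).
  apply: is_derive_eq (is_derive_sub (is_derive_add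
    (is_derive_mul (is_derive_const 3 S) (is_derive_pow 2 (is_derive_id S 1)))
    (is_derive_mul (is_derive_const (9 / 2) S) (is_derive_id S 1)))
    (is_derive_const (6 * rc c) S)) _.
  by rewrite /=; ring.
have hM : is_derive S 1 (major_sq c) (((6 * S + 9 / 2) +
   (root_gap c S + (S + 3 / 2) * ((- 6 - 6 * S) / (2 * root_gap c S)))) / 2).
  apply: is_derive_eq (is_derive_mul (is_derive_add hA hu) (is_derive_const 2^-1 S)) _.
  by rewrite mulr0 addr0.
eexists; last exact: is_derive_mul hu (is_derive_inv (lt0r_neq0 M0) hM).
have B0 : 0 < (S + 3 / 2) * (6 * S + 9 / 2) - sum_sq c S.
  by rewrite /sum_sq; have := sqr_ge0 S; move: S0 r0; clear; lra.
move: A0 M0 B0; rewrite -[major_sq c S]/((sum_sq c S + (S + 3 / 2) * root_gap c S) / 2).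
set d := root_gap c S in d0 *; set A := sum_sq c S => A0 M0 B0.
rewrite [leLHS](_ : _ = - (3 * (S + 3 / 2) * (1 + S) * A
   + d ^+ 2 * ((S + 3 / 2) * (6 * S + 9 / 2) - A)) /
   (2 * d * ((A + (S + 3 / 2) * d) / 2) ^+ 2)).
  rewrite mulNr oppr_le0; apply: divr_ge0; last first.
    by apply: mulr_ge0; [lra|rewrite exprn_ge0// ltW].
  apply: addr_ge0; last by rewrite mulr_ge0 ?exprn_ge0 ?ltW.
  by rewrite !mulr_ge0// ?(ltW A0)//; lra.
field.
by rewrite !lt0r_neq0//; lra.
Qed.

Lemma is_derive_axes_sum c S : admissible c S ->
  exists2 d, 0 < d & is_derive S 1 (axes_sum c) d.
Proof.
move=> adm; have A0 := sum_sq_gt0 adm; have Q0 := prod_sq_gt0 adm.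
have [S0 P0 _] := adm.
have hA : is_derive S 1 (sum_sq c) (6 * S + 9 / 2).
  apply: is_derive_eq (is_derive_sub (is_derive_add
    (is_derive_mul (is_derive_const 3 S) (is_derive_pow 2 (is_derive_id S 1)))
    (is_derive_mul (is_derive_const (9 / 2) S) (is_derive_id S 1)))
    (is_derive_const (6 * rc c) S)) _.
  by rewrite /=; ring.
have hP : is_derive S 1 (root_prod c) (2 * S + 3 / 2).
  apply: is_derive_eq (is_derive_sub (is_derive_add
    (is_derive_pow 2 (is_derive_id S 1))
    (is_derive_mul (is_derive_const (3 / 2) S) (is_derive_id S 1)))
    (is_derive_const (3 * rc c) S)) _.
  by rewrite /=; ring.
have hQ : is_derive S 1 (fun x => root_prod c x + 2 * x ^+ 2 + 9 / 2 * x + 9 / 4)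
    (2 * S + 3 / 2 + 4 * S + 9 / 2).
  apply: is_derive_eq (is_derive_add (is_derive_add (is_derive_add hP
    (is_derive_mul (is_derive_const 2 S) (is_derive_pow 2 (is_derive_id S 1))))
    (is_derive_mul (is_derive_const (9 / 2) S) (is_derive_id S 1)))
    (is_derive_const (9 / 4) S)) _.
  by rewrite /=; ring.
have hV := is_derive_sqrt Q0 (is_derive_mul hP hQ).
have hW := is_derive_add hA (is_derive_mul (is_derive_const 2 S) hV).
have W0 : 0 < sum_sq c S + 2 * Num.sqrt (prod_sq c S).
  by rewrite addr_gt0// mulr_gt0// sqrtr_gt0.
have hs := is_derive_sqrt
  (f := fun t => sum_sq c t + 2 * Num.sqrt (prod_sq c t)) W0 hW.
eexists; last exact: hs.
apply: divr_gt0; last by rewrite mulr_gt0// sqrtr_gt0.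
rewrite mul0r add0r; apply: addr_gt0; first lra.
apply: mulr_gt0 => //; apply: divr_gt0; last by rewrite mulr_gt0// sqrtr_gt0.
by apply: addr_gt0; apply: mulr_gt0 => //; have := sqr_ge0 S; lra.
Qed.

Lemma is_derive_period_map c S : admissible c S ->
  exists2 d, d < 0 & is_derive S 1 (period_map c) d.
Proof.
move=> adm.
have [d1 d1le hm] := is_derive_msq adm.
have [d2 d2gt hw] := is_derive_axes_sum adm.
have m0 := msq_gt0 adm; have m1 := msq_lt1 adm.
have [d3 d3ge hB] := is_derive_completeK_scaled (ltW m0) m1.
have M0 := major_gt0 adm; have n0 := minor_gt0 adm.
have w0 : 0 < axes_sum c S.
  by rewrite axes_sumE// addr_gt0// sqrtr_gt0.
have B0 : 0 < completeK (msq c S) * (1 + Num.sqrt (1 - msq c S)).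
  by rewrite mulr_gt0// ?completeK_gt0 ?ltW// ltr_wpDr ?sqrtr_ge0.
have s0 : 0 < 2 * Num.sqrt (3 * sc c).
  by rewrite mulr_gt0// sqrtr_gt0 mulr_gt0// (lt_trans ltr01 (adm_sc_gt1 adm)).
have hBm := is_derive_comp (f := fun p => completeK p * (1 + Num.sqrt (1 - p))) hB hm.
have h := is_derive_mul (is_derive_mul (is_derive_const (2 * Num.sqrt (3 * sc c)) S) hBm)
  (is_derive_inv (lt0r_neq0 w0) hw).
eexists; last first.
  apply: near_eq_is_derive h; near=> x.
  apply/esym/period_map_axes; near: x; exact: near_admissible_r.
rewrite mul0r add0r -[X in X < _]opprK oppr_lt0.
move: w0 B0 s0; set w := axes_sum c S; set B := _ * (1 + _); set s := 2 * _ => w0 B0 s0.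
rewrite (_ : - _ = s * (d3 * - d1 * w + B * d2) / w ^+ 2); last first.
  by field; rewrite lt0r_neq0.
apply: divr_gt0; last exact: exprn_gt0.
apply: mulr_gt0 => //; apply: ltr_wpDl; last exact: mulr_gt0.
by apply: mulr_ge0; [rewrite mulr_ge0// oppr_ge0|exact: ltW].
Unshelve. all: by end_near. Qed.

Lemma continuous_period_map c S : admissible c S ->
  {for S, continuous (period_map c)}.
Proof. by move=> /is_derive_period_map[d _]; exact: is_derive_continuous. Qed.

Lemma period_map_decr c S1 S2 : admissible c S1 -> admissible c S2 ->
  S1 < S2 -> period_map c S2 < period_map c S1.
Proof.
move=> h1 h2 h12.
have adm x : S1 <= x <= S2 -> admissible c x by exact: admissible_convex.
(* The derivative is known only through the existence of a negative value; this gives it a name for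
   the mean value theorem. *)
pose df x := 'D_1 (period_map c) x.
have hd x : S1 <= x <= S2 -> is_derive x 1 (period_map c) (df x).
  move=> /adm /is_derive_period_map[d _ hd]; apply/derivableP.
  by case: hd.
have [|x hx e] := @MVT_gen R (period_map c) df S1 S2.
  by rewrite (min_idPl (ltW h12)) (max_idPr (ltW h12)).
rewrite (min_idPl (ltW h12)) (max_idPr (ltW h12)) in hx.
have [d d0 hd'] := is_derive_period_map (adm _ hx).
rewrite (is_derive_uniq (hd _ hx) hd') in e.
by rewrite -subr_lt0 e nmulr_rlt0// subr_gt0.
Qed.

Lemma period_map_inj c S1 S2 : admissible c S1 -> admissible c S2 ->
  period_map c S1 = period_map c S2 -> S1 = S2.
Proof.
move=> h1 h2 e; case: (ltgtP S1 S2) => // h.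
  by have := period_map_decr h1 h2 h; rewrite e ltxx.
by have := period_map_decr h2 h1 h; rewrite e ltxx.
Qed.

(** From K <= pi X / (2 Y) the factor X cancels. The bound is continuous up to the closing of the
    gap, where it equals the limit of the period. *)
Lemma period_map_le c S : admissible c S ->
  period_map c S <= pi * Num.sqrt (3 * sc c) / Num.sqrt (minor_sq c S).
Proof.
move=> adm; have m0 := msq_gt0 adm; have m1 := msq_lt1 adm.
have M0 := major_gt0 adm; have n0 := minor_gt0 adm.
have s0 : 0 < 3 * sc c by rewrite mulr_gt0// (lt_trans ltr01 (adm_sc_gt1 adm)).
have E1 : Num.sqrt (major_sq c S / (3 * sc c)) =
    Num.sqrt (major_sq c S) / Num.sqrt (3 * sc c).
  by rewrite sqrtrM ?(ltW M0)// sqrtrV ?(ltW s0).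
have E2 : Num.sqrt (minor_sq c S / major_sq c S) =
    Num.sqrt (minor_sq c S) / Num.sqrt (major_sq c S).
  by rewrite sqrtrM ?(ltW n0)// sqrtrV ?(ltW M0).
have h1 : 0 < Num.sqrt (major_sq c S) by rewrite sqrtr_gt0.
have h2 : 0 < Num.sqrt (minor_sq c S) by rewrite sqrtr_gt0.
have h3 : 0 < Num.sqrt (3 * sc c) by rewrite sqrtr_gt0.
have := completeK_le (ltW m0) m1; rewrite onem_msq// E2 /period_map E1 => hK.
rewrite [leRHS](_ : _ = 2 * (pi / 2 / (Num.sqrt (minor_sq c S) / Num.sqrt (major_sq c S)))
    / (Num.sqrt (major_sq c S) / Num.sqrt (3 * sc c))); last first.
  by field; rewrite !lt0r_neq0.
by rewrite ler_pM2r ?invr_gt0 ?divr_gt0// ler_pM2l.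
Qed.

(** Only the divergence as Y tends to 0 matters, so the factor sqrt(3 s) is bounded below by 1. *)
Lemma period_map_ge c S : admissible c S ->
  2 / Num.sqrt (major_sq c S) *
    ln (1 + pi * Num.sqrt (major_sq c S) / (2 * Num.sqrt (minor_sq c S)))
  <= period_map c S.
Proof.
move=> adm; have m0 := msq_gt0 adm; have m1 := msq_lt1 adm.
have M0 := major_gt0 adm; have n0 := minor_gt0 adm.
have s1 : 1 <= 3 * sc c by have := adm_sc_gt1 adm; lra.
have s0 : 0 < 3 * sc c by lra.
have E1 : Num.sqrt (major_sq c S / (3 * sc c)) =
    Num.sqrt (major_sq c S) / Num.sqrt (3 * sc c).
  by rewrite sqrtrM ?(ltW M0)// sqrtrV ?(ltW s0).
have E2 : Num.sqrt (minor_sq c S / major_sq c S) =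
    Num.sqrt (minor_sq c S) / Num.sqrt (major_sq c S).
  by rewrite sqrtrM ?(ltW n0)// sqrtrV ?(ltW M0).
have h1 : 0 < Num.sqrt (major_sq c S) by rewrite sqrtr_gt0.
have h2 : 0 < Num.sqrt (minor_sq c S) by rewrite sqrtr_gt0.
have h3 : 1 <= Num.sqrt (3 * sc c) by rewrite -[leLHS](sqrtr1 R) ler_wsqrtr.
have h30 : 0 < Num.sqrt (3 * sc c) by exact: lt_le_trans h3.
have K0 := completeK_gt0 (ltW m0) m1.
have := completeK_ge (ltW m0) m1; rewrite onem_msq// E2 /period_map E1 => hK.
apply: (@le_trans _ _ (2 / Num.sqrt (major_sq c S) * completeK (msq c S))).
  rewrite ler_pM2l ?divr_gt0//; apply: le_trans hK.
  rewrite le_eqVlt; apply/orP; left; apply/eqP; congr (ln (1 + _)).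
  by field; rewrite !lt0r_neq0.
rewrite [leRHS](_ : _ = 2 / Num.sqrt (major_sq c S) * completeK (msq c S) * Num.sqrt (3 * sc c)); last first.
  by field; rewrite !lt0r_neq0.
by rewrite ler_peMr// mulr_ge0 ?divr_ge0 ?ltW.
Qed.

Lemma near_at_left (x : R) (P : R -> Prop) :
  (\forall y \near x, P y) -> \forall y \near x^'-, P y.
Proof. by apply: filterS => y Py _. Qed.

Lemma near_at_right (x : R) (P : R -> Prop) :
  (\forall y \near x, P y) -> \forall y \near x^'+, P y.
Proof. by apply: filterS => y Py _. Qed.

Lemma continuous_root_gap c : continuous (root_gap c).
Proof.
move=> S; suff : {for S, continuous (fun S => gap_sq c S)}.
  exact: continuous_sqrt_comp.
apply: continuousB; last first.
  by apply: continuousM; [exact: cvg_cst|exact: exprn_continuous].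
apply: continuousB; first exact: cvg_cst.
by apply: continuousM; [exact: cvg_cst|exact: cvg_id].
Qed.

Lemma continuous_sum_sq c : continuous (sum_sq c).
Proof.
move=> S; suff : {for S, continuous (fun S => sum_sq c S)} by [].
apply: continuousB; last exact: cvg_cst.
apply: continuousD; apply: continuousM; try exact: cvg_cst.
  exact: exprn_continuous.
exact: cvg_id.
Qed.

Lemma continuous_axes c :
  continuous (major_sq c) /\ continuous (minor_sq c).
Proof.
have h S : {for S, continuous (fun S => (S + 3 / 2) * root_gap c S)}.
  apply: continuousM; last exact: continuous_root_gap.
  by apply: continuousD; [exact: cvg_id|exact: cvg_cst].
split=> S.
  suff : {for S, continuous (fun S => major_sq c S)} by [].
  apply: continuousM; last exact: cvg_cst.
  by apply: continuousD => //; exact: continuous_sum_sq.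
suff : {for S, continuous (fun S => minor_sq c S)} by [].
apply: continuousM; last exact: cvg_cst.
by apply: continuousB => //; exact: continuous_sum_sq.
Qed.

Lemma period_map_lt_ex L c : 0 < L ->
  L ^+ 2 < Num.sqrt (sc c) * (L ^+ 2 - 4 * pi ^+ 2) ->
  exists2 S, admissible c S & period_map c S < L.
Proof.
move=> L0 hw; set w := Num.sqrt (sc c) in hw.
have p0 := @pi_gt0 R.
have w0 : 0 <= w by exact: sqrtr_ge0.
have w1 : 1 < w.
  have pp : 0 < 4 * pi ^+ 2 :> R by rewrite mulr_gt0// exprn_gt0.
  have LL : 0 < L ^+ 2 by rewrite exprn_gt0.
  by rewrite ltNge; apply/negP => h; nra.
have sw : sc c = w ^+ 2.
  rewrite sqr_sqrtr// ltW// -sqrtr_gt0; exact: lt_trans w1.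
have rw : rc c = (w ^+ 2 - 1) / 4 by rewrite -sw /rc /sc; field.
have gE S : gap_sq c S = 3 * (w - 1 - S) * (S + w + 1).
  by rewrite /gap_sq rw; field.
have g1 : root_gap c (w - 1) = 0 by rewrite /root_gap gE subrr mulr0 mul0r sqrtr0.
(* The gap closes at S = w - 1, and there X^2 = Y^2 = 3/4 w (w - 1). The inequality is the square of
   pi sqrt(3) w < L Y, and it is [hw] up to the factor 3/4 w. *)
have n1 : 3 * (pi ^+ 2 * w ^+ 2) < L ^+ 2 * minor_sq c (w - 1).
  rewrite /minor_sq g1 mulr0 subr0 rw.
  rewrite [ltRHS](_ : _ = 3 / 4 * w * (w - 1) * L ^+ 2); last by field.
  rewrite -subr_gt0 (_ : _ - _ = 3 / 4 * w * (w * (L ^+ 2 - 4 * pi ^+ 2) - L ^+ 2)); last by field.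
  by apply: mulr_gt0; [lra|rewrite subr_gt0].
have P1 : 0 < root_prod c (w - 1).
  rewrite /root_prod rw (_ : _ - _ = (w - 1) ^+ 2 / 4); last by field.
  by rewrite divr_gt0// exprn_gt0// subr_gt0.
have cP : {for w - 1, continuous (fun S => root_prod c S)}.
  apply: continuousB; last exact: cvg_cst.
  apply: continuousD; first exact: exprn_continuous.
  by apply: continuousM; [exact: cvg_cst|exact: cvg_id].
have cn : {for w - 1, continuous (fun S => L ^+ 2 * minor_sq c S)}.
  apply: continuousM; first exact: cvg_cst.
  exact: (continuous_axes c).2.
have nP : \forall S \near (w - 1)^'-, 0 < root_prod c S.
  exact: near_at_left (cvgr_gt _ cP _ P1).
have nn : \forall S \near (w - 1)^'-, 3 * (pi ^+ 2 * w ^+ 2) < L ^+ 2 * minor_sq c S.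
  exact: near_at_left (cvgr_gt _ cn _ n1).
(* At w - 1 itself the gap is 0, which is not admissible; the strict inequalities survive slightly
   to the left. *)
have [S [[S0 S1] [PS nS]]] : exists S, (0 < S /\ S < w - 1) /\ (0 < root_prod c S /\
    3 * (pi ^+ 2 * w ^+ 2) < L ^+ 2 * minor_sq c S).
  near ((w - 1)^'-) => S; exists S; split; split.
  - near: S; apply: nbhs_left_gt; lra.
  - by near: S; exact: nbhs_left_lt.
  - by near: S.
  - by near: S.
have adm : admissible c S.
  by split=> //; rewrite gE !mulr_gt0//; lra.
exists S => //; apply: le_lt_trans (period_map_le adm) _.
have m0 := minor_gt0 adm.
rewrite ltr_pdivrMr ?sqrtr_gt0//.
rewrite -(@ltr_pXn2r _ 2)// ?nnegrE ?mulr_ge0 ?sqrtr_ge0 ?(ltW L0) ?(ltW p0)//.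
rewrite !exprMn !sqr_sqrtr ?(ltW m0)//; last by rewrite sw mulr_ge0 ?sqr_ge0.
by rewrite sw; lra.
Unshelve. all: by end_near. Qed.

Lemma period_map_gt_ex L c : 0 < rc c ->
  exists2 S, admissible c S & L < period_map c S.
Proof.
(* [S0] is the positive root of [root_prod]: there alpha_3 = 0, Y = 0 and k = 1. *)
move=> r0; pose q := Num.sqrt (9 + 48 * rc c); pose S0 : R := (- 3 + q) / 4.
have qq : q ^+ 2 = 9 + 48 * rc c by rewrite sqr_sqrtr//; lra.
have q3 : 3 < q.
  by rewrite -(@ltr_pXn2r _ 2)// ?nnegrE ?sqrtr_ge0// qq; lra.
have S00 : 0 < S0 by rewrite /S0; lra.
have PE S : root_prod c S = (S - S0) * (S + S0 + 3 / 2).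
  rewrite /root_prod (_ : rc c = (q ^+ 2 - 9) / 48); last by rewrite qq; field.
  by rewrite /S0; field.
have gE S : gap_sq c S = S ^+ 2 - 4 * root_prod c S.
  by rewrite /gap_sq /root_prod; field.
have g0 : gap_sq c S0 = S0 ^+ 2 by rewrite gE PE subrr mul0r mulr0 subr0.
have d0 : root_gap c S0 = S0 by rewrite /root_gap g0 sqrtr_sqr gtr0_norm.
have rS : rc c = (S0 ^+ 2 + 3 / 2 * S0) / 3.
  by have := PE S0; rewrite subrr mul0r /root_prod => h; lra.
have M0 : 0 < major_sq c S0.
  rewrite /major_sq d0 rS [ltRHS](_ : _ = S0 ^+ 2 + 3 / 2 * S0); last by field.
  by have := exprn_gt0 2 S00; lra.
have n0 : minor_sq c S0 = 0 by rewrite /minor_sq d0 rS; field.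
have [cM cn] := continuous_axes c.
pose X0 := Num.sqrt (major_sq c S0).
have X00 : 0 < X0 by rewrite sqrtr_gt0.
have cX : {for S0, continuous (fun S => Num.sqrt (major_sq c S))}.
  by apply: continuous_sqrt_comp; exact: cM.
have cY : {for S0, continuous (fun S => Num.sqrt (minor_sq c S))}.
  by apply: continuous_sqrt_comp; exact: cn.
have cG : {for S0, continuous (fun S => gap_sq c S)}.
  apply: continuousB; last first.
    by apply: continuousM; [exact: cvg_cst|exact: exprn_continuous].
  apply: continuousB; first exact: cvg_cst.
  by apply: continuousM; [exact: cvg_cst|exact: cvg_id].
have G0 : 0 < gap_sq c S0 by rewrite g0 exprn_gt0.
(* If X > X0 / 2 and Y < e, then pi X / (2 Y) exceeds exp(l X0) with l = max(L, 1), so the period is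
   at least 2 l X0 / X; X < 2 X0 makes this larger than l. The maximum with 1 keeps l positive, as L
   has no assumed sign. *)
pose e := pi * X0 / (4 * expR (Num.max L 1 * X0)).
have e0 : 0 < e.
  by apply: divr_gt0; apply: mulr_gt0 => //; [exact: pi_gt0|exact: expR_gt0].
have eE : expR (Num.max L 1 * X0) = pi * X0 / (4 * e).
  rewrite /e; move: (expR_gt0 (Num.max L 1 * X0)) (@pi_gt0 R).
  set E := expR _; set p := pi; clearbody E p => E0 p0; field.
  by rewrite !lt0r_neq0.
clearbody e.
have Y0 : Num.sqrt (minor_sq c S0) < e by rewrite n0 sqrtr0.

have X0h : X0 / 2 < X0 by lra.
have X02 : X0 < 2 * X0 by lra.
have k1 : \forall S \near S0^'+, 0 < gap_sq c S.
  exact: near_at_right (cvgr_gt _ cG _ G0).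
have k2 : \forall S \near S0^'+, X0 / 2 < Num.sqrt (major_sq c S).
  exact: near_at_right (cvgr_gt _ cX _ X0h).
have k3 : \forall S \near S0^'+, Num.sqrt (major_sq c S) < 2 * X0.
  exact: near_at_right (cvgr_lt _ cX _ X02).
have k4 : \forall S \near S0^'+, Num.sqrt (minor_sq c S) < e.
  exact: near_at_right (cvgr_lt _ cY _ Y0).
have [S [S1 [GS [[X1 X2] Y1]]]] : exists S, S0 < S /\ (0 < gap_sq c S /\
    ((X0 / 2 < Num.sqrt (major_sq c S) /\ Num.sqrt (major_sq c S) < 2 * X0) /\
    Num.sqrt (minor_sq c S) < e)).
  near (S0^'+) => S; exists S; do !split.
  - by near: S; exact: nbhs_right_gt.
  - by near: S.
  - by near: S.
  - by near: S.
  - by near: S.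
have adm : admissible c S.
  by split; [lra| rewrite PE mulr_gt0//; lra|].
exists S => //; apply: lt_le_trans (period_map_ge adm).
move: X1 X2 Y1; have : 0 < Num.sqrt (minor_sq c S) by rewrite sqrtr_gt0 minor_gt0.
set X := Num.sqrt (major_sq c S); set Y := Num.sqrt (minor_sq c S).
move=> Y00 X1 X2 Y1.
have X10 : 0 < X by lra.
have h : Num.max L 1 * X0 <= ln (1 + pi * X / (2 * Y)).
  rewrite -[leLHS]expRK ler_ln ?posrE ?expR_gt0//; last first.
    by rewrite addr_gt0// divr_gt0 ?mulr_gt0 ?pi_gt0.
  rewrite (@le_trans _ _ (pi * X / (2 * Y)))// ?lerDr//.
  rewrite eE.
  rewrite ler_pdivlMr ?mulr_gt0// mulrAC ler_pdivrMr ?mulr_gt0//.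
  have := @pi_gt0 R; move: X1 Y1 Y00 e0 X00 X10; clear; move: e => e.
  move=> X1 Y1 Y0 e0 X0p Xp p0.
  have h1 : X0 * Y <= 2 * X * e by nra.
  rewrite (_ : pi * X0 * (2 * Y) = 2 * pi * (X0 * Y)); last by ring.
  rewrite (_ : pi * X * (4 * e) = 2 * pi * (2 * X * e)); last by ring.
  by rewrite ler_wpM2l// mulr_ge0// ltW.
have L1 : L <= Num.max L 1 by rewrite le_max lexx.
have L2 : 1 <= Num.max L 1 by rewrite le_max lexx orbT.
apply: (@lt_le_trans _ _ (2 / X * (Num.max L 1 * X0))); last first.
  by rewrite ler_wpM2l// divr_ge0// ltW.
apply: le_lt_trans L1 _; rewrite -subr_gt0.
move: L2; set l := Num.max L 1 => l1.
rewrite (_ : _ - _ = l * (2 * X0 - X) / X); last by field; rewrite lt0r_neq0.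
by rewrite divr_gt0// mulr_gt0//; lra.
Unshelve. all: by end_near. Qed.

Lemma period_map_surj L c : 0 < L ->
  L ^+ 2 < Num.sqrt (sc c) * (L ^+ 2 - 4 * pi ^+ 2) ->
  exists2 S, admissible c S & period_map c S = L.
Proof.
move=> L0 hw; have [S2 adm2 h2] := period_map_lt_ex L0 hw.
have [S1 adm1 h1] := period_map_gt_ex L (adm_rc_gt0 adm2).
have S12 : S1 <= S2.
  rewrite leNgt; apply/negP => h; have := period_map_decr adm2 adm1 h; lra.
have adm x : S1 <= x <= S2 -> admissible c x by exact: admissible_convex.
have [||S] := @IVT R (period_map c) S1 S2 L S12.
- apply/continuous_in_subspaceT => x; rewrite inE /= in_itv /= => hx.
  exact/continuous_period_map/adm.
- have h := lt_trans h2 h1; rewrite min_r ?max_l ?ltW//.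
- by rewrite in_itv /= => /adm ? ?; exists S.
Qed.

End PeriodMap.

(** * Amplitude and wave profile *)

Section Amplitude.
Context {R : realType}.
Implicit Types (m u x c S : R).

Lemma ell_delta_le1 m x : 0 <= m -> ell_delta m x <= 1.
Proof.
move=> m0; rewrite -[leRHS]sqrtr1 ler_wsqrtr//.
by rewrite gerBl mulr_ge0// sqr_ge0.
Qed.

(** For m >= 0 the integrand is at least 1. Expansion of distances yields injectivity, surjectivity
    and an inverse that is 1-Lipschitz uniformly in m. *)
Lemma ell0_expanding m x y : 0 <= m -> m < 1 -> x <= y ->
  y - x <= ell 0 m y - ell 0 m x.
Proof.
move=> m0 m1 xy.
have [|z hz ->] := @MVT_gen R (ell 0 m) (ell_integrand 0 m) x y.
  by move=> z _; exact: is_derive_ell.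
rewrite -[leLHS]mul1r ler_wpM2r ?subr_ge0// ell_integrand0.
by rewrite invf_ge1 ?ell_delta_gt0// ell_delta_le1.
Qed.

Lemma ell0_dist m x y : 0 <= m -> m < 1 ->
  `|x - y| <= `|ell 0 m x - ell 0 m y|.
Proof.
move=> m0 m1; wlog yx : x y / y <= x => [hw|].
  have /orP[yx|xy] := le_total y x; first exact: hw.
  by rewrite distrC [leRHS]distrC; exact: hw.
have h := ell0_expanding m0 m1 yx.
by rewrite !ger0_norm ?subr_ge0//; have := yx; lra.
Qed.

Lemma ell0_inj m : 0 <= m -> m < 1 -> injective (ell 0 m).
Proof.
move=> m0 m1 x y e; apply/eqP; rewrite -subr_eq0 -normr_le0.
by rewrite (le_trans (ell0_dist x y m0 m1))// e subrr normr0.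
Qed.

Lemma ell0_homo m x y : 0 <= m -> m < 1 -> x <= y -> ell 0 m x <= ell 0 m y.
Proof. by move=> m0 m1 xy; have := ell0_expanding m0 m1 xy; lra. Qed.

Lemma ell0_surj m u : 0 <= m -> m < 1 -> exists x, ell 0 m x = u.
Proof.
move=> m0 m1; have e0 : ell 0 m 0 = 0 by exact: ell0.
have h1 : u <= ell 0 m `|u|.
  have := ell0_expanding m0 m1 (normr_ge0 u); rewrite e0 !subr0.
  by apply: le_trans; exact: ler_norm.
have h2 : ell 0 m (- `|u|) <= u.
  have n0 : - `|u| <= 0 by rewrite oppr_le0.
  have := ell0_expanding m0 m1 n0; rewrite e0 !sub0r opprK lerNr => h.
  by apply: le_trans h _; rewrite lerNl -normrN ler_norm.
have nn : - `|u| <= `|u| by rewrite ge0_cp.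
have [||x _ hx] := @IVT R (ell 0 m) (- `|u|) `|u| u nn.
- apply/continuous_subspaceT => x.
  exact: is_derive_continuous (is_derive_ell 0 x m1).
- by rewrite ge_min h2 /= le_max h1 orbT.
- by exists x.
Qed.

Definition am m u : R := xget 0 [set x | ell 0 m x = u].

Lemma amK m u : 0 <= m -> m < 1 -> ell 0 m (am m u) = u.
Proof.
move=> m0 m1; have [x hx] := ell0_surj u m0 m1.
exact: (xgetPex 0 (ex_intro [set x | ell 0 m x = u] x hx)).
Qed.

Lemma am_ell m x : 0 <= m -> m < 1 -> am m (ell 0 m x) = x.
Proof. by move=> m0 m1; apply: (ell0_inj m0 m1); rewrite amK. Qed.

Lemma jacobi_amE u k : jacobi_am u k = am (k ^+ 2) u.
Proof.
by rewrite /jacobi_am /am; congr (xget _ _); apply/funext => x /=;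
  rewrite ellipticFE.
Qed.

Lemma ell0N m x : m < 1 -> ell 0 m (- x) = - ell 0 m x.
Proof.
move=> m1; apply/eqP; rewrite -subr_eq0 opprK; apply/eqP.
have h (y : R) : is_derive y 1 (fun y => ell 0 m (- y) + ell 0 m y) 0.
  have hn := is_derive_comp (g := fun y => - y) (is_derive_ell 0 (- y) m1)
    (is_derive_opp (is_derive_id y 1)).
  apply: is_derive_eq (is_derive_add hn (is_derive_ell 0 y m1)) _.
  by rewrite !ell_integrand0 /ell_delta sinN sqrrN mulrN1 addNr.
rewrite (is_derive_0_is_cst x 0 h) oppr0 ell0 addr0//.
Qed.

(** The integrand has period pi, so the increment over pi is constant; at -pi/2 oddness makes it 2
    K. *)
Lemma ell0Dpi m x : m < 1 -> ell 0 m (x + pi) = ell 0 m x + 2 * completeK m.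
Proof.
move=> m1.
have h (y : R) : is_derive y 1 (fun y => ell 0 m (y + pi) - ell 0 m y) 0.
  have hn := is_derive_comp (g := fun y => y + pi) (is_derive_ell 0 (y + pi) m1)
    (is_derive_add (is_derive_id y 1) (is_derive_const pi y)).
  apply: is_derive_eq (is_derive_sub hn (is_derive_ell 0 y m1)) _.
  by rewrite !ell_integrand0 /ell_delta sinDpi sqrrN addr0 mulr1 subrr.
have := is_derive_0_is_cst x (- (pi / 2)) h.
have -> : - (pi / 2) + pi = pi / 2 :> R by field.
rewrite ell0N// opprK -/(completeK m) => /eqP; rewrite subr_eq => /eqP ->.
ring.
Qed.

Lemma amD m u : 0 <= m -> m < 1 -> am m (u + 2 * completeK m) = am m u + pi.
Proof.
move=> m0 m1; rewrite -{1}[u](amK u m0 m1) -ell0Dpi// am_ell//.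
Qed.

Lemma am0 m : 0 <= m -> m < 1 -> am m 0 = 0.
Proof. by move=> m0 m1; rewrite -[X in am _ X](ell0 0 m) am_ell. Qed.

(** The amplitude at q differs from the fixed amplitude at p by at most the distance between g q and
    the value of [ell 0 (f q)] at that fixed amplitude, which tends to 0. Expansion requires 0 <= f
    q, hence the hypothesis near p. *)
Lemma continuous_am (T : topologicalType) (p : T) (f g : T -> R) :
  0 <= f p -> f p < 1 -> (\forall q \near p, 0 <= f q) ->
  {for p, continuous f} -> {for p, continuous g} ->
  {for p, continuous (fun q => am (f q) (g q))}.
Proof.
move=> f0 f1 nf0 cf cg.
have ce : {for p, continuous (fun q => g q - ell 0 (f q) (am (f p) (g p)))}.
  apply: continuousB => //; apply: continuous_ell => //; exact: cvg_cst.
have nf1 : \forall q \near p, f q < 1 by exact: (cvgr_lt _ cf _ f1).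
apply/cvgrPdist_lt => e e0.
have /cvgrPdist_lt/(_ e e0) := ce; rewrite amK// subrr => he.
near=> q.
have q0 : 0 <= f q by near: q.
have q1 : f q < 1 by near: q.
apply: le_lt_trans (ell0_dist _ _ q0 q1) _.
rewrite amK//.
have : `|0 - (g q - ell 0 (f q) (am (f p) (g p)))| < e by near: q.
by rewrite sub0r opprB.
Unshelve. all: by end_near. Qed.

Lemma is_derive_am m g x : 0 <= m -> m < 1 ->
  is_derive x 1 (fun x => am m (g * x)) (g * ell_delta m (am m (g * x))).
Proof.
move=> m0 m1.
have d0 := lt0r_neq0 (ell_delta_gt0 (am m (g * x)) m1).
apply: is_derive_eq.
  apply: (@is_derive_implicit _ (fun x t => ell 0 m t - g * x)
    (fun x t => ell_integrand 0 m t) (fun x => am m (g * x)) x (- g) 0).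
  - apply: is_derive_eq (is_derive_sub (is_derive_const _ x)
      (is_derive_mul (is_derive_const g x) (is_derive_id x 1))) _.
    by rewrite mul0r !add0r mulr1.
  - near=> y z.
    apply: is_derive_eq (is_derive_sub (is_derive_ell 0 _ m1) (is_derive_const _ _)) _.
    by rewrite subr0.
  - have c2 : {for (x, am m (g * x)), continuous (fun q : R * R => q.2)}.
      exact: cvg_snd.
    have c1 : {for (x, am m (g * x)), continuous (fun q : R * R => m)}.
      exact: cvg_cst.
    exact: continuous_ell_integrand m1 c1 c2.
  - by rewrite ell_integrand0 invr_eq0.
  - apply: (@continuous_am _ x (fun=> m) (fun x => g * x)) => //.
    + by near=> y.
    + exact: cvg_cst.
    by apply: continuousM; [exact: cvg_cst|exact: cvg_id].
  - by near=> y; rewrite amK// subrr.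
by rewrite opprK ell_integrand0 invrK.
Unshelve. all: by end_near. Qed.

End Amplitude.

(** * The wave profile: its minimal period and its equation *)

Section WaveShape.
Context {R : realType}.
Implicit Types (c S x t L : R).

Definition wave_speed c S : R := Num.sqrt (major_sq c S / (3 * sc c)).
Definition amplitude c S x : R := am (msq c S) (wave_speed c S * x).
Definition flatness c S : R := alpha4_of c S * msq c S / (3 / 2 + S).
Definition wave_den c S t : R := Num.sqrt (1 + flatness c S * sin t ^+ 2).
Definition wave_shape c S t : R :=
  Num.sqrt (alpha4_of c S) * ell_delta (msq c S) t / wave_den c S t.

Lemma dnoidal_shape c S x : admissible c S ->
  dnoidal (alpha4_of c S) c x = wave_shape c S (amplitude c S x).
Proof.
move=> adm; rewrite /dnoidal /jacobi_dn /jacobi_sn !jacobi_amE adm_modulus_sqr//.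
rewrite adm_modulus_sq// adm_gamma// adm_alpha1//.
by rewrite /wave_shape /wave_den /flatness opprD !opprK.
Qed.

Section Admissible.
Variables (c S : R).
Hypothesis adm : admissible c S.

Let m0 : 0 <= msq c S. Proof. exact: ltW (msq_gt0 adm). Qed.
Let m1 : msq c S < 1. Proof. exact: msq_lt1 adm. Qed.

Lemma flatness_gt0 : 0 < flatness c S.
Proof.
apply: divr_gt0; first by rewrite mulr_gt0 ?alpha4_of_gt0 ?msq_gt0.
by have := adm_gt0 adm; lra.
Qed.

Lemma wave_den_gt0 t : 0 < wave_den c S t.
Proof.
by rewrite sqrtr_gt0 ltr_wpDr// mulr_ge0 ?sqr_ge0// ltW// flatness_gt0.
Qed.

Lemma wave_den_sqr t : wave_den c S t ^+ 2 = 1 + flatness c S * sin t ^+ 2.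
Proof.
by rewrite sqr_sqrtr// addr_ge0// mulr_ge0 ?sqr_ge0// ltW// flatness_gt0.
Qed.

Lemma wave_speed_gt0 : 0 < wave_speed c S.
Proof.
rewrite sqrtr_gt0 divr_gt0 ?major_gt0// mulr_gt0//.
exact: lt_trans (adm_sc_gt1 adm).
Qed.

Lemma amplitudeDperiod x :
  amplitude c S (x + period_map c S) = amplitude c S x + pi.
Proof.
rewrite /amplitude -amD// mulrDr; congr (am _ (_ + _)).
rewrite /period_map -/(wave_speed c S) mulrC divfK// lt0r_neq0//.
exact: wave_speed_gt0.
Qed.

Lemma wave_shapeDpi t : wave_shape c S (t + pi) = wave_shape c S t.
Proof. by rewrite /wave_shape /wave_den /ell_delta sinDpi sqrrN. Qed.

Lemma periodic_wave : periodic (fun x => wave_shape c S (amplitude c S x)) (period_map c S).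
Proof. by move=> x; rewrite amplitudeDperiod wave_shapeDpi. Qed.

(** In y = sin^2 t the squared numerator decreases and the squared denominator increases, so the
    value at 0 is a maximum attained only where y = 0. *)
Lemma wave_shape_max t : wave_shape c S t = wave_shape c S 0 -> sin t = 0.
Proof.
move=> /(congr1 (fun z => z ^+ 2)); rewrite /wave_shape !exprMn !exprVn.
rewrite !wave_den_sqr !ell_delta_sqr// sin0 expr0n !mulr0 subr0 addr0 invr1 !mulr1.
rewrite sqr_sqrtr ?(ltW (alpha4_of_gt0 adm))// => e.
have a0 := alpha4_of_gt0 adm; have n0 := flatness_gt0.
have y0 := sqr_ge0 (sin t); set y := sin t ^+ 2 in e y0.
have d0 : 0 < 1 + flatness c S * y by rewrite ltr_wpDr// mulr_ge0// ltW.
have {}e : 1 - msq c S * y = 1 + flatness c S * y.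
  move: e; rewrite -mulrA => /(canRL (mulKf (lt0r_neq0 a0))); rewrite mulVf ?lt0r_neq0//.
  by move=> /(canRL (divfK (lt0r_neq0 d0))); rewrite mul1r.
have : (msq c S + flatness c S) * y = 0 by rewrite mulrDl; lra.
move/eqP; rewrite mulf_eq0 gt_eqF ?addr_gt0 ?msq_gt0//= /y sqrf_eq0.
by move/eqP.
Qed.

(** A period p carries the maximum at 0 to another maximum, where the sine of the amplitude
    vanishes; being positive, that amplitude is at least pi, which is reached only after a full
    [period_map]. *)
Lemma wave_period_min p : 0 < p ->
  periodic (fun x => wave_shape c S (amplitude c S x)) p -> period_map c S <= p.
Proof.
move=> p0 /(_ 0) /=; rewrite add0r {2}/amplitude mulr0 am0// => /wave_shape_max s0.
have g0 := wave_speed_gt0.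
have tE : ell 0 (msq c S) (amplitude c S p) = wave_speed c S * p by exact: amK.
have t0 : 0 < amplitude c S p.
  rewrite ltNge; apply/negP => /(ell0_homo m0 m1); rewrite tE ell0.
  by rewrite leNgt mulr_gt0.
have tpi : pi <= amplitude c S p.
  rewrite leNgt; apply/negP => h.
  by have := @sin_gt0_pi _ (amplitude c S p); rewrite t0 h s0 ltxx => /(_ isT).
have := ell0_homo m0 m1 tpi; rewrite tE -[pi]add0r ell0Dpi// ell0 add0r => h.
by rewrite /period_map ler_pdivrMr// [p * _]mulrC.
Qed.

Lemma period_map_gt0 : 0 < period_map c S.
Proof.
by rewrite divr_gt0 ?wave_speed_gt0// mulr_gt0// completeK_gt0.
Qed.

Definition wave_slope t : R :=
  - (Num.sqrt (alpha4_of c S) * wave_speed c S * (msq c S + flatness c S)) *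
  (sin t * cos t * (wave_den c S t)^-1 ^+ 3).

Lemma is_derive_wave_den (v : R -> R) x dv : is_derive x 1 v dv ->
  is_derive x 1 (fun y => wave_den c S (v y))
    (flatness c S * sin (v x) * cos (v x) * dv / wave_den c S (v x)).
Proof.
move=> hv; have p0 : 0 < 1 + flatness c S * sin (v x) ^+ 2.
  by rewrite -wave_den_sqr exprn_gt0// wave_den_gt0.
have h := is_derive_add (is_derive_const 1 x) (is_derive_mul (is_derive_const (flatness c S) x)
   (is_derive_pow 2 (is_derive_comp (is_derive_sin (v x)) hv))).
apply: is_derive_eq.
  by apply: (@is_derive_sqrt _ (fun y => 1 + flatness c S * sin (v y) ^+ 2) _ _ p0 h).
have := wave_den_gt0 (v x); rewrite -/(wave_den c S (v x)) => d0.
by rewrite /= expr1; field; rewrite lt0r_neq0.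
Qed.

Lemma is_derive_amplitude x :
  is_derive x 1 (amplitude c S) (wave_speed c S * ell_delta (msq c S) (amplitude c S x)).
Proof. exact: is_derive_am. Qed.

Lemma is_derive_wave x :
  is_derive x 1 (fun x => wave_shape c S (amplitude c S x)) (wave_slope (amplitude c S x)).
Proof.
have hA := is_derive_amplitude x.
have hD := is_derive_ell_delta (u := fun=> msq c S) m1 (is_derive_const _ x) hA.
have hN := is_derive_wave_den hA.
have N0 := wave_den_gt0 (amplitude c S x).
have D0 := ell_delta_gt0 (amplitude c S x) m1.
have hI := @is_derive_inv _ (fun y => wave_den c S (amplitude c S y)) x _
  (lt0r_neq0 N0) hN.
apply: is_derive_eq (is_derive_mul (is_derive_mul
  (is_derive_const (Num.sqrt (alpha4_of c S)) x) hD) hI) _.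
have e1 := wave_den_sqr (amplitude c S x).
have e2 := ell_delta_sqr (amplitude c S x) m1.
rewrite /wave_slope; move: N0 D0 e1 e2; set N := wave_den _ _ _; set D := ell_delta _ _.
set s := sin _; set k := cos _; set g := wave_speed _ _; set n := flatness _ _.
set m := msq _ _; set a := Num.sqrt _ => N0 D0 e1 e2.
(* In m N^2 + n D^2 the terms in s^2 cancel and m + n remains. *)
transitivity (- (a * g) * (s * k * (m * N ^+ 2 + n * D ^+ 2)) * N^-1 ^+ 3).
  by field; rewrite !lt0r_neq0.
by rewrite e1 e2; ring.
Qed.

Definition wave_curv t : R :=
  - (Num.sqrt (alpha4_of c S) * wave_speed c S ^+ 2 * (msq c S + flatness c S)) *
  (ell_delta (msq c S) t * (wave_den c S t)^-1 ^+ 5) *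
  ((1 - 2 * sin t ^+ 2) * (1 + flatness c S * sin t ^+ 2)
    - 3 * flatness c S * sin t ^+ 2 * (1 - sin t ^+ 2)).

Lemma is_derive_wave_slope x :
  is_derive x 1 (fun x => wave_slope (amplitude c S x)) (wave_curv (amplitude c S x)).
Proof.
have hA := is_derive_amplitude x.
have hN := is_derive_wave_den hA.
have N0 := wave_den_gt0 (amplitude c S x).
have hI := @is_derive_inv _ (fun y => wave_den c S (amplitude c S y)) x _
  (lt0r_neq0 N0) hN.
apply: is_derive_eq (is_derive_mul (is_derive_const (- (Num.sqrt (alpha4_of c S)
  * wave_speed c S * (msq c S + flatness c S))) x) (is_derive_mul
  (is_derive_mul (is_derive_comp (is_derive_sin _) hA) (is_derive_comp (is_derive_cos _) hA))
  (is_derive_pow 3 hI))) _.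
have e1 := wave_den_sqr (amplitude c S x).
have e3 := cos2sin2 (amplitude c S x).
rewrite mul0r add0r /wave_curv -e1 /=; move: N0 e1 e3; set N := wave_den _ _ _; set D := ell_delta _ _.
set s := sin _; set k := cos _; set g := wave_speed _ _; set n := flatness _ _.
set m := msq _ _; set a := Num.sqrt _ => N0 e1 e3.
transitivity (- (a * g ^+ 2 * (m + n)) * (D * N^-1 ^+ 5) *
   ((k ^+ 2 - s ^+ 2) * N ^+ 2 - 3 * n * s ^+ 2 * k ^+ 2)).
  by field; rewrite !lt0r_neq0.
by rewrite e3; ring.
Qed.

(** Each term is the profile times a function of even powers of w, D and N, that is, of sin^2 t and
    the roots; the equation becomes a rational identity once this common factor is exposed. *)
Lemma wave_equation t : - wave_curv t + rc c / sc c * wave_shape c S t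
  - (sc c)^-1 * (wave_shape c S t ^+ 3 + wave_shape c S t ^+ 5) = 0.
Proof.
have N0 := wave_den_gt0 t; have e1 := wave_den_sqr t.
have e2 := ell_delta_sqr t m1.
have s0 : 0 < sc c := lt_trans ltr01 (adm_sc_gt1 adm).
have g2 : wave_speed c S ^+ 2 = major_sq c S / (3 * sc c).
  rewrite sqr_sqrtr// ltW//; apply: divr_gt0; first exact: major_gt0.
  by rewrite mulr_gt0.
have a2 : Num.sqrt (alpha4_of c S) ^+ 2 = alpha4_of c S.
  by rewrite sqr_sqrtr// ltW// alpha4_of_gt0.
(* In terms of a = alpha_4 and b = alpha_3 all coefficients, including r, are rational and no gap
   remains. *)
pose b := (S - root_gap c S) / 2.
pose a := alpha4_of c S.
have a0 : 0 < a by exact: alpha4_of_gt0.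
have b0 : 0 < b by have := root_gap_lt adm; rewrite /b; lra.
have SE : S = a + b by rewrite /a /b /alpha4_of; field.
have dE : root_gap c S = a - b by rewrite /a /b /alpha4_of; field.
have ME : major_sq c S = a * (b + 3 / 2 + a + b).
  by rewrite majorE// -/a -/b; congr (_ * _); move: SE; clearbody a b; lra.
have mE : msq c S = (a + b + 3 / 2) * (a - b) / (a * (b + 3 / 2 + a + b)).
  by rewrite /msq ME dE {1}SE.
have nE : flatness c S = (a - b) / (b + 3 / 2 + a + b).
  rewrite /flatness mE -/a SE; field; rewrite !lt0r_neq0//; lra.
have rE : rc c = ((a + b) * (3 / 2 + a + b) - a * b) / 3.
  have := root_gap_sqr adm; rewrite dE /gap_sq SE => h.
  have -> : rc c = ((a - b) ^+ 2 + 6 * (a + b) + 3 * (a + b) ^+ 2) / 12 by lra.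
  by field.
rewrite /wave_curv /wave_shape -/a g2 ME -/a in a2 *.
move: N0 e1 e2 a2; set N := wave_den _ _ _; set D := ell_delta _ _.
set y := sin t ^+ 2; set w := Num.sqrt a.
move=> N0 e1 e2 a2.
have -> : (w * D / N) ^+ 3 = w * D / N * (w ^+ 2 * D ^+ 2 / N ^+ 2).
  by field; rewrite lt0r_neq0.
have -> : (w * D / N) ^+ 5 = w * D / N * (w ^+ 2 * D ^+ 2 / N ^+ 2) ^+ 2.
  by field; rewrite lt0r_neq0.
have -> : D * N^-1 ^+ 5 = D / N * (N ^+ 2)^-1 ^+ 2.
  by field; rewrite lt0r_neq0.
have n2 : N ^+ 2 != 0 by rewrite lt0r_neq0// exprn_gt0.
move: n2; rewrite a2 e1 e2 rE mE nE => n2.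
have y0 : 0 <= y by exact: sqr_ge0.
have ab : 0 <= (a - b) * y by rewrite mulr_ge0// -dE ltW// root_gap_gt0.
clearbody w N D y a b.
have s1 := lt0r_neq0 s0; have a1 := lt0r_neq0 a0; have N1 := lt0r_neq0 N0.
move: (sc c) s1 => s s1.
field.
rewrite s1 N1 a1 /=; apply/and3P; split=> //; rewrite lt0r_neq0//; lra.
Qed.

End Admissible.

Lemma dnoidal_funE c S : admissible c S ->
  dnoidal (alpha4_of c S) c = fun x => wave_shape c S (amplitude c S x).
Proof. by move=> adm; apply/funext => x; exact: dnoidal_shape. Qed.

Lemma dnoidal_fundamental_period c S : admissible c S ->
  fundamental_period (dnoidal (alpha4_of c S) c) (period_map c S).
Proof.
move=> adm; rewrite dnoidal_funE//; split.
- exact: period_map_gt0.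
- exact: periodic_wave.
- by move=> p p0 hp; exact: wave_period_min hp.
Qed.

Lemma dnoidal_solves c S : admissible c S ->
  solves_profile_equation c (dnoidal (alpha4_of c S) c).
Proof.
move=> adm x; rewrite dnoidal_funE//.
have h1 y := is_derive_wave adm y.
have e1 : derive1 (fun x => wave_shape c S (amplitude c S x)) =
   fun x => wave_slope c S (amplitude c S x).
  by apply/funext => y; rewrite derive1E; have [_ ->] := h1 y.
have h2 y := is_derive_wave_slope adm y.
split.
- by have [] := h1 x.
- by rewrite e1; have [] := h2 x.
- rewrite derive1nS derive1n1 e1 derive1E.
  have [_ ->] := h2 x; exact: wave_equation.
Qed.

End WaveShape.

(** * Differentiation along the branch *)

Section WaveExpressions.
Context {R : realType}.
Implicit Types (c S t x L : R) (v : nat -> R) (e : @expr R).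

(* Variable 0 is the speed c, variable 1 is S, every other one is the angle. *)
Definition triple (T : Type) (a b d : T) (i : nat) : T :=
  match i with 0%N => a | 1%N => b | _ => d end.

Definition wave_dom : set (nat -> R) := [set v | admissible (v 0%N) (v 1%N)].

Let C (a : R) := Const a.
Let Vc := @Var R 0.
Let VS := @Var R 1.
Let Vt := @Var R 2.

Definition ERc := Add (C 1) (Opp (Mul Vc Vc)).
Definition ESc := Add (C 5) (Opp (Mul (C 4) (Mul Vc Vc))).
Definition EGapSq := Add (Mul (C 12) ERc)
  (Opp (Add (Mul (C 6) VS) (Mul (C 3) (Mul VS VS)))).
Definition EGap := Sqrt EGapSq.
Definition EAlpha := Mul (Add VS EGap) (C 2^-1).
Definition EArm := Mul (Add VS (C (3 / 2))) EGap.
Definition EMajor := Mul (Add (Add (Mul (C 3) (Mul VS VS))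
  (Add (Mul (C (9 / 2)) VS) (Opp (Mul (C 6) ERc)))) EArm) (C 2^-1).
Definition EMsq := Mul EArm (Inv EMajor).
Definition EFlat := Mul (Mul EAlpha EMsq) (Inv (Add (C (3 / 2)) VS)).
Definition ESpeed := Sqrt (Mul EMajor (Inv (Mul (C 3) ESc))).
Definition EPeriod := Mul (Mul (C 2) (Ell 0 EMsq (C (pi / 2)))) (Inv ESpeed).
(** The position x at which the angle takes a given value. The amplitude is the solution of [EPhase]
    = x and is differentiated implicitly from it. *)
Definition EPhase := Mul (Ell 0 EMsq Vt) (Inv ESpeed).
Definition EDelta := Sqrt (EllRadicand EMsq Vt).
Definition EShape := Mul (Mul (Sqrt EAlpha) EDelta)
  (Inv (Sqrt (Add (C 1) (Mul EFlat (Mul (Sin Vt) (Sin Vt)))))).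

Section Values.
Variable v : nat -> R.
Local Notation c := (v 0%N).
Local Notation S := (v 1%N).
Local Notation t := (v 2%N).

Lemma eval_ERc : eval v ERc = rc c.
Proof. by rewrite /= /rc expr2 mulN1r. Qed.

Lemma eval_ESc : eval v ESc = sc c.
Proof. by rewrite /= /sc expr2 mulN1r. Qed.

Lemma eval_EGapSq : eval v EGapSq = gap_sq c S.
Proof.
rewrite -[LHS]/(12 * eval v ERc + -1 * (6 * S + 3 * (S * S))).
by rewrite eval_ERc /gap_sq; ring.
Qed.

Lemma eval_EGap : eval v EGap = root_gap c S.
Proof. by rewrite -[LHS]/(Num.sqrt (eval v EGapSq)) eval_EGapSq. Qed.

Lemma eval_EAlpha : eval v EAlpha = alpha4_of c S.
Proof. by rewrite -[LHS]/((S + eval v EGap) / 2) eval_EGap. Qed.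

Lemma eval_EArm : eval v EArm = (S + 3 / 2) * root_gap c S.
Proof. by rewrite -[LHS]/((S + 3 / 2) * eval v EGap) eval_EGap. Qed.

Lemma eval_EMajor : eval v EMajor = major_sq c S.
Proof.
rewrite -[LHS]/((3 * (S * S) + (9 / 2 * S + -1 * (6 * eval v ERc)) + eval v EArm) / 2).
by rewrite eval_ERc eval_EArm /major_sq; congr (_ / _); ring.
Qed.

Lemma eval_EMsq : eval v EMsq = msq c S.
Proof. by rewrite -[LHS]/(eval v EArm / eval v EMajor) eval_EArm eval_EMajor. Qed.

Lemma eval_EFlat : eval v EFlat = flatness c S.
Proof.
by rewrite -[LHS]/(eval v EAlpha * eval v EMsq / (3 / 2 + S)) eval_EAlpha eval_EMsq.
Qed.

Lemma eval_ESpeed : eval v ESpeed = wave_speed c S.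
Proof.
rewrite -[LHS]/(Num.sqrt (eval v EMajor / (3 * eval v ESc))).
by rewrite eval_EMajor eval_ESc.
Qed.

Lemma eval_EPeriod : eval v EPeriod = period_map c S.
Proof.
rewrite -[LHS]/(2 * ell 0 (eval v EMsq) (pi / 2) / eval v ESpeed).
by rewrite eval_EMsq eval_ESpeed.
Qed.

Lemma eval_EPhase : eval v EPhase = ell 0 (msq c S) t / wave_speed c S.
Proof.
by rewrite -[LHS]/(ell 0 (eval v EMsq) t / eval v ESpeed) eval_EMsq eval_ESpeed.
Qed.

Lemma eval_EDelta : eval v EDelta = ell_delta (msq c S) t.
Proof.
by rewrite -[LHS]/(Num.sqrt (eval v (EllRadicand EMsq Vt))) eval_EllRadicand eval_EMsq.
Qed.

Lemma eval_EShape : eval v EShape = wave_shape c S t.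
Proof.
rewrite -[LHS]/(Num.sqrt (eval v EAlpha) * eval v EDelta /
  Num.sqrt (1 + eval v EFlat * (sin t * sin t))).
by rewrite eval_EAlpha eval_EDelta eval_EFlat -expr2.
Qed.

End Values.

Lemma ok_EGap : ok wave_dom EGap.
Proof.
by split=> [|v [_ _ h]]; [|rewrite eval_EGapSq].
Qed.

Lemma ok_EMajor : ok wave_dom EMajor.
Proof. by do !split=> //; have [] := ok_EGap. Qed.

Lemma ok_EMsq : ok wave_dom EMsq.
Proof.
split; first by split=> //; exact: ok_EGap.
split=> [|v adm]; first exact: ok_EMajor.
by rewrite eval_EMajor lt0r_neq0// major_gt0.
Qed.

Lemma ok_EAlpha : ok wave_dom EAlpha.
Proof. by split=> //; split=> //; exact: ok_EGap. Qed.

Lemma ok_EFlat : ok wave_dom EFlat.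
Proof.
split; first by split; [exact: ok_EAlpha|exact: ok_EMsq].
split=> //= v [S0 _ _]; rewrite lt0r_neq0//; lra.
Qed.

Lemma ok_ESpeed : ok wave_dom ESpeed.
Proof.
have s0 v : wave_dom v -> 0 < 3 * sc (v 0%N).
  by move=> adm; rewrite mulr_gt0// (lt_trans ltr01 (adm_sc_gt1 adm)).
split.
  split; first exact: ok_EMajor.
  split=> // v /s0; rewrite -eval_ESc => h.
  by rewrite -[X in X != 0]/(3 * eval v ESc) lt0r_neq0.
move=> v adm; rewrite -[ltRHS]/(eval v EMajor / (3 * eval v ESc)).
by rewrite eval_EMajor eval_ESc divr_gt0 ?major_gt0 ?s0.
Qed.

Lemma ok_EPeriod : ok wave_dom EPeriod.
Proof.
split.
  split=> //; split=> //; first exact: ok_EMsq.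
  by move=> v adm; rewrite eval_EMsq; exact: msq_lt1.
split; first exact: ok_ESpeed.
by move=> v adm; rewrite eval_ESpeed lt0r_neq0//; exact: wave_speed_gt0.
Qed.

Lemma ok_EPhase : ok wave_dom EPhase.
Proof.
split.
  split=> //; first exact: ok_EMsq.
  by move=> v adm; rewrite eval_EMsq; exact: msq_lt1.
split; first exact: ok_ESpeed.
by move=> v adm; rewrite eval_ESpeed lt0r_neq0//; exact: wave_speed_gt0.
Qed.

Lemma ok_EDelta : ok wave_dom EDelta.
Proof.
split; first by split=> //; split=> //; split=> //; exact: ok_EMsq.
move=> v adm; rewrite eval_EllRadicand ell_radicand_gt0// eval_EMsq.
exact: msq_lt1.
Qed.

Lemma ok_EShape : ok wave_dom EShape.
Proof.
have pos v : wave_dom v -> 0 < 1 + eval v EFlat * (sin (v 2%N) * sin (v 2%N)).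
  move=> adm; rewrite eval_EFlat ltr_wpDr//; apply: mulr_ge0.
    exact/ltW/flatness_gt0.
  by rewrite -expr2 sqr_ge0.
split.
  split; last exact: ok_EDelta.
  split; first exact: ok_EAlpha.
  by move=> v adm; rewrite eval_EAlpha alpha4_of_gt0.
split; last by move=> v /pos h; rewrite /= lt0r_neq0// sqrtr_gt0.
split; last exact: pos.
by split=> //; split=> //; exact: ok_EFlat.
Qed.

Lemma ok_Mul D (a b : @expr R) : ok D a -> ok D b -> ok D (Mul a b).
Proof. by []. Qed.

Lemma ok_Opp D (a : @expr R) : ok D a -> ok D (Opp a).
Proof. by []. Qed.

Lemma ok_Inv D (a : @expr R) : ok D a -> (forall v, D v -> eval v a != 0) -> ok D (Inv a).
Proof. by []. Qed.

Lemma eval_Mul v (a b : @expr R) : eval v (Mul a b) = eval v a * eval v b.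
Proof. by []. Qed.

Lemma eval_Opp v (a : @expr R) : eval v (Opp a) = - eval v a.
Proof. by rewrite /= mulN1r. Qed.

Lemma eval_Inv v (a : @expr R) : eval v (Inv a) = (eval v a)^-1.
Proof. by []. Qed.

#[local] Arguments eval : simpl never.
#[local] Arguments der : simpl never.
Opaque EMsq ESpeed EDelta EPeriod EPhase EShape.

Lemma is_derive_triple (w : nat -> R) (f g h : R -> R) (a b d : @expr R) (t : R) :
  is_derive t 1 f (eval w a) -> is_derive t 1 g (eval w b) ->
  is_derive t 1 h (eval w d) ->
  forall i, is_derive t 1 (fun s => triple (f s) (g s) (h s) i) (eval w (triple a b d i)).
Proof. by move=> ? ? ? [|[|i]]. Qed.

Definition dS := triple (C 0) (C 1) (C 0).
Definition dc := triple (C 1) (C 0) (C 0).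

(** Uniqueness of derivatives transfers the sign found in [is_derive_period_map] to the syntactic
    derivative, by moving coordinate 1 of v alone. *)
Lemma eval_dS_EPeriod_lt0 v : wave_dom v -> eval v (der dS EPeriod) < 0.
Proof.
move=> adm; have [d d0 hd] := is_derive_period_map adm.
pose w (s : R) (i : nat) : R := if i == 1%N then s else v i.
have wv : w (v 1%N) = v.
  by apply/funext => i; rewrite /w; case: eqP => [->|].
have h : is_derive (v 1%N) 1 (fun s => eval (w s) EPeriod)
    (eval (w (v 1%N)) (der dS EPeriod)).
  apply: (is_derive_eval ok_EPeriod); rewrite ?wv// => -[|[|i]] /=.
  - exact: is_derive_cst.
  - exact: is_derive_id.
  - exact: is_derive_cst.
have e : (fun s => eval (w s) EPeriod) = period_map (v 0%N).
  by apply/funext => s; rewrite eval_EPeriod.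
by rewrite e wv in h; rewrite (is_derive_uniq h hd).
Qed.

Lemma ok_triple (a b d : @expr R) : ok wave_dom a -> ok wave_dom b -> ok wave_dom d ->
  forall i, ok wave_dom (triple a b d i).
Proof. by move=> ? ? ? [|[|i]]. Qed.

(* The derivatives of S in c along the branch, and of the angle in c and in x. *)
Definition ESigma := Opp (Mul (der dc EPeriod) (Inv (der dS EPeriod))).
Definition EAngle_x := Mul ESpeed EDelta.
Definition EAngle_c :=
  Opp (Mul (der (triple (C 1) ESigma (C 0)) EPhase) EAngle_x).

Lemma ok_ESigma : ok wave_dom ESigma.
Proof.
apply/ok_Opp/ok_Mul; first by apply: ok_der ok_EPeriod; exact: ok_triple.
apply: ok_Inv; first by apply: ok_der ok_EPeriod; exact: ok_triple.
by move=> v /eval_dS_EPeriod_lt0/ltr0_neq0.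
Qed.

Lemma ok_EAngle_x : ok wave_dom EAngle_x.
Proof. by split; [exact: ok_ESpeed|exact: ok_EDelta]. Qed.

Lemma ok_EAngle_c : ok wave_dom EAngle_c.
Proof.
apply/ok_Opp/ok_Mul; last exact: ok_EAngle_x.
by apply: ok_der ok_EPhase; apply: ok_triple; [|exact: ok_ESigma|].
Qed.

(** Two vector fields on (c, S, angle): along the branch at fixed x for [along_c], and along the
    wave at fixed c for [along_x]. *)
Definition along_c := der (triple (C 1) ESigma EAngle_c).
Definition along_x := der (triple (C 0) (C 0) EAngle_x).

Lemma ok_along_c e : ok wave_dom e -> ok wave_dom (along_c e).
Proof.
by apply: ok_der; apply: ok_triple; [|exact: ok_ESigma|exact: ok_EAngle_c].
Qed.

Lemma ok_along_x e : ok wave_dom e -> ok wave_dom (along_x e).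
Proof. by apply: ok_der; apply: ok_triple; [| |exact: ok_EAngle_x]. Qed.

Lemma ok_iter f e n : (forall e, ok wave_dom e -> ok wave_dom (f e)) ->
  ok wave_dom e -> ok wave_dom (iter n f e).
Proof. by move=> h he; elim: n => //= n; exact: h. Qed.

Section Branch.
Variables (L : R) (J : set R) (sigma : R -> R).
Hypothesis openJ : open J.
Hypothesis sigmaP : forall c, J c ->
  admissible c (sigma c) /\ period_map c (sigma c) = L.

Let nearJ c : J c -> \forall c' \near c, J c'.
Proof. by move=> Jc; exact: open_nbhs_nbhs. Qed.

Lemma continuous_triple (T : topologicalType) (p : T) (f g h : T -> R) :
  {for p, continuous f} -> {for p, continuous g} -> {for p, continuous h} ->
  forall i, {for p, continuous (fun q => triple (f q) (g q) (h q) i)}.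
Proof. by move=> ? ? ? [|[|i]]. Qed.

(** At c the period is above L at sigma c - h and below L at sigma c + h. Both inequalities persist
    for c' near c, where strict decrease in S traps sigma c' between the two. *)
Lemma continuous_sigma c : J c -> {for c, continuous sigma}.
Proof.
move=> Jc; have [adm pE] := sigmaP Jc.
apply/cvgrPdist_lt => e e0.
have /nbhs_ballP[d /= d0 hd] := near_admissible_r adm.
pose h := Num.min e d / 2.
have md0 : 0 < Num.min e d by rewrite lt_min e0.
have h0 : 0 < h by rewrite divr_gt0.
have hmin : h < Num.min e d by rewrite /h; lra.
have [he hd'] : h < e /\ h < d.
  by move: hmin; rewrite lt_min => /andP[].
have a1 : admissible c (sigma c - h).
  by apply: hd; rewrite /ball /= opprB addrC subrK gtr0_norm.
have a2 : admissible c (sigma c + h).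
  by apply: hd; rewrite /ball /= opprD addNKr normrN gtr0_norm.
have cont S : admissible c S -> {for c, continuous (fun c' => period_map c' S)}.
  move=> admS.
  have -> : (fun c' => period_map c' S) = fun c' => eval (triple c' S 0) EPeriod.
    by apply/funext => c'; rewrite eval_EPeriod.
  apply: (continuous_eval ok_EPeriod) => //; apply: continuous_triple.
  - exact: cvg_id.
  - exact: cvg_cst.
  - exact: cvg_cst.
have p1 : L < period_map c (sigma c - h).
  by rewrite -pE; apply: period_map_decr => //; lra.
have p2 : period_map c (sigma c + h) < L.
  by rewrite -pE; apply: period_map_decr => //; lra.
have n1 : \forall c' \near c, L < period_map c' (sigma c - h).
  exact: (cvgr_gt _ (cont _ a1) _ p1).
have n2 : \forall c' \near c, period_map c' (sigma c + h) < L.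
  exact: (cvgr_lt _ (cont _ a2) _ p2).
have n3 := near_admissible_l a1.
have n4 := near_admissible_l a2.
have n5 := nearJ Jc.
near=> c'.
have Jc' : J c' by near: c'.
have [adm' pE'] := sigmaP Jc'.
have k1 : L < period_map c' (sigma c - h) by near: c'.
have k2 : period_map c' (sigma c + h) < L by near: c'.
have k3 : admissible c' (sigma c - h) by near: c'.
have k4 : admissible c' (sigma c + h) by near: c'.
have l1 : sigma c - h < sigma c'.
  rewrite ltNge le_eqVlt; apply/negP => /predU1P[e1|e1].
    by rewrite -e1 pE' ltxx in k1.
  by have := period_map_decr adm' k3 e1; rewrite pE' ltNge (ltW k1).
have l2 : sigma c' < sigma c + h.
  rewrite ltNge le_eqVlt; apply/negP => /predU1P[e1|e1].
    by rewrite e1 pE' ltxx in k2.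
  by have := period_map_decr k4 adm' e1; rewrite pE' ltNge (ltW k2).
by rewrite ltr_norml; apply/andP; split; lra.
Unshelve. all: by end_near. Qed.

(** The angle does not occur in [EPeriod], so any t may fill the third variable. *)
Lemma is_derive_sigma c t : J c ->
  is_derive c 1 sigma (eval (triple c (sigma c) t) ESigma).
Proof.
move=> Jc; have [adm pE] := sigmaP Jc.
have dom0 : wave_dom (triple c (sigma c) t) by [].
have n0 := eval_dS_EPeriod_lt0 dom0.
have okS : ok wave_dom (der dS EPeriod) by apply: ok_der ok_EPeriod; exact: ok_triple.
have h := @is_derive_implicit R period_map
  (fun c S => eval (triple c S t) (der dS EPeriod)) sigma c
  (eval (triple c (sigma c) t) (der dc EPeriod)) L.
apply: is_derive_eq; first apply: h.
- have -> : period_map^~ (sigma c) = fun c' => eval (triple c' (sigma c) t) EPeriod.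
    by apply/funext => c'; rewrite eval_EPeriod.
  by apply: (is_derive_eval ok_EPeriod) => //; exact: is_derive_triple.
- apply: filterS (near_admissible adm) => -[c' S'] /= adm'.
  have -> : period_map c' = fun S => eval (triple c' S t) EPeriod.
    by apply/funext => S; rewrite eval_EPeriod.
  by apply: (is_derive_eval ok_EPeriod) => //; exact: is_derive_triple.
- apply: (continuous_eval okS); [by []|apply: continuous_triple].
  + exact: cvg_fst.
  + exact: cvg_snd.
  + exact: cvg_cst.
- exact: ltr0_neq0.
- exact: continuous_sigma.
- by apply: filterS (nearJ Jc) => c' /sigmaP[].
by rewrite /ESigma eval_Opp eval_Mul eval_Inv mulNr.
Qed.

Definition angle c x : R := amplitude c (sigma c) x.
Definition point c x := triple c (sigma c) (angle c x).

Lemma continuous_angle c x : J c ->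
  {for (c, x), continuous (fun q : R * R => angle q.1 q.2)}.
Proof.
move=> Jc; have [adm _] := sigmaP Jc.
have c1 : {for (c, x), continuous (fun q : R * R => q.1)} by exact: cvg_fst.
have c2 : {for (c, x), continuous (fun q : R * R => q.2)} by exact: cvg_snd.
have cs : {for (c, x), continuous (fun q : R * R => sigma q.1)}.
  by apply: (@continuous_comp _ _ _ (@fst R R) sigma) => //; exact: continuous_sigma.
(* The third component is a filler: [EMsq] and [ESpeed] contain only the first two variables. *)
have ct := continuous_triple c1 cs c1.
have cm : {for (c, x), continuous (fun q : R * R => msq q.1 (sigma q.1))}.
  have -> : (fun q : R * R => msq q.1 (sigma q.1)) =
      fun q => eval (triple q.1 (sigma q.1) q.1) EMsq.
    by apply/funext => q; rewrite eval_EMsq.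
  exact: (continuous_eval ok_EMsq).
have cg : {for (c, x), continuous (fun q : R * R => wave_speed q.1 (sigma q.1))}.
  have -> : (fun q : R * R => wave_speed q.1 (sigma q.1)) =
      fun q => eval (triple q.1 (sigma q.1) q.1) ESpeed.
    by apply/funext => q; rewrite eval_ESpeed.
  exact: (continuous_eval ok_ESpeed).
apply: continuous_am => //=.
- exact/ltW/msq_gt0.
- exact: msq_lt1.
- exists (J, setT) => /=; first by split; [exact: nearJ|exact: filterT].
  by move=> [c' y] [/= Jc' _]; apply/ltW/msq_gt0; have [] := sigmaP Jc'.
- exact: continuousM.
Qed.

Lemma continuous_point e c x : ok wave_dom e -> J c ->
  {for (c, x), continuous (fun q : R * R => eval (point q.1 q.2) e)}.
Proof.
move=> oke Jc; have [adm _] := sigmaP Jc.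
apply: (continuous_eval oke); [by []|apply: continuous_triple].
- exact: cvg_fst.
- apply: (@continuous_comp _ _ _ (@fst R R) sigma); first exact: cvg_fst.
  exact: continuous_sigma.
- exact: continuous_angle.
Qed.

Lemma is_derive_point_x e c x : ok wave_dom e -> J c ->
  is_derive x 1 (fun x => eval (point c x) e) (eval (point c x) (along_x e)).
Proof.
move=> oke Jc; have [adm _] := sigmaP Jc.
apply: (is_derive_eval oke); [by []|apply: is_derive_triple].
apply: is_derive_eq (is_derive_amplitude adm x) _.
by rewrite eval_Mul eval_ESpeed eval_EDelta.
Qed.

Lemma angle_phase c x : J c -> eval (point c x) EPhase = x.
Proof.
move=> Jc; have [adm _] := sigmaP Jc.
rewrite eval_EPhase /= /angle /amplitude amK ?msq_lt1// ?ltW ?msq_gt0//.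
by rewrite mulrC mulKf// lt0r_neq0// wave_speed_gt0.
Qed.

(** Implicit differentiation of [EPhase] = x at fixed x. The derivative of the phase in the angle is
    1 / (speed Delta), so dividing by it is multiplying by [EAngle_x]. *)
Lemma is_derive_angle_c c x : J c ->
  is_derive c 1 (angle ^~ x) (eval (point c x) EAngle_c).
Proof.
move=> Jc; have [adm _] := sigmaP Jc.
have m1 := msq_lt1 adm.
pose EPhase_t := Mul (EllIntegrand 0 EMsq Vt) (Inv ESpeed).
have okt : ok wave_dom EPhase_t.
  split; first by apply: ok_EllIntegrand; case: ok_EPhase.
  by case: ok_EPhase.
have phE c' y : eval (triple c' (sigma c') y) EPhase_t =
   (ell_delta (msq c' (sigma c')) y)^-1 / wave_speed c' (sigma c').
  rewrite -[LHS]/(eval _ (EllIntegrand 0 EMsq Vt) / eval _ ESpeed).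
  by rewrite eval_EllIntegrand eval_EMsq eval_ESpeed ell_integrand0.
have s0 := lt0r_neq0 (wave_speed_gt0 adm).
have d0 := lt0r_neq0 (ell_delta_gt0 (angle c x) m1).
have h := @is_derive_implicit R
  (fun c y => eval (triple c (sigma c) y) EPhase)
  (fun c y => eval (triple c (sigma c) y) EPhase_t) (angle^~ x) c
  (eval (point c x) (der (triple (C 1) ESigma (C 0)) EPhase)) x.
apply: is_derive_eq; first apply: h.
- apply: (is_derive_eval ok_EPhase); [by []|apply: is_derive_triple].
  exact: is_derive_sigma.
- exists (J, setT) => /=; first by split; [exact: nearJ|exact: filterT].
  move=> [c' y] [/= Jc' _]; have [adm' _] := sigmaP Jc'.
  have -> : (fun y => eval (triple c' (sigma c') y) EPhase) =
     fun y => ell 0 (msq c' (sigma c')) y * (wave_speed c' (sigma c'))^-1.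
    by apply/funext => y'; rewrite eval_EPhase.
  apply: is_derive_eq (is_derive_mul (is_derive_ell 0 y (msq_lt1 adm')) (is_derive_const _ y)) _.
  by rewrite mulr0 addr0 phE ell_integrand0.
- apply: (continuous_eval okt); [by []|apply: continuous_triple].
  + exact: cvg_fst.
  + apply: (@continuous_comp _ _ _ (@fst R R) sigma); first exact: cvg_fst.
    exact: continuous_sigma.
  + exact: cvg_snd.
- by rewrite phE mulf_neq0// invr_eq0.
- have ca := @continuous_angle c x Jc.
  have cp : {for c, continuous (fun c' => (c', x))}.
    have h1 : c' @[c' --> c] --> c by exact: cvg_id.
    have h2 : (fun=> x) @ c --> x by exact: cvg_cst.
    exact: cvg_pair h1 h2.
  exact: (@continuous_comp _ _ _ (fun c' => (c', x)) (fun q : R * R => angle q.1 q.2)).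
- by apply: filterS (nearJ Jc) => c' Jc'; exact: angle_phase.
rewrite phE eval_Opp !eval_Mul eval_ESpeed eval_EDelta.
move: (eval _ _) s0 d0 => z; rewrite /=; set w := wave_speed _ _; set d := ell_delta _ _.
by move=> s0 d0; field; rewrite s0 d0.
Qed.

Lemma is_derive_point_c e c x : ok wave_dom e -> J c ->
  is_derive c 1 (fun c => eval (point c x) e) (eval (point c x) (along_c e)).
Proof.
move=> oke Jc; have [adm _] := sigmaP Jc.
apply: (is_derive_eval oke); [by []|apply: is_derive_triple].
- exact: is_derive_sigma.
- exact: is_derive_angle_c.
Qed.

End Branch.

End WaveExpressions.

(** * Smooth curves in periodic Sobolev spaces *)

Section PeriodicJets.
Context {R : realType}.
Variable L : R.
Hypothesis L0 : 0 < L.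
Local Notation mu := (@lebesgue_measure R).

(** All derivatives are carried along explicitly, to serve as witnesses for the weak derivatives in
    [Hper_norm]. *)
Definition periodic_jet (g : nat -> R -> R) : Prop :=
  periodic (g 0%N) L /\ forall j (x : R), is_derive x 1 (g j) (g j.+1 x).

Lemma periodic_derive (f df : R -> R) : periodic f L ->
  (forall x : R, is_derive x 1 f (df x)) -> periodic df L.
Proof.
move=> pf hf x.
have h := is_derive_comp (g := fun y => y + L) (hf (x + L))
  (is_derive_add (is_derive_id x 1) (is_derive_const L x)).
have e : (fun y => f (y + L)) = f by apply/funext => y; exact: pf.
rewrite e addr0 mulr1 in h.
exact: is_derive_uniq h (hf x).
Qed.

Lemma periodic_jet_shift g : periodic_jet g -> periodic_jet (fun j => g j.+1).
Proof. by move=> [pg hg]; split=> //; exact: periodic_derive (pg) (hg 0%N). Qed.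

Lemma periodic_jetD g j : periodic_jet g -> periodic (g j) L.
Proof. by elim: j g => [g []|j ih g /periodic_jet_shift/ih]. Qed.

Lemma continuous_jet g j : periodic_jet g -> continuous (g j).
Proof. by move=> [_ hg] x; exact: is_derive_continuous (hg j x). Qed.

Lemma derivable_LRcontinuous (f : R -> R) (a b : R) :
  (forall x : R, derivable f x 1) -> derivable_oo_LRcontinuous f a b.
Proof.
move=> hf; have cf x : {for x, continuous f}.
  by apply/differentiable_continuous/derivable1_diffP.
split; first by move=> x _; exact: hf.
  exact: cvg_at_right_filter (cf a).
exact: cvg_at_left_filter (cf b).
Qed.

Lemma derivable_continuous (f : R -> R) : (forall x : R, derivable f x 1) -> continuous f.
Proof. by move=> hf x; apply/differentiable_continuous/derivable1_diffP. Qed.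

Lemma periodic_derive1n psi j : test_per L psi -> periodic (derive1n j psi) L.
Proof.
move=> [pp dp]; elim: j => [//|j ih].
rewrite derive1nS; apply: periodic_derive ih _ => x.
by rewrite derive1E; apply/derivableP; exact: dp.
Qed.

(** Each integration by parts moves one derivative from psi to g; the boundary terms cancel by
    periodicity of both. The induction shifts the jet, hence it is over all g. *)
Lemma weak_derivative_jet g j : periodic_jet g -> weak_derivative_per L j (g 0%N) (g j).
Proof.
move=> + psi tpsi; elim: j g => [g _|j ih g jg]; first by rewrite mul1r.
have [pg hg] := jg; have [pp dp] := tpsi.
rewrite (@Rintegration_by_parts R (g 0%N) (derive1n j psi) (g 1%N)
  (derive1n j.+1 psi) 0 L) //.
- have -> : g 0%N L = g 0%N 0 by rewrite -(pg 0) add0r.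
  have -> : derive1n j psi L = derive1n j psi 0.
    by rewrite -(periodic_derive1n j tpsi 0) add0r.
  rewrite subrr sub0r (ih _ (periodic_jet_shift jg)) exprS mulN1r mulNr.
  by [].
- by apply: continuous_subspaceT; exact: continuous_jet.
- by apply: derivable_LRcontinuous => x; have [] := hg 0%N x.
- by move=> x _; rewrite derive1E; have [_ ->] := hg 0%N x.
- apply: continuous_subspaceT; apply: derivable_continuous => x; exact: dp.
- by apply: derivable_LRcontinuous => x; exact: dp.
Qed.

Lemma integral_sqr_le (f : R -> R) (e : R) : continuous f ->
  (forall x, 0 <= x <= L -> `|f x| <= e) ->
  (\int[mu]_(x in `[0%R, L]) ((f x) ^+ 2)%:E <= (e ^+ 2 * L)%:E)%E.
Proof.
move=> cf hf.
have -> : ((e ^+ 2 * L)%:E = \int[mu]_(x in `[0%R, L]) (e ^+ 2)%:E)%E.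
  rewrite integral_cst//= lebesgue_measure_itv /= lte_fin L0 EFinM.
  by rewrite oppr0 adde0.
have c2 : continuous (fun x => f x ^+ 2) by move=> x; apply: continuous_pow; exact: cf.
apply: ge0_le_integral => //.
- by move=> x _; rewrite lee_fin sqr_ge0.
- apply/measurable_EFinP; apply: measurable_funTS; exact: continuous_measurable_fun.
- move=> x; rewrite /= in_itv /= => /hf h.
  rewrite lee_fin -(real_normK (num_real (f x))).
  by rewrite lerXn2r ?nnegrE//; apply: le_trans h.
Qed.

Lemma L2per_jet g j : periodic_jet g -> L2per L (g j).
Proof.
move=> jg; have cg := continuous_jet jg (j := j); split.
- exact: continuous_measurable_fun.
- exact: periodic_jetD.
- have c2 : continuous (fun x => g j x ^+ 2).
    by move=> x; apply: continuous_pow; exact: cg.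
  apply: integrable_lty; first exact: measurable_itv.
  exact: integrable_segment 0 L c2.
Qed.

Lemma Hper_norm_ge0 n f : (0 <= Hper_norm L n f)%E.
Proof. exact: sqrte_ge0. Qed.

Lemma Hper_norm_jet_le n g (e : R) : periodic_jet g -> 0 <= e ->
  (forall j x, (j <= n)%N -> 0 <= x <= L -> `|g j x| <= e) ->
  (Hper_norm L n (g 0%N) <= (Num.sqrt (n.+1%:R * (e ^+ 2 * L)))%:E)%E.
Proof.
move=> jg e0 hg.
have b0 : 0 <= n.+1%:R * (e ^+ 2 * L) by rewrite !mulr_ge0 ?sqr_ge0// ltW.
rewrite -[leRHS]/(sqrte (n.+1%:R * (e ^+ 2 * L))%:E) lee_sqrt ?lee_fin//.
apply: ge_ereal_inf; eexists.
  exists g => //= j _; split; [exact: L2per_jet|exact: weak_derivative_jet].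
have -> : ((n.+1%:R * (e ^+ 2 * L))%:E = \sum_(0 <= j < n.+1) (e ^+ 2 * L)%:E)%E.
  by rewrite sumEFin big_const_nat iter_addr_0 subn0 mulr_natl.
rewrite !big_nat; apply: lee_sum => j /andP[_ jn].
by apply: integral_sqr_le => [|x hx]; [exact: continuous_jet|exact: hg].
Qed.

Lemma Hper_norm_jet_lty n g : periodic_jet g -> (Hper_norm L n (g 0%N) < +oo)%E.
Proof.
move=> jg.
have bd j : exists B, forall x, 0 <= x <= L -> `|g j x| <= B.
  have [x _ hx] : exists2 x, x \in `[0, L] & forall t, t \in `[0, L] -> `|g j t| <= `|g j x|.
    apply: (@EVT_max R (fun x => `|g j x|)); first exact: ltW.
    apply: continuous_subspaceT => x; apply: continuous_comp.
      exact: continuous_jet.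
    exact: norm_continuous.
  by exists `|g j x| => t ht; apply: hx; rewrite in_itv.
have [B hB] := choice bd.
pose e := \sum_(0 <= j < n.+1) `|B j|.
have e0 : 0 <= e by apply: sumr_ge0.
apply: le_lt_trans (Hper_norm_jet_le jg e0 _) (ltry _).
move=> j x jn hx; apply: le_trans (hB j x hx) _.
apply: le_trans (ler_norm _) _.
rewrite /e big_mkord (bigD1 (Ordinal (jn : (j < n.+1)%N))) //=.
by rewrite lerDl sumr_ge0.
Qed.

Lemma Hper_jet n g : periodic_jet g -> Hper L n (g 0%N).
Proof. by move=> jg; split; [exact: L2per_jet|exact: Hper_norm_jet_lty]. Qed.

End PeriodicJets.

(** * Mixed derivatives, uniform convergence and smooth curves *)

Section SmoothCurves.
Context {R : realType}.

(** The second difference over a square of side h, computed by mean values in either order, is h^2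
    times each mixed derivative at some point of the square; continuity at the corner identifies the
    two. *)
Lemma schwarz (f fc fx fcx fxc : R -> R -> R) (c0 x0 d : R) : 0 < d ->
  (forall c x : R, `|c - c0| < d -> is_derive c 1 (f ^~ x) (fc c x)) ->
  (forall c x : R, `|c - c0| < d -> is_derive x 1 (f c) (fx c x)) ->
  (forall c x : R, `|c - c0| < d -> is_derive c 1 (fx ^~ x) (fxc c x)) ->
  (forall c x : R, `|c - c0| < d -> is_derive x 1 (fc c) (fcx c x)) ->
  {for (c0, x0), continuous (fun q : R * R => fcx q.1 q.2)} ->
  {for (c0, x0), continuous (fun q : R * R => fxc q.1 q.2)} ->
  fcx c0 x0 = fxc c0 x0.
Proof.
move=> d0 hc hx hxc hcx c1 c2.
apply/eqP; rewrite -subr_eq0 -normr_le0; apply/ler_addgt0Pr => e e0.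
rewrite add0r.
have e2 : 0 < e / 2 by rewrite divr_gt0.
have /cvgrPdist_lt/(_ _ e2) n1 := c1.
have /cvgrPdist_lt/(_ _ e2) n2 := c2.
have [[A B] /= [/nbhs_ballP[d1 /= d10 hA] /nbhs_ballP[d2 /= d20 hB]] AB] := filterI n1 n2.
pose h := Num.min d (Num.min d1 d2) / 2.
have m0 : 0 < Num.min d (Num.min d1 d2) by rewrite !lt_min d0 d10.
have h0 : 0 < h by rewrite divr_gt0.
have hm : h < Num.min d (Num.min d1 d2) by rewrite /h; lra.
have [hd [h1 h2]] : h < d /\ h < d1 /\ h < d2.
  by move: hm; rewrite !lt_min => /andP[? /andP[]].
have Ac c : c0 <= c <= c0 + h -> A c /\ `|c - c0| < d.
  move=> /andP[k1 k2]; split; last by rewrite ger0_norm; lra.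
  by apply: hA; rewrite /ball /= distrC ger0_norm; lra.
have Bx x : x0 <= x <= x0 + h -> B x.
  by move=> /andP[k1 k2]; apply: hB; rewrite /ball /= distrC ger0_norm; lra.
have mm a : (Num.min a (a + h) = a) * (Num.max a (a + h) = a + h).
  by rewrite min_l ?max_r// lerDl ltW.
pose D := f (c0 + h) (x0 + h) - f (c0 + h) x0 - (f c0 (x0 + h) - f c0 x0).
have [c [x [hc1 hx1 E1]]] : exists c x, [/\ c0 <= c <= c0 + h, x0 <= x <= x0 + h &
    D = fcx c x * h * h].
  have [|c] := @MVT_gen R (fun c => f c (x0 + h) - f c x0)
      (fun c => fc c (x0 + h) - fc c x0) c0 (c0 + h).
    rewrite !mm => c /Ac[_ k]; apply: is_derive_sub; exact: hc.
  rewrite !mm => /[dup] hc1 /Ac[_ k] E.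
  have [|x] := @MVT_gen R (fc c) (fcx c) x0 (x0 + h).
    by move=> x _; exact: hcx.
  rewrite !mm => hx1 E'.
  exists c, x; split=> //; rewrite /D.
  have -> : f (c0 + h) (x0 + h) - f (c0 + h) x0 - (f c0 (x0 + h) - f c0 x0) =
    (fc c (x0 + h) - fc c x0) * (c0 + h - c0) by exact: E.
  by rewrite E'; ring.
have [c' [x' [hc2 hx2 E2]]] : exists c x, [/\ c0 <= c <= c0 + h, x0 <= x <= x0 + h &
    D = fxc c x * h * h].
  have c00 : `|c0 - c0| < d by rewrite subrr normr0.
  have c0h : `|c0 + h - c0| < d by rewrite ger0_norm; lra.
  have [|z] := @MVT_gen R (fun x => f (c0 + h) x - f c0 x)
      (fun x => fx (c0 + h) x - fx c0 x) x0 (x0 + h).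
    by move=> z _; apply: is_derive_sub; exact: hx.
  rewrite !mm => hx1' E.
  have [|c'] := @MVT_gen R (fx ^~ z) (fxc ^~ z) c0 (c0 + h).
    by rewrite !mm => c' /Ac[_ k]; exact: hxc.
  rewrite !mm => hc1' E'.
  exists c', z; split=> //; rewrite /D.
  have -> : f (c0 + h) (x0 + h) - f (c0 + h) x0 - (f c0 (x0 + h) - f c0 x0) =
    (fx (c0 + h) z - fx c0 z) * (x0 + h - x0) by rewrite -E; ring.
  by rewrite E'; ring.
have E : fcx c x = fxc c' x'.
  have h00 := lt0r_neq0 h0.
  by apply: (mulIf h00); apply: (mulIf h00); rewrite -E1 -E2.
have k1 := (AB (c, x) (conj (Ac _ hc1).1 (Bx _ hx1))).1.
have k2 := (AB (c', x') (conj (Ac _ hc2).1 (Bx _ hx2))).2.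
rewrite /= in k1 k2.
have -> : fcx c0 x0 - fxc c0 x0 = (fcx c0 x0 - fcx c x) - (fxc c0 x0 - fxc c' x').
  by rewrite E; ring.
rewrite (le_trans (ler_normB _ _))//.
by rewrite [leRHS](splitr e) lerD// ltW.
Qed.

(** Near each x of the segment, both [G y x'] and [G c x'] are compared with [G c x]; compactness
    makes the neighbourhood of c independent of x. *)
Lemma uniform_near_segment (G : R -> R -> R) (c L e : R) : 0 < e ->
  (forall x : R, {for (c, x), continuous (fun q : R * R => G q.1 q.2)}) ->
  \forall y \near c, forall x, 0 <= x <= L -> `|G y x - G c x| < e.
Proof.
move=> e0 cG; have e2 : 0 < e / 2 by rewrite divr_gt0.
have /compact_near_coveringP cov := @segment_compact R 0 L.
have H := cov R (nbhs c) (fun y x => `|G y x - G c x| < e) (nbhs_filter c).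
apply: filterS (H _) => [y hy x hx|x _].
  by apply: hy; rewrite /= in_itv.
have /cvgrPdist_lt/(_ _ e2)[[A B] /= [hA hB] AB] := cG x.
exists (B, A) => //= -[x' y] /= [Bx' Ay].
have k1 := AB (y, x') (conj Ay Bx').
have k2 := AB (c, x') (conj (nbhs_singleton hA) Bx').
rewrite /= in k1 k2.
have -> : G y x' - G c x' = (G c x - G c x') - (G c x - G y x') by ring.
by rewrite (le_lt_trans (ler_normB _ _))// [ltRHS](splitr e) ltrD.
Qed.

(** [G m j] stands for the derivative of order m in c and j in x. The hypotheses allow
    differentiation in either variable at every stage, which contains the commutation of mixed
    derivatives. *)
Variables (L : R) (J : set R) (G : nat -> nat -> R -> R -> R).
Hypotheses (L0 : 0 < L) (openJ : open J).
Hypothesis derx : forall m j c (x : R), J c -> is_derive x 1 (G m j c) (G m j.+1 c x).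
Hypothesis derc : forall m j (c x : R), J c ->
  is_derive c 1 (fun c => G m j c x) (G m.+1 j c x).
Hypothesis contG : forall m j (c x : R), J c ->
  {for (c, x), continuous (fun q : R * R => G m j q.1 q.2)}.
Hypothesis perG : forall c, J c -> periodic (G 0%N 0%N c) L.

(** Periodicity in x passes to derivatives in c: the functions of c at x and at x + L coincide near
    c, hence so do their derivatives. *)
Lemma jet_curve m c : J c -> periodic_jet L (fun j => G m j c).
Proof.
elim: m c => [|m ih] c Jc; first by split; [exact: perG|move=> j x; exact: derx].
split; last by move=> j x; exact: derx.
move=> x; have h1 := derc m 0 x Jc; have h2 := derc m 0 (x + L) Jc.
apply: (is_derive_uniq h2); apply: near_eq_is_derive h1.
have nJ : \forall y \near c, J y by exact: open_nbhs_nbhs.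
apply: filterS nJ => c' Jc'; apply/esym.
by have [pg _] := ih c' Jc'; exact: pg.
Qed.

Lemma near_ball (P : R -> Prop) (c : R) : (\forall y \near c, P y) ->
  exists2 d : R, 0 < d & forall y : R, ball c d y -> P y.
Proof. by move=> /nbhs_ballP[d /= d0 hd]; exists d. Qed.

(** By the mean value theorem the quotient is the next derivative at an intermediate speed. That
    speed depends on j and x, so the next derivative has to be close to its value at c uniformly in
    both. *)
Lemma near_quotient n m c (e : R) : 0 < e -> J c ->
  \forall y \near c, J y /\ (y != c -> forall j x, (j <= n)%N -> 0 <= x <= L ->
    `|(G m j y x - G m j c x) / (y - c) - G m.+1 j c x| < e).
Proof.
move=> e0 Jc.
have U : \forall y \near c, forall j, (j <= n)%N -> forall x, 0 <= x <= L ->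
    `|G m.+1 j y x - G m.+1 j c x| < e.
  elim: n => [|n ih].
    have := uniform_near_segment L e0 (fun x => @contG m.+1 0 c x Jc).
    by apply: filterS => y hy [|//] _; exact: hy.
  have := uniform_near_segment L e0 (fun x => @contG m.+1 n.+1 c x Jc).
  apply: filterS2 ih => y h1 h2 j; rewrite leq_eqVlt => /predU1P[->|]; first exact: h2.
  by rewrite ltnS; exact: h1.
have nJ : \forall y \near c, J y by exact: open_nbhs_nbhs.
have [d d0 hd] := near_ball (filterI nJ U).
apply/nbhs_ballP; exists d => //= y yd.
have bd z : Num.min c y <= z <= Num.max c y -> ball c d z.
  move: yd; rewrite /ball /= !ltr_norml minElt maxElt.
  clear -d0; case: (ltP c y) => k /andP[k1 k2] /andP[k3 k4]; apply/andP; split.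
  - by lra.
  - by lra.
  - by lra.
  - by lra.
split; first exact: (hd _ yd).1.
move=> yc j x jn hx.
have [|z hz ->] := @MVT_gen R (fun c => G m j c x) (fun c => G m.+1 j c x) c y.
  by move=> z /bd /hd[Jz _]; exact: derc.
rewrite mulfK ?subr_eq0//.
by have [_ h] := hd _ (bd _ hz); exact: h.
Qed.

Lemma smooth_into_Hper_family n (I : set R) : I `<=` J ->
  smooth_into_Hper L n I (G 0%N 0%N).
Proof.
move=> IJ; exists (fun m => G m 0%N); split=> [//|m c /IJ Jc|m c /IJ Jc].
  exact: (Hper_jet L0 n (jet_curve m Jc)).
suff H : Hper_norm L n (fun x => (G m 0%N y x - G m 0%N c x) / (y - c) - G m.+1 0%N c x)
    @[y --> c^'] --> 0%E.
  by apply: cvg_trans H; apply: cvg_app; exact: cvg_within.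
have B (e : R) : 0 < e -> \forall y \near c^',
    (Hper_norm L n (fun x => (G m 0%N y x - G m 0%N c x) / (y - c) - G m.+1 0%N c x)%R
      <= (e / 2)%:E)%E.
  move=> e0; have c0 : 0 < n.+1%:R * L by rewrite mulr_gt0.
  (* Chosen so that the bound of [Hper_norm_jet_le] at e' is exactly e / 2. *)
  pose e' := e / 2 / Num.sqrt (n.+1%:R * L).
  have e'0 : 0 < e' by rewrite !divr_gt0// sqrtr_gt0.
  have := near_quotient n m e'0 Jc => H.
  near=> y.
  have yc : y != c by near: y; exact: nbhs_dnbhs_neq.
  have [Jy hy] : J y /\ (y != c -> forall j x, (j <= n)%N -> 0 <= x <= L ->
    `|(G m j y x - G m j c x) / (y - c) - G m.+1 j c x| < e').
    by near: y; exact: nbhs_dnbhs H.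
  (* For fixed y the error of the quotient is itself a jet in x, so the bound on the norm applies to
     it. *)
  have jet : periodic_jet L (fun j x => (G m j y x - G m j c x) / (y - c) - G m.+1 j c x).
    split.
      move=> x /=; have [py _] := jet_curve m Jy; have [pc _] := jet_curve m Jc.
      by have [pc' _] := jet_curve m.+1 Jc; rewrite py pc pc'.
    move=> j x; apply: is_derive_eq (is_derive_sub (is_derive_mul (is_derive_sub
      (derx m j x Jy) (derx m j x Jc)) (is_derive_const (y - c)^-1 x)) (derx m.+1 j x Jc)) _.
    by rewrite mulr0 addr0.
  apply: le_trans (Hper_norm_jet_le L0 jet (ltW e'0) _) _.
    by move=> j x jn hx; apply/ltW/hy.
  rewrite lee_fin (_ : n.+1%:R * _ = (e / 2) ^+ 2).
    by rewrite sqrtr_sqr ger0_norm// ltW// divr_gt0.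
  rewrite /e' expr_div_n sqr_sqrtr ?ltW//; field.
  by rewrite (lt0r_neq0 L0) lt0r_neq0// ltr_pwDl.
apply/fine_cvgP; split.
  apply: filterS (B 1 ltr01) => y h; rewrite ge0_fin_numE ?Hper_norm_ge0//.
  exact: le_lt_trans h (ltry _).
apply/cvgrPdist_lt => e e0; apply: filterS (B e e0) => y h.
rewrite sub0r normrN ger0_norm ?fine_ge0 ?Hper_norm_ge0//=.
apply: (@le_lt_trans _ _ (e / 2)); last by lra.
by rewrite -[leRHS]/(fine (e / 2)%:E) fine_le// ge0_fin_numE ?Hper_norm_ge0// (le_lt_trans h)// ltry.
Unshelve. all: by end_near. Qed.

End SmoothCurves.

(** * The branch of speeds *)

Section SmoothBranch.
Context {R : realType}.
Variables (L : R) (J : set R) (sigma : R -> R).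
Hypothesis openJ : open J.
Hypothesis sigmaP : forall c, J c ->
  admissible c (sigma c) /\ period_map c (sigma c) = L.

#[local] Arguments eval : simpl never.
#[local] Arguments der : simpl never.
Opaque EMsq ESpeed EDelta EPeriod EPhase EShape EAlpha along_c along_x.

(** The two orders of differentiation give different terms; their values at points of the branch
    agree by Schwarz, both mixed derivatives being continuous. *)
Lemma along_commute e c x : ok wave_dom e -> J c ->
  eval (point sigma c x) (along_c (along_x e)) =
  eval (point sigma c x) (along_x (along_c e)).
Proof.
move=> oke Jc.
have nJ : \forall y \near c, J y by exact: open_nbhs_nbhs.
have [d d0 hd] := near_ball nJ.
have bJ c' : `|c' - c| < d -> J c' by move=> h; apply: hd; rewrite /ball /= distrC.
have okx := ok_along_x oke; have okc := ok_along_c oke.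
apply/esym; apply: (@schwarz _ (fun c x => eval (point sigma c x) e)
  (fun c x => eval (point sigma c x) (along_c e))
  (fun c x => eval (point sigma c x) (along_x e))
  (fun c x => eval (point sigma c x) (along_x (along_c e)))
  (fun c x => eval (point sigma c x) (along_c (along_x e))) c x d d0).
- by move=> c' x' /bJ Jc'; exact: (is_derive_point_c openJ sigmaP).
- by move=> c' x' /bJ Jc'; exact: (is_derive_point_x sigmaP).
- by move=> c' x' /bJ Jc'; exact: (is_derive_point_c openJ sigmaP).
- by move=> c' x' /bJ Jc'; exact: (is_derive_point_x sigmaP).
- exact: (continuous_point openJ sigmaP (ok_along_x okc)).
- exact: (continuous_point openJ sigmaP (ok_along_c okx)).
Qed.

(** The family used for the wave applies [along_x] outermost, so a further derivative in c has to be
    moved inside all of these. *)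
Lemma along_iter_commute e j c x : ok wave_dom e -> J c ->
  eval (point sigma c x) (along_c (iter j along_x e)) =
  eval (point sigma c x) (iter j along_x (along_c e)).
Proof.
move=> oke Jc; elim: j x => [//|j ih] x; rewrite !iterS.
have okj := ok_iter j ok_along_x oke.
rewrite along_commute//.
have h1 := is_derive_point_x sigmaP x (ok_along_c okj) Jc.
have h2 := is_derive_point_x sigmaP x (ok_iter j ok_along_x (ok_along_c oke)) Jc.
apply: (is_derive_uniq h1).
have -> : (fun x => eval (point sigma c x) (along_c (iter j along_x e))) =
  fun x => eval (point sigma c x) (iter j along_x (along_c e)) by apply/funext => y.
exact: h2.
Qed.

Lemma smooth_on_branch I : I `<=` J -> smooth_on I (fun c => alpha4_of c (sigma c)).
Proof.
(* The position 0 is arbitrary: [EAlpha] does not contain the angle. *)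
move=> IJ; exists (fun n c => eval (point sigma c 0) (iter n along_c EAlpha)).
split=> [c _|n c /IJ Jc]; first exact: eval_EAlpha.
have oke := ok_iter n ok_along_c (@ok_EAlpha R).
have /is_derive_quotient h := is_derive_point_c openJ sigmaP 0 oke Jc.
by rewrite iterS; apply: cvg_trans h; apply: cvg_app; exact: cvg_within.
Qed.

Lemma smooth_wave_branch I n : 0 < L -> I `<=` J ->
  smooth_into_Hper L n I (fun c => dnoidal (alpha4_of c (sigma c)) c).
Proof.
move=> L0 IJ.
pose E m j := iter j (@along_x R) (iter m along_c EShape).
have okE m j : ok wave_dom (E m j).
  by apply: ok_iter; [exact: ok_along_x|apply: ok_iter; [exact: ok_along_c|exact: ok_EShape]].
pose G m j c x := eval (point sigma c x) (E m j).
have [||||D [D0 HD DD]] := @smooth_into_Hper_family R L J G L0 openJ _ _ _ _ n I IJ.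
- by move=> m j c x Jc; exact: (is_derive_point_x sigmaP).
- move=> m j c x Jc.
  apply: is_derive_eq (is_derive_point_c openJ sigmaP x (okE m j) Jc) _.
  by rewrite along_iter_commute//; apply: ok_iter; [exact: ok_along_c|exact: ok_EShape].
- by move=> m j c x Jc; exact: (continuous_point openJ sigmaP (okE m j) Jc).
- move=> c Jc; have [adm pE] := sigmaP Jc.
  have -> : G 0%N 0%N c = fun x => wave_shape c (sigma c) (amplitude c (sigma c) x).
    by apply/funext => x; rewrite /G eval_EShape.
  by rewrite -pE; exact: periodic_wave.
exists D; split=> // c Ic; have [adm _] := sigmaP (IJ _ Ic).
rewrite D0// dnoidal_funE//.
by apply/funext => x; rewrite /G eval_EShape.
Qed.

End SmoothBranch.

(** * The range of admissible speeds *)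

Section SpeedRange.
Context {R : realType}.
Implicit Types L c a : R.

(** For L > 0 it says that the limit of the period at k = 0 is below L. Negative speeds are
    included, so that a neighbourhood of 0 belongs to this set whenever 0 does. *)
Definition speeds L : set R :=
  [set c | L ^+ 2 < Num.sqrt (sc c) * (L ^+ 2 - 4 * pi ^+ 2)].

Definition branch L c : R :=
  xget 0 [set S | admissible c S /\ period_map c S = L].

Lemma open_speeds L : open (speeds L).
Proof.
have cs : continuous (@sc R).
  move=> c; exact: is_derive_continuous (is_derive_sub (is_derive_const 5 c)
    (is_derive_mul (is_derive_const 4 c) (is_derive_pow 2 (is_derive_id c 1)))).
apply: (@open_comp R R (fun c => Num.sqrt (sc c) * (L ^+ 2 - 4 * pi ^+ 2))
  [set y | L ^+ 2 < y]); last exact: open_gt.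
move=> c _.
apply: (@continuousM _ _ (fun c => Num.sqrt (sc c)) (cst (L ^+ 2 - 4 * pi ^+ 2))).
  by apply: (@continuous_comp _ _ _ (@sc R) Num.sqrt); [exact: cs|exact: sqrt_continuous].
exact: cvg_cst.
Qed.

Lemma branchP L c : 0 < L -> speeds L c ->
  admissible c (branch L c) /\ period_map c (branch L c) = L.
Proof.
move=> L0 /(period_map_surj L0)[S adm pE].
by apply: (xgetPex 0 (P := [set S | admissible c S /\ period_map c S = L])); exists S.
Qed.

Lemma branch_uniq L c a : 0 < L -> speeds L c -> alpha4_range c a ->
  period a c = L -> a = alpha4_of c (branch L c).
Proof.
move=> L0 /(branchP L0)[adm pE] /alpha4_range_admissible[S admS ->].
by rewrite period_mapE// => pS; rewrite (period_map_inj admS adm)// pS pE.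
Qed.

(** The square root is at least 1, hence L > 2 pi, which makes the denominator L^2 - 4 pi^2 in
    [cmax] positive. *)
Lemma length_bounds L : 2 * pi * Num.sqrt (Num.sqrt 5 / (Num.sqrt 5 - 1)) < L ->
  0 < L /\ 4 * pi ^+ 2 < L ^+ 2.
Proof.
move=> hL; have p0 : 0 < pi :> R := pi_gt0 R.
have s5 : 1 < Num.sqrt 5 :> R by rewrite -{1}(sqrtr1 R) ltr_sqrt//; lra.
have h1 : 1 <= Num.sqrt (Num.sqrt 5 / (Num.sqrt 5 - 1)) :> R.
  rewrite -{1}(sqrtr1 R) ler_sqrt// ?divr_ge0//; try lra.
  by rewrite ler_pdivlMr; lra.
have h2 : 2 * pi < L by apply: le_lt_trans hL; rewrite ler_peMr//; lra.
by split; [lra|nra].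
Qed.

(** With d = L^2 - 4 pi^2, squaring c < [cmax L] gives (L^2 / d)^2 < 5 - 4 c^2 = s, and the square
    root of this is the defining condition of [speeds]. *)
Lemma cmax_speeds L : 0 < L -> 4 * pi ^+ 2 < L ^+ 2 -> 0 < cmax L ->
  `[0, cmax L[ `<=` speeds L.
Proof.
move=> L0 hL hc c; rewrite /= in_itv /= => /andP[c0 cc].
rewrite /speeds /=; set d := L ^+ 2 - 4 * pi ^+ 2.
have d0 : 0 < d by rewrite /d; lra.
rewrite -ltr_pdivrMr//.
have q : L ^+ 4 / d ^+ 2 = (L ^+ 2 / d) ^+ 2 by rewrite expr_div_n -exprM.
have q0 : 0 < L ^+ 2 / d by rewrite divr_gt0// exprn_gt0.
have key : (L ^+ 2 / d) ^+ 2 < sc c.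
  move: cc hc; rewrite /cmax -/d q /sc; set z := Num.sqrt _ => cc hc.
  have z0 : 0 < z by lra.
  (* Positivity of z excludes a negative radicand, for which the square root would be 0. *)
  have : z ^+ 2 = 5 - (L ^+ 2 / d) ^+ 2.
    by rewrite sqr_sqrtr// ltW// -sqrtr_gt0.
  by set w := (L ^+ 2 / d) ^+ 2; nra.
rewrite -[ltLHS]ger0_norm ?(ltW q0)// -sqrtr_sqr ltr_sqrt//.
exact: le_lt_trans (sqr_ge0 _) key.
Qed.

Lemma speeds_lt1 L c : 0 < L -> speeds L c -> 0 <= c -> c < 1.
Proof. by move=> L0 /(branchP L0)[/adm_rc_gt0 + _] c0; rewrite /rc; nra. Qed.

Lemma dnoidal_branch_speeds L c0 (I : set R) : 0 < L -> interval_around c0 I ->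
  I `<=` speeds L -> I `<=` `[0, 1[ ->
  dnoidal_branch_on L c0 (alpha4_of c0 (branch L c0)) I.
Proof.
move=> L0 aI IJ I1; split=> //.
have sP c : speeds L c -> _ := branchP L0.
(* The whole line serves as I2: at each speed [branch_uniq] determines the value in the range with
   period L, so uniqueness of the branch is pointwise. *)
exists setT, (fun c => alpha4_of c (branch L c)); split.
- by split; [by move=> ? ? ? ? ?|exact: filterT].
- split=> // [|c /IJ/sP[adm pE]]; first exact: (smooth_on_branch (@open_speeds L) sP).
  by rewrite period_mapE//; split=> //; exact: adm_alpha4_range.
- move=> Lam' [_ _ _ h] c Ic; have [r pE] := h c Ic.
  exact: branch_uniq (IJ _ Ic) r pE.
- move=> c /IJ/sP[adm pE]; split.
  + by rewrite adm_modulus_sq// msq_gt0// msq_lt1.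
  + by have := dnoidal_fundamental_period adm; rewrite pE.
  + exact: dnoidal_solves.
- by move=> n; exact: (smooth_wave_branch (@open_speeds L) sP).
Qed.

End SpeedRange.

Theorem theorem2p2 (R : realType) (L c0 : R)
  (hL : 2 * pi * Num.sqrt (Num.sqrt 5 / (Num.sqrt 5 - 1)) < L)
  (hc0 : 0 < c0 < cmax L) :
  (exists! a0 : R, alpha4_range c0 a0 /\ period a0 c0 = L) /\
  (forall a0 : R, alpha4_range c0 a0 -> period a0 c0 = L ->
     (exists I1 : set R, dnoidal_branch_on L c0 a0 I1) /\
     dnoidal_branch_on L c0 a0 `[0, cmax L[).
Proof.
have [L0 hL2] := length_bounds hL.
have [c00 c0m] := andP hc0.
have IJ := cmax_speeds L0 hL2 (lt_trans c00 c0m).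
have Ic0 : `[0, cmax L[%classic c0 by rewrite /= in_itv /= ltW.
have Jc0 := IJ _ Ic0.
have [adm pE] := branchP L0 Jc0.
split.
  exists (alpha4_of c0 (branch L c0)); split=> [|a [ra pa]].
    by split; [exact: adm_alpha4_range|rewrite period_mapE].
  by apply/esym/branch_uniq.
move=> a0 ra pa; rewrite (branch_uniq L0 Jc0 ra pa).
suff B : dnoidal_branch_on L c0 (alpha4_of c0 (branch L c0)) `[0, cmax L[.
  by split=> //; exists `[0, cmax L[%classic.
apply: dnoidal_branch_speeds => //.
- split; first exact: interval_is_interval.
  have : c0 \in `]0, cmax L[ by rewrite in_itv /= c00.
  move=> /near_in_itvoo; apply: filterS => c; rewrite /= !in_itv /= => /andP[? ->].
  by rewrite andbT ltW.
- move=> c Ic; have := Ic; rewrite /= !in_itv /= => /andP[c1 _].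
  by rewrite c1 (speeds_lt1 L0 (IJ _ Ic)).
Qed.
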